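(* Let $n\ge 1$. Let $\mathcal{D}'$ be the sheaf of real-valued Schwartz distributions on $\mathbb{R}^n$, let $\lambda:\mathcal{C}^0\to\mathcal{D}'$ be the canonical inclusion of continuous functions into distributions, and let $D_k:\mathcal{D}'\to\mathcal{D}'$ ($k=1,\dots,n$) be the distributional partial derivatives. Consider the problem $\mathcal{P}(H,j,(\delta_k)_{k})$ given by the following conditions: (i) $H:(\mathbb{R}^n)^{\mathrm{op}}\to\mathbf{Vect}_{\mathbb{R}}$ is a sheaf of real vector spaces on $\mathbb{R}^n$. (ii) $j:\mathcal{C}^0\to H$ is a sheaf morphism. (iii) $\delta_k:H\to H$, $k=1,\dots,n$, are sheaf morphisms compatible with partial derivatives of $\mathcal{C}^1_k$ functions: $\delta_k\circ j\circ\iota_k=j\circ\partial_k$ for all $k=1,\dots,n$. (iv) For every $\alpha\in\mathbb{N}^n$, every $n$-dimensional interval $U$ and every $f\in\mathcal{C}^0(U)$: if $f=\theta_1+\dots+\theta_n$, where each $\theta_k$ is a polynomial in $x_k$ of degree $<\alpha_k$ whose coefficients are continuous functions on $U$ independent of $x_k$, then $\delta_U^\alpha(j_U(f))=0$. (v) $\delta_h\circ\delta_k=\delta_k\circ\delta_h$ for all $h,k=1,\dots,n$. Then $(\mathcal{D}',\lambda,(D_k)_k)$ is a co-universal solution of $\mathcal{P}$ with respect to the property of preserving embeddings and derivatives. That is, $(\mathcal{D}',\lambda,(D_k)_k)$ satisfies (i)-(v), and for every $(H,j,(\delta_k)_k)$ satisfying (i)-(v) there exists one and only one sheaf morphism $\psi:\mathcal{D}'\to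 H$ such that $\psi\circ\lambda=j$ and $\psi\circ D_k=\delta_k\circ\psi$ for all $k=1,\dots,n$.
   Context: $\mathbb{N}=\{0,1,2,\dots\}$. $\mathbf{Vect}_{\mathbb{R}}$ is the category of real vector spaces and linear maps. A topological space is also regarded as the category of its open sets ordered by inclusion, so a sheaf $H:(\mathbb{R}^n)^{\mathrm{op}}\to\mathbf{Vect}_{\mathbb{R}}$ is an ordinary sheaf of real vector spaces on $\mathbb{R}^n$ (Euclidean topology). A sheaf morphism is a natural transformation, i.e. a family of linear maps indexed by open sets $U$ and commuting with restrictions. $\mathcal{C}^0$ is the sheaf of real-valued continuous functions on open subsets of $\mathbb{R}^n$. For $U\subseteq\mathbb{R}^n$ open, $\mathcal{C}^1_k(U)$ is the space of all $f\in\mathcal{C}^0(U)$ such that, for every $x\in U$, the function $t\mapsto f(x_1,\dots,x_{k-1},t,x_{k+1},\dots,x_n)$ is $\mathcal{C}^1$ on the open set of those $t\in\mathbb{R}$ for which the argument lies in $U$, and such that the resulting partial derivative $\partial_k f$ is continuous on $U$. The sheaf morphisms $\iota_k:\mathcal{C}^1_k\hookrightarrow\mathcal{C}^0$ and $\partial_k:\mathcal{C}^1_k\to\mathcal{C}^0$ are the inclusion and the $k$-th partial derivative. An $n$-dimensional interval is a set $U=(c_1-r,c_1+r)\times\dots\times(c_n-r,c_n+r)$ with $c\in\mathbb{R}^n$, $r\in\mathbb{R}_{>0}$. A polynomial of degree $<0$ is $0$. For a multi-index $\alpha\in\mathbb{N}^n$, $\delta_U^\alpha:=\delta_{1U}^{\alpha_1}\circ\dots\circ\delta_{nU}^{\alpha_n}$,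 where powers denote iterated composition and $\delta_{kU}:H(U)\to H(U)$ is the component of $\delta_k$ at $U$. *)

(* Defs.v *)
(* R^n is 'rV[R]_n, for an arbitrary realType R. *)
From HB Require Import structures.
From mathcomp Require Import all_boot all_order all_algebra.
From mathcomp Require Import all_classical all_reals all_analysis.
From mathcomp Require Import ring.

Set Implicit Arguments.
Unset Strict Implicit.
Unset Printing Implicit Defensive.

Import Order.TTheory GRing.Theory Num.Theory.
Import numFieldNormedType.Exports.

Local Open Scope classical_set_scope.
Local Open Scope ring_scope.

Record opens (T : topologicalType) := Opens {
  opens_set :> set T;
  opens_open : open opens_set }.

Notation "x \ino U" := (opens_set U x) (at level 70, no associativity).

Definition opensI (T : topologicalType) (U V : opens T) : opens T :=
  Opens (openI (opens_open U) (opens_open V)).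

Lemma opensIl (T : topologicalType) (U V : opens T) : opensI U V `<=` U.
Proof. by move=> x []. Qed.

Lemma opensIr (T : topologicalType) (U V : opens T) : opensI U V `<=` V.
Proof. by move=> x []. Qed.

Section Sheaves.
Variables (R : realType) (T : topologicalType).

Record presheaf := Presheaf {
  sections :> opens T -> lmodType R;
  res : forall U V : opens T, V `<=` U -> sections U -> sections V;
  res_linear : forall (U V : opens T) (VU : V `<=` U), linear (res VU);
  res_id : forall (U : opens T) (UU : U `<=` U) (s : sections U), res UU s = s;
  res_comp : forall (U V W : opens T) (VU : V `<=` U) (WV : W `<=` V)
    (WU : W `<=` U) (s : sections U), res WV (res VU s) = res WU s }.

Definition is_sheaf (F : presheaf) : Prop :=
  forall (I : Type) (U : opens T) (V : I -> opens T)
    (VU : forall i, V i `<=` U), \bigcup_i V i = U ->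
  forall s : forall i, F (V i),
    (forall i j, res (@opensIl _ (V i) (V j)) (s i) =
                 res (@opensIr _ (V i) (V j)) (s j)) ->
    exists! t : F U, forall i, res (VU i) t = s i.

Record morphism (F G : presheaf) := Morphism {
  component :> forall U : opens T, F U -> G U;
  component_linear : forall U : opens T, linear (@component U);
  component_natural : forall (U V : opens T) (VU : V `<=` U) (s : F U),
    @component V (res VU s) = res VU (@component U s) }.
Arguments component {F G} m U s.

HB.instance Definition _ (F : presheaf) (U V : opens T) (VU : V `<=` U) :=
  GRing.isLinear.Build R (F U) (F V) *:%R (@res F U V VU) (res_linear VU).

HB.instance Definition _ (F G : presheaf) (phi : morphism F G) (U : opens T) :=
  GRing.isLinear.Build R (F U) (G U) *:%R (@component F G phi U)
    (@component_linear F G phi U).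

Lemma morphismP (F G : presheaf) (phi psi : morphism F G) :
  (forall U s, phi U s = psi U s) -> phi = psi.
Proof.
case: phi psi => f fl fn [g gl gn] /= fg.
have {}fg : f = g by apply: functional_extensionality_dep => U; apply/funext.
by subst g; rewrite (Prop_irrelevance fl gl) (Prop_irrelevance fn gn).
Qed.

Lemma comp_linear (F G H : presheaf) (psi : morphism G H) (phi : morphism F G)
  (U : opens T) : linear (psi U \o phi U).
Proof. by move=> a s t /=; rewrite !linearP. Qed.

Lemma comp_natural (F G H : presheaf) (psi : morphism G H) (phi : morphism F G)
  (U V : opens T) (VU : V `<=` U) (s : F U) :
  psi V (phi V (res VU s)) = res VU (psi U (phi U s)).
Proof. by rewrite !component_natural. Qed.

Definition mcomp (F G H : presheaf) (psi : morphism G H) (phi : morphism F G) :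
    morphism F H :=
  Morphism (@comp_linear _ _ _ psi phi) (@comp_natural _ _ _ psi phi).

End Sheaves.

Arguments res {R T} p {U V} VU s.
Notation "psi \oM phi" := (mcomp psi phi)
  (at level 50, format "psi  \oM  phi").

(* op_0^(alpha 0) (op_1^(alpha 1) (... (op_(n-1)^(alpha (n-1)) x))) *)
Definition multi_iter (n : nat) (X : Type) (op : 'I_n -> X -> X)
    (alpha : 'I_n -> nat) (x : X) : X :=
  foldr (fun k => iter (alpha k) (op k)) x (enum 'I_n).

Section Functions.
Variables (R : realType) (n : nat).
Local Notation E := 'rV[R]_n.
Implicit Types (U V W : opens E) (f g : E -> R) (x : E) (k : 'I_n) (t : R).

Lemma continuous_lin (S : topologicalType) (a : R) (u v : S -> R) (x : S) :
  {for x, continuous u} -> {for x, continuous v} ->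
  {for x, continuous (a *: u + v)}.
Proof.
move=> uc vc.
have ac : {for x, continuous (fun=> a : R^o)} by exact: cst_continuous.
exact: (cvgD (cvgM ac (uc : (u : S -> R^o) y @[y --> x] --> u x)) vc).
Qed.

(* x with its k-th coordinate replaced by t *)
Definition upd x k t : E := \row_i (if i == k then t else x ord0 i).

Definition slice f x k : R -> R := fun t => f (upd x k t).

Definition partial k f : E -> R := fun x => (derive1 (slice f x k)) (x ord0 k).

(* Functions on an open set U are represented by their extension by 0 to R^n,
   so that equality of sections is equality of functions.  As U is open,
   continuity on U is continuity in R^n at each point of U. *)
Definition continuous_on U f :=
  (forall x, x \ino U -> {for x, continuous f}) /\ (forall x, ~ x \ino U -> f x = 0).

Definition C0_pred U : {pred E -> R} := fun f => `[< continuous_on U f >].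

Record C0fun U := MkC0 { C0_val :> E -> R; C0_valP : C0_val \in C0_pred U }.

HB.instance Definition _ U := [isSub for @C0_val U].
HB.instance Definition _ U := [Choice of C0fun U by <:].

Lemma C0_submod_closed U : submod_closed (C0_pred U).
Proof.
split; first by apply/asboolP; split=> // x _; exact: cst_continuous.
move=> a f g /asboolP[fc f0] /asboolP[gc g0]; apply/asboolP; split => x Ux.
  exact: (continuous_lin (fc x Ux) (gc x Ux)).
by rewrite !fctE/= f0// g0// scaler0 addr0.
Qed.

HB.instance Definition _ U :=
  GRing.isSubmodClosed.Build R _ (C0_pred U) (@C0_submod_closed U).
HB.instance Definition _ U := [SubChoice_isSubLmodule of C0fun U by <:].

Definition is_C1 k U f :=
  (forall x, x \ino U -> forall t, upd x k t \ino U ->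
     derivable (slice f x k) t 1 /\ {for t, continuous (derive1 (slice f x k))}) /\
  (forall x, x \ino U -> {for x, continuous (partial k f)}).

Definition C1_pred k U : {pred C0fun U} :=
  fun f : C0fun U => `[< is_C1 k U f >].

Record C1fun k U := MkC1 { C1_val :> C0fun U; C1_valP : C1_val \in @C1_pred k U }.


HB.instance Definition _ k U := [isSub for @C1_val k U].
HB.instance Definition _ k U := [Choice of C1fun k U by <:].

Lemma derive1_ext (u v : R -> R) : u = v -> derive1 u = derive1 v.
Proof. by move->. Qed.

Lemma slice_lin a f g x k : slice (a *: f + g) x k = a *: slice f x k + slice g x k.
Proof. by []. Qed.

Lemma derivable_lin a (u v : R -> R) t : derivable u t 1 -> derivable v t 1 ->
  derivable (a *: u + v) t 1.
Proof.
move=> du dv.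
have -> : a *: u + v = (a \*: (u : R -> R^o)) + (v : R -> R^o) by [].
exact: (derivableD (@derivableZ _ _ _ _ a _ _ du) dv).
Qed.

Lemma derive1_lin a (u v : R -> R) t : derivable u t 1 -> derivable v t 1 ->
  derive1 (a *: u + v) t = a * derive1 u t + derive1 v t.
Proof.
move=> du dv.
have -> : a *: u + v = (a \*: (u : R -> R^o)) + (v : R -> R^o) by [].
rewrite !derive1E (deriveD (@derivableZ _ _ _ _ a _ _ du) dv).
by rewrite (@deriveZ _ _ _ _ a _ _ du).
Qed.

Lemma upd_id x k : upd x k (x ord0 k) = x.
Proof. by apply/rowP => i; rewrite mxE; case: eqP => // ->. Qed.

Lemma upd_continuous k : continuous (fun p : E * R => upd p.1 k p.2).
Proof.
move=> [x t] A [P xP PA] /=.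
have xP' i : nbhs (x ord0 i) (fun r => if i == k then True else P ord0 i r).
  case: eqP => [ik|/eqP ik]; first exact: filterT.
  by have := xP ord0 i; rewrite mxE (negPf ik).
have tP : nbhs t (P ord0 k) by have := xP ord0 k; rewrite mxE eqxx.
exists ([set y : E | forall i j, (if j == k then True else P ord0 j (y i j))], P ord0 k).
  split=> //=; exists (fun i j r => if j == k then True else P ord0 j r) => // i j.
  by rewrite (ord1 i).
move=> [y r] /= [yP rP]; apply: PA => i j; rewrite (ord1 i) mxE.
by have := yP ord0 j; case: eqP => // ->.
Qed.

Lemma upd_continuousr x k : continuous (upd x k).
Proof.
move=> t; have h : (fun s => (x, s)) s @[s --> t] --> (x, t).
  by apply: (@cvg_pair _ _ _ _ (nbhs x) (nbhs t)); [exact: cvg_cst|exact: cvg_id].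
exact: (continuous_comp h (@upd_continuous k (x, t))).
Qed.

Lemma near_opens (U : opens E) x : x \ino U -> \forall y \near x, y \ino U.
Proof. by move=> xU; exact: open_nbhs_nbhs (conj (opens_open U) xU). Qed.

Lemma near_upd (U : opens E) x k t : upd x k t \ino U ->
  \forall s \near t, upd x k s \ino U.
Proof. by move=> xU; apply: (@upd_continuousr x k t); exact: near_opens. Qed.

Lemma slice_near U f g x k t : (forall y, y \ino U -> f y = g y) ->
  upd x k t \ino U -> {near t, slice f x k =1 slice g x k}.
Proof.
move=> fg /near_upd xU; near=> s.
by apply: fg; near: s.
Unshelve. all: by end_near. Qed.

Lemma eq_derivable_slice U f g x k t : (forall y, y \ino U -> f y = g y) ->
  upd x k t \ino U -> derivable (slice f x k) t 1 -> derivable (slice g x k) t 1.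
Proof. by move=> fg xU; apply: near_eq_derivable; exact: (slice_near fg). Qed.

Lemma eq_derive1_slice U f g x k t : (forall y, y \ino U -> f y = g y) ->
  upd x k t \ino U -> derive1 (slice f x k) t = derive1 (slice g x k) t.
Proof.
by move=> fg xU; rewrite !derive1E; apply: near_eq_derive; exact: (slice_near fg).
Qed.

Lemma eq_partial U f g x k : (forall y, y \ino U -> f y = g y) ->
  x \ino U -> partial k f x = partial k g x.
Proof. by move=> fg xU; apply: (eq_derive1_slice fg); rewrite upd_id. Qed.

Lemma near_continuous_at (S : topologicalType) (f g : S -> R) (x : S) :
  (\near x, f x = g x) -> {for x, continuous f} -> {for x, continuous g}.
Proof.
move=> fg; rewrite /prop_for /continuous_at => fc.
rewrite -(nbhs_singleton fg).
by apply: cvg_trans fc; apply: near_eq_cvg; apply: filterS fg => y ->.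
Qed.

Lemma eq_continuous_at U f g x : (forall y, y \ino U -> f y = g y) ->
  x \ino U -> {for x, continuous f} -> {for x, continuous g}.
Proof.
move=> fg xU fc; apply: (near_continuous_at _ fc).
by near=> y; apply/fg; near: y; exact: (near_opens xU).
Unshelve. all: by end_near. Qed.

Lemma eq_C1 k U V f g : V `<=` U -> (forall y, y \ino V -> f y = g y) ->
  is_C1 k U f -> is_C1 k V g.
Proof.
move=> VU fg [fd fc]; split=> x xV; last first.
  have fcx := fc x (VU x xV).
  apply: (eq_continuous_at _ xV fcx) => y yV; exact: (eq_partial k fg yV).
move=> t tV; have [d c] := fd x (VU _ xV) t (VU _ tV).
split; first exact: (eq_derivable_slice fg tV d).
apply: (near_continuous_at _ c).
near=> s; apply: (eq_derive1_slice fg); near: s; exact: near_upd.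
Unshelve. all: by end_near. Qed.

Lemma partial_lin k a f g x :
  derivable (slice f x k) (x ord0 k) 1 -> derivable (slice g x k) (x ord0 k) 1 ->
  partial k (a *: f + g) x = a * partial k f x + partial k g x.
Proof. exact: derive1_lin. Qed.

Lemma C1_lin k U a f g : is_C1 k U f -> is_C1 k U g -> is_C1 k U (a *: f + g).
Proof.
move=> [fd fc] [gd gc]; split=> x xU; last first.
  have cc := @continuous_lin _ a _ _ _ (fc x xU) (gc x xU).
  apply: (eq_continuous_at _ xU cc) => y yU.
  have yk : upd y k (y ord0 k) \ino U by rewrite upd_id.
  have [df _] := fd y yU _ yk; have [dg _] := gd y yU _ yk.
  by rewrite (partial_lin a df dg).
move=> t tU; have [df cf] := fd x xU t tU; have [dg cg] := gd x xU t tU.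
split; first by rewrite slice_lin; exact: (@derivable_lin a _ _ _ df dg).
have cc := @continuous_lin _ a _ _ _ cf cg.
apply: (near_continuous_at _ cc).
near=> s; have sU : upd x k s \ino U by near: s; exact: near_upd.
have [dfs _] := fd x xU s sU; have [dgs _] := gd x xU s sU.
by rewrite slice_lin (derive1_lin a dfs dgs).
Unshelve. all: by end_near. Qed.

Lemma C1_submod_closed k U : submod_closed (@C1_pred k U).
Proof.
split.
  apply/asboolP; have p0 x t : derive1 (slice (0 : E -> R) x k) t = 0.
    by rewrite derive1E; apply: derive_cst.
  split=> x _; last first.
    have -> : partial k (C0_val (0 : C0fun U)) = cst 0 by apply/funext => y; exact: p0.
    exact: cst_continuous.
  move=> t _; split; first exact: (@derivable_cst _ _ _ (0 : R) t 1).
  have -> : derive1 (slice (C0_val (0 : C0fun U)) x k) = cst 0.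
    by apply/funext => y; exact: p0.
  exact: cst_continuous.
move=> a f g /asboolP fC /asboolP gC; apply/asboolP.
exact: (C1_lin a fC gC).
Qed.

HB.instance Definition _ k U := @GRing.isSubmodClosed.Build R _ (@C1_pred k U)
  (@C1_submod_closed k U).
HB.instance Definition _ k U := [SubChoice_isSubLmodule of C1fun k U by <:].

Lemma restrE (U : opens E) f x : x \ino U -> (f \_ U) x = f x.
Proof. by move=> xU; rewrite patchT// inE. Qed.

Lemma restrN (U : opens E) f x : ~ x \ino U -> (f \_ U) x = 0.
Proof. by move=> xU; rewrite patchC// inE. Qed.

Lemma restr_lin (U : opens E) a f g : (a *: f + g) \_ U = a *: (f \_ U) + g \_ U.
Proof.
apply/funext => x; have [xU|xU] := pselect (x \ino U).
  by rewrite restrE// !fctE /= !restrE.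
by rewrite restrN// !fctE /= !restrN// scaler0 addr0.
Qed.

Lemma restr_comp (V W : opens E) f : W `<=` V -> (f \_ V) \_ W = f \_ W.
Proof.
move=> WV; apply/funext => x; have [xU|xU] := pselect (x \ino W).
  by rewrite !restrE//; exact: WV.
by rewrite !restrN.
Qed.

Lemma restr_continuous_on U f :
  (forall x, x \ino U -> {for x, continuous f}) -> continuous_on U (f \_ U).
Proof.
move=> fc; split=> x xU; last exact: restrN.
by apply: (eq_continuous_at _ xU (fc x xU)) => y yU; rewrite restrE.
Qed.

Lemma C0P U (f : C0fun U) : continuous_on U f.
Proof. exact/asboolP/C0_valP. Qed.

Lemma C1P k U (f : C1fun k U) : is_C1 k U f.
Proof. exact/asboolP/C1_valP. Qed.

Definition C0_mk U f (fc : forall x, x \ino U -> {for x, continuous f}) : C0fun U :=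
  MkC0 (asboolT (restr_continuous_on fc)).

Lemma C0_res_subproof U V (VU : V `<=` U) (f : C0fun U) x :
  x \ino V -> {for x, continuous f}.
Proof. by move=> xV; apply: (C0P f).1; exact: VU. Qed.

Definition C0_res U V (VU : V `<=` U) (f : C0fun U) : C0fun V :=
  C0_mk (@C0_res_subproof U V VU f).

Lemma C0_res_linear U V (VU : V `<=` U) : linear (C0_res VU).
Proof.
by move=> a f g; apply: val_inj; exact: (restr_lin V a (C0_val f) (C0_val g)).
Qed.

Lemma C0_res_id U (UU : U `<=` U) (f : C0fun U) : C0_res UU f = f.
Proof.
apply: val_inj; apply/funext => x /=; have [xU|xU] := pselect (x \ino U).
  by rewrite restrE.
by rewrite restrN// (C0P f).2.
Qed.

Lemma C0_res_comp (U V W : opens E) (VU : V `<=` U) (WV : W `<=` V) (WU : W `<=` U)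
  (f : C0fun U) : C0_res WV (C0_res VU f) = C0_res WU f.
Proof. by apply: val_inj; exact: restr_comp. Qed.

Definition C0 : presheaf R E := Presheaf C0_res_linear C0_res_id C0_res_comp.

Lemma C1_res_subproof k U V (VU : V `<=` U) (f : C1fun k U) :
  is_C1 k V (C0_res VU f).
Proof. by apply: (eq_C1 VU _ (C1P f)) => y yV; rewrite [RHS]restrE. Qed.

Definition C1_res k U V (VU : V `<=` U) (f : C1fun k U) : C1fun k V :=
  MkC1 (asboolT (C1_res_subproof VU f)).

Lemma C1_res_linear k U V (VU : V `<=` U) : linear (@C1_res k U V VU).
Proof. by move=> a f g; apply: val_inj; exact: C0_res_linear. Qed.

Lemma C1_res_id k U (UU : U `<=` U) (f : C1fun k U) : C1_res UU f = f.
Proof. by apply: val_inj; exact: C0_res_id. Qed.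

Lemma C1_res_comp k (U V W : opens E) (VU : V `<=` U) (WV : W `<=` V) (WU : W `<=` U)
  (f : C1fun k U) : C1_res WV (C1_res VU f) = C1_res WU f.
Proof. by apply: val_inj; exact: C0_res_comp. Qed.

Definition C1 k : presheaf R E :=
  Presheaf (@C1_res_linear k) (@C1_res_id k) (@C1_res_comp k).

Lemma C1_incl_linear k U : linear (fun f : C1 k U => C1_val f : C0 U).
Proof. by []. Qed.

Lemma C1_incl_natural k U V (VU : V `<=` U) (f : C1 k U) :
  (C1_val (res (C1 k) VU f) : C0 V) = res C0 VU (C1_val f).
Proof. by []. Qed.

Definition C1_incl k : morphism (C1 k) C0 :=
  Morphism (@C1_incl_linear k) (@C1_incl_natural k).

Definition dC1_fun k U (f : C1 k U) : C0 U := C0_mk (C1P f).2.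

Lemma dC1_linear k U : linear (@dC1_fun k U).
Proof.
move=> a f g; apply: val_inj => /=; rewrite -restr_lin.
apply/funext => x; have [xU|xU] := pselect (x \ino U); last by rewrite !restrN.
rewrite !restrE//.
have xk : upd x k (x ord0 k) \ino U by rewrite upd_id.
have [df _] := (C1P f).1 x xU _ xk; have [dg _] := (C1P g).1 x xU _ xk.
exact: (partial_lin a df dg).
Qed.

Lemma dC1_natural k U V (VU : V `<=` U) (f : C1 k U) :
  dC1_fun (res (C1 k) VU f) = res C0 VU (dC1_fun f).
Proof.
apply: val_inj; apply/funext => x /=.
have [xV|xV] := pselect (x \ino V); last by rewrite !restrN.
rewrite !restrE//; last exact: VU.
by apply: (eq_partial k _ xV) => y yV; rewrite restrE.
Qed.

Definition dC1 k : morphism (C1 k) C0 := Morphism (@dC1_linear k) (@dC1_natural k).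

(* iterated partial derivatives: partials [:: k1; ...; kp] f is
   d_k1 (... (d_kp f)) *)
Definition partials (s : seq 'I_n) f : E -> R := foldr partial f s.

Definition smooth f := forall s : seq 'I_n, continuous (partials s f) /\
  forall k x, derivable (slice (partials s f) x k) (x ord0 k) 1.

Definition supp f : set E := closure [set x | f x != 0].

Definition test_pred U : {pred E -> R} := fun f =>
  `[< [/\ smooth f, compact (supp f) & supp f `<=` U] >].

Record testfun U :=
  MkTest { test_val :> E -> R; test_valP : test_val \in @test_pred U }.

HB.instance Definition _ U := [isSub for @test_val U].
HB.instance Definition _ U := [Choice of testfun U by <:].

Lemma partials_lin a f g s : smooth f -> smooth g ->
  partials s (a *: f + g) = a *: partials s f + partials s g.
Proof.
move=> fs gs; elim: s => //= k s ->; apply/funext => x.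
exact: (partial_lin a ((fs s).2 k x) ((gs s).2 k x)).
Qed.

Lemma smooth_lin a f g : smooth f -> smooth g -> smooth (a *: f + g).
Proof.
move=> fs gs s; rewrite partials_lin//; split.
  by move=> x; exact: (@continuous_lin _ a _ _ _ ((fs s).1 x) ((gs s).1 x)).
move=> k x; rewrite slice_lin.
exact: (@derivable_lin a _ _ _ ((fs s).2 k x) ((gs s).2 k x)).
Qed.

Lemma partial0 k : partial k (0 : E -> R) = 0.
Proof.
apply/funext => x; rewrite /partial derive1E.
exact: (@derive_cst _ _ _ (0 : R)).
Qed.

Lemma partials0 s : partials s (0 : E -> R) = 0.
Proof. by elim: s => //= k s ->; exact: partial0. Qed.

Lemma smooth0 : smooth (0 : E -> R).
Proof.
move=> s; rewrite partials0; split; first exact: cst_continuous.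
by move=> k x; exact: (@derivable_cst _ _ _ (0 : R)).
Qed.

Lemma supp_sub f (K : set E) : closed K -> (forall x, ~ K x -> f x = 0) ->
  supp f `<=` K.
Proof.
move=> /closure_id Kc fK; rewrite Kc; apply: closure_subset => x /= /eqP fx.
by apply: contrapT => /fK.
Qed.

Lemma suppN f x : ~ supp f x -> f x = 0.
Proof.
by move=> fx; apply: contrapT => /eqP f0; apply: fx; exact: subset_closure.
Qed.

Lemma closed_supp f : closed (supp f).
Proof. exact: closed_closure. Qed.

Lemma supp_lin a f g : supp (a *: f + g) `<=` supp f `|` supp g.
Proof.
apply: supp_sub; first by apply: closedU; exact: closed_supp.
move=> x /not_orP[/suppN fx /suppN gx].
by rewrite !fctE /= fx gx scaler0 addr0.
Qed.

Lemma test_submod_closed U : submod_closed (@test_pred U).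
Proof.
split.
  have s0 : supp (0 : E -> R) `<=` set0 by apply: supp_sub => //; exact: closed0.
  apply/asboolP; split; [exact: smooth0| |].
    by move: s0; rewrite subset0 => ->; exact: compact0.
  by move=> x /s0.
move=> a f g /asboolP[fs fc fU] /asboolP[gs gc gU]; apply/asboolP; split.
- exact: smooth_lin.
- apply: (@subclosed_compact _ _ (supp f `|` supp g)); first exact: closed_supp.
    exact: compactU.
  exact: supp_lin.
- by move=> x /supp_lin[/fU|/gU].
Qed.

HB.instance Definition _ U := @GRing.isSubmodClosed.Build R _ (@test_pred U)
  (@test_submod_closed U).
HB.instance Definition _ U := [SubChoice_isSubLmodule of testfun U by <:].

Lemma testP U (phi : testfun U) :
  [/\ smooth phi, compact (supp phi) & supp phi `<=` U].
Proof. exact/asboolP/test_valP. Qed.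

Lemma test_incl_subproof U V (VU : V `<=` U) (phi : testfun V) :
  [/\ smooth phi, compact (supp phi) & supp phi `<=` U].
Proof. by have [? ? sV] := testP phi; split => // x /sV; exact: VU. Qed.

Definition test_incl U V (VU : V `<=` U) (phi : testfun V) : testfun U :=
  MkTest (asboolT (test_incl_subproof VU phi)).

Lemma test_incl_linear U V (VU : V `<=` U) : linear (test_incl VU).
Proof. by move=> a f g; exact: val_inj. Qed.

Lemma smooth_partial k f : smooth f -> smooth (partial k f).
Proof. by move=> fs s; have := fs (rcons s k); rewrite /partials foldr_rcons. Qed.

Lemma supp_partial k f : supp (partial k f) `<=` supp f.
Proof.
apply: supp_sub; first exact: closed_supp.
move=> x fx; pose O := Opens (closed_openC (@closed_supp f)).
have xO : x \ino O by [].
rewrite (@eq_partial O f 0 x k _ xO); first by rewrite partial0.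
by move=> y; exact: suppN.
Qed.

Lemma test_partial_subproof k U (phi : testfun U) :
  [/\ smooth (partial k phi), compact (supp (partial k phi)) &
      supp (partial k phi) `<=` U].
Proof.
have [ps pc pU] := testP phi; split.
- exact: smooth_partial.
- exact: (subclosed_compact (@closed_supp _) pc (@supp_partial _ _)).
- by move=> x /supp_partial/pU.
Qed.

Definition test_partial k U (phi : testfun U) : testfun U :=
  MkTest (asboolT (test_partial_subproof k phi)).

Lemma test_partial_linear k U : linear (@test_partial k U).
Proof.
move=> a f g; apply: val_inj; apply/funext => x.
have [fs _ _] := testP f; have [gs _ _] := testP g.
exact: (partial_lin a ((fs [::]).2 k x) ((gs [::]).2 k x)).
Qed.

(* Lists of coordinates are used instead of multi-indices: by the symmetry of
   partial derivatives of smooth functions this is the usual C^m norm. *)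
Definition Cnorm (m : nat) f : R :=
  sup [set y | exists (s : seq 'I_n) (x : E),
                 (size s <= m)%N /\ y = `|partials s f x| ].

Lemma compact_supp_bounded f : continuous f -> compact (supp f) ->
  exists M : R, forall x, `|f x| <= M.
Proof.
move=> fc fk; have := continuous_compact (continuous_subspaceT fc) fk.
move=> /compact_bounded[M [_ fM]]; exists (`|M| + 1) => x.
have [xs|/suppN ->] := pselect (supp f x); last by rewrite normr0 addr_ge0.
apply: (fM (`|M| + 1)); last by exists x.
by rewrite (le_lt_trans (ler_norm M))// ltrDl.
Qed.

Lemma partials_bounded m f : smooth f -> compact (supp f) ->
  exists M : R, forall s x, (size s <= m)%N -> `|partials s f x| <= M.
Proof.
elim: m f => [|m IH] f fs fk; have [M fM] := compact_supp_bounded (fs [::]).1 fk.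
  by exists M => -[].
have h k : exists M : R, forall s x, (size s <= m)%N ->
    `|partials s (partial k f) x| <= M.
  apply: IH; first exact: smooth_partial.
  exact: (subclosed_compact (@closed_supp _) fk (@supp_partial _ _)).
have [N hN] := choice h; exists (`|M| + \sum_k `|N k|) => s x.
case/lastP: s => [_|s k].
  by rewrite (le_trans (fM x))// (le_trans (ler_norm _))// lerDl sumr_ge0.
rewrite size_rcons ltnS => sm; rewrite /partials foldr_rcons.
rewrite (le_trans (hN k s x sm))// (le_trans (ler_norm _))// (bigD1 k)//=.
by rewrite addrCA lerDl addr_ge0// sumr_ge0.
Qed.

Lemma Cnorm_ub m f s x : smooth f -> compact (supp f) -> (size s <= m)%N ->
  `|partials s f x| <= Cnorm m f.
Proof.
move=> fs fk sm; apply: ub_le_sup; last by exists s, x.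
have [M fM] := partials_bounded m fs fk; exists M => _ [s' [y [s'm ->]]].
exact: fM.
Qed.

Lemma Cnorm_le m f (M : R) :
  (forall s x, (size s <= m)%N -> `|partials s f x| <= M) -> Cnorm m f <= M.
Proof.
move=> fM; apply: ge_sup; first by exists `|f 0|, [::], 0.
by move=> _ [s [x [sm ->]]]; exact: fM.
Qed.

Lemma Cnorm_ge0 m f : smooth f -> compact (supp f) -> 0 <= Cnorm m f.
Proof.
by move=> fs fk; apply: le_trans (Cnorm_ub (s := [::]) 0 fs fk _).
Qed.

Lemma Cnorm_mono m m' f : (m <= m')%N -> smooth f -> compact (supp f) ->
  Cnorm m f <= Cnorm m' f.
Proof.
move=> mm' fs fk; apply: Cnorm_le => s x sm; apply: Cnorm_ub => //.
exact: leq_trans mm'.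
Qed.

Lemma Cnorm_partial k m f : smooth f -> compact (supp f) ->
  Cnorm m (partial k f) <= Cnorm m.+1 f.
Proof.
move=> fs fk; apply: Cnorm_le => s x sm.
have := @Cnorm_ub m.+1 f (rcons s k) x fs fk.
by rewrite size_rcons ltnS => /(_ sm); rewrite /partials foldr_rcons.
Qed.

(* The seminorm estimates express continuity of T for the LF topology of test
   functions. *)
Definition is_distr U (T : testfun U -> R) : Prop :=
  scalar T /\
  forall K : set E, compact K -> K `<=` U ->
    exists (C : R) (m : nat), forall phi : testfun U,
      supp phi `<=` K -> `|T phi| <= C * Cnorm m phi.

Definition distr_pred U : {pred testfun U -> R} := fun T => `[< is_distr T >].

Record distr U :=
  MkDistr { distr_val :> testfun U -> R; distr_valP : distr_val \in @distr_pred U }.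

HB.instance Definition _ U := [isSub for @distr_val U].
HB.instance Definition _ U := [Choice of distr U by <:].

Lemma distr_submod_closed U : submod_closed (@distr_pred U).
Proof.
split.
  apply/asboolP; split=> [a f g|K _ _]; first by rewrite mulr0 addr0.
  by exists 0, 0%N => phi _; rewrite normr0 mul0r.
move=> a S T /asboolP[Sl Sc] /asboolP[Tl Tc]; apply/asboolP; split.
  move=> b f g; rewrite !fctE /= Sl Tl /GRing.scale /=; ring.
move=> K Kc KU; have [C [m SC]] := Sc K Kc KU; have [D [p TD]] := Tc K Kc KU.
exists (`|a| * `|C| + `|D|), (maxn m p) => phi phiK.
have [ps pc _] := testP phi.
rewrite !fctE /= (le_trans (ler_normD _ _))// mulrDl lerD//.
  rewrite normrM -mulrA ler_wpM2l// (le_trans (SC phi phiK))//.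
  rewrite (le_trans (ler_wpM2r (Cnorm_ge0 m ps pc) (ler_norm C)))//.
  by rewrite ler_wpM2l// Cnorm_mono// leq_maxl.
rewrite (le_trans (TD phi phiK))//.
rewrite (le_trans (ler_wpM2r (Cnorm_ge0 p ps pc) (ler_norm D)))//.
by rewrite ler_wpM2l// Cnorm_mono// leq_maxr.
Qed.

HB.instance Definition _ U := @GRing.isSubmodClosed.Build R _ (@distr_pred U)
  (@distr_submod_closed U).
HB.instance Definition _ U := [SubChoice_isSubLmodule of distr U by <:].

Lemma distrP U (T : distr U) : is_distr T.
Proof. exact/asboolP/distr_valP. Qed.

Lemma distr_res_subproof U V (VU : V `<=` U) (T : distr U) :
  is_distr (fun phi : testfun V => T (test_incl VU phi)).
Proof.
have [Tl Tc] := distrP T; split; first by move=> a f g; rewrite test_incl_linear Tl.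
move=> K Kc KV; have [C [m TC]] := Tc K Kc (subset_trans KV VU).
by exists C, m => phi phiK; exact: TC.
Qed.

Definition distr_res U V (VU : V `<=` U) (T : distr U) : distr V :=
  MkDistr (asboolT (distr_res_subproof VU T)).

Lemma distr_res_linear U V (VU : V `<=` U) : linear (distr_res VU).
Proof. by move=> a S T; exact: val_inj. Qed.

Lemma distr_res_id U (UU : U `<=` U) (T : distr U) : distr_res UU T = T.
Proof.
apply: val_inj; apply/funext => phi /=; congr (distr_val T _).
exact: val_inj.
Qed.

Lemma distr_res_comp U V W (VU : V `<=` U) (WV : W `<=` V) (WU : W `<=` U)
  (T : distr U) : distr_res WV (distr_res VU T) = distr_res WU T.
Proof.
apply: val_inj; apply/funext => phi /=; congr (distr_val T _).
exact: val_inj.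
Qed.

Definition Distr : presheaf R E :=
  Presheaf distr_res_linear distr_res_id distr_res_comp.

Lemma distr_partial_subproof k U (T : distr U) :
  is_distr (fun phi : testfun U => - T (test_partial k phi)).
Proof.
have [Tl Tc] := distrP T; split.
  by move=> a f g; rewrite test_partial_linear Tl opprD mulrN.
move=> K Kc KU; have [C [m TC]] := Tc K Kc KU.
exists `|C|, m.+1 => phi phiK; have [ps pc _] := testP phi.
rewrite normrN (le_trans (TC _ _))//.
  by move=> x /supp_partial/phiK.
have [pps ppc _] := testP (test_partial k phi).
rewrite (le_trans (ler_wpM2r (Cnorm_ge0 m pps ppc) (ler_norm C)))//.
by rewrite ler_wpM2l// Cnorm_partial.
Qed.

Definition distr_partial k U (T : Distr U) : Distr U :=
  MkDistr (asboolT (distr_partial_subproof k T)).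

Lemma distr_partial_linear k U : linear (@distr_partial k U).
Proof.
move=> a S T; apply: val_inj; apply/funext => phi /=.
by rewrite !fctE /= opprD /GRing.scale /= mulrN.
Qed.

Lemma distr_partial_natural k U V (VU : V `<=` U) (T : Distr U) :
  distr_partial k (res Distr VU T) = res Distr VU (distr_partial k T).
Proof.
apply: val_inj; apply/funext => phi /=; congr (- distr_val T _).
exact: val_inj.
Qed.

Definition dDistr k : morphism Distr Distr :=
  Morphism (@distr_partial_linear k) (@distr_partial_natural k).

End Functions.

Section Integration.
Variables (R : realType) (n : nat).
Local Notation E := 'rV[R]_n.
Implicit Types (U V W : opens E) (f g : E -> R) (x : E) (k : 'I_n) (t : R).

(* For continuous compactly supported g, Rn_int g is the Lebesgue integral of g
   over R^n, computed as an iterated integral (Fubini); the coordinates being all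
   integrated, the base point 0 is irrelevant. *)
Definition int_coord k g : E -> R :=
  fun x => \int[@lebesgue_measure R]_t slice g x k t.

Definition Rn_int g : R := foldr int_coord g (enum 'I_n) 0.

Section Integral1.
Variables (M : R) (M0 : 0 <= M).
Let mu := @lebesgue_measure R.
Let A : set R := `[- M, M]%classic.
Implicit Types u v : R -> R.

Definition box_supp1 u := continuous u /\ forall t, M < `|t| -> u t = 0.

Lemma box_supp1_itv u : box_supp1 u -> \int[mu]_t u t = \int[mu]_(t in A) u t.
Proof.
move=> [_ u0]; rewrite [RHS]Rintegral_mkcond; apply: eq_Rintegral => t _.
rewrite patchE; case: ifPn => // /negP tA; apply: u0.
by rewrite ltNge; apply/negP => tM; apply: tA; rewrite inE /A /= in_itv /= -ler_norml.
Qed.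

Lemma measurable_box : measurable (A : set (measurableTypeR R)).
Proof. exact: measurable_itv. Qed.

Lemma cont_int u : continuous u -> mu.-integrable A (EFin \o u).
Proof.
move=> uc; apply: continuous_compact_integrable; first exact: segment_compact.
exact: continuous_subspaceT.
Qed.

Lemma box_supp1_lin a u v : box_supp1 u -> box_supp1 v -> box_supp1 (fun t => a * u t + v t).
Proof.
move=> [uc u0] [vc v0]; split.
  by move=> t; exact: (continuous_lin (uc t) (vc t)).
by move=> t tM; rewrite u0// v0// mulr0 addr0.
Qed.

Lemma int1_lin a u v : box_supp1 u -> box_supp1 v ->
  \int[mu]_t (a * u t + v t) = a * \int[mu]_t u t + \int[mu]_t v t.
Proof.
move=> uv vv; rewrite !box_supp1_itv//; last exact: box_supp1_lin.
rewrite RintegralD//.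
- by rewrite RintegralZl//; [exact: measurable_box|exact: cont_int uv.1].
- exact: measurable_box.
- by apply: cont_int => t; apply: cvgM; [exact: cvg_cst|exact: uv.1].
- exact: cont_int vv.1.
Qed.

Lemma int1_bound u (B : R) : box_supp1 u -> (forall t, `|u t| <= B) ->
  `|\int[mu]_t u t| <= B * (M *+ 2).
Proof.
move=> uv uB; rewrite box_supp1_itv//.
have nc : continuous (fun t => `|u t|).
  by move=> t; apply: cvg_norm; exact: uv.1.
apply: (le_trans (le_normr_Rintegral measurable_box (cont_int uv.1))).
have Bc : continuous (cst B : R -> R) by move=> t; exact: cvg_cst.
apply: (le_trans (le_Rintegral measurable_box (cont_int nc) (cont_int Bc) _)) => //=.
rewrite Rintegral_cst; last exact: measurable_box.
apply: ler_wpM2l; first exact: le_trans (uB 0).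
have -> : fine (lebesgue_measure A) = if - M < M then M - - M else 0.
  by rewrite /A lebesgue_measure_itv /= lte_fin; case: ifP.
by case: ifPn => _; [rewrite opprK mulr2n|rewrite mulrn_wge0].
Qed.

End Integral1.

Section IntegralN.
Variables (M : R) (M0 : 0 <= M).

Definition box_supp (s : seq 'I_n) f := continuous f /\
  forall x i, i \notin s -> M < `|x ord0 i| -> f x = 0.

Lemma continuous_slice f x k : continuous f -> continuous (slice f x k).
Proof.
by move=> fc t; apply: (continuous_comp (@upd_continuousr R n x k t)); exact: fc.
Qed.

Lemma box_supp_slice s f x k : box_supp s f -> k \notin s -> box_supp1 M (slice f x k).
Proof.
move=> [fc f0] ks; split; first exact: continuous_slice.
by move=> t tM; apply: (f0 _ k ks); rewrite mxE eqxx.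
Qed.

Lemma box_supp_int s f k : box_supp s f -> k \notin s -> box_supp (k :: s) (int_coord k f).
Proof.
move=> fg ks; have fv x := box_supp_slice x fg ks; split; last first.
  move=> x i; rewrite inE negb_or => /andP[ik iS] xM.
  rewrite /int_coord (_ : slice f x k = cst 0).
    by rewrite Rintegral_cst//= mul0r.
  apply/funext => t; apply: (fg.2 _ i iS).
  by rewrite mxE (negPf ik).
move=> x; apply/(@cvgrPdist_le _ _ _ _ (nbhs_filter x)) => e e0.
pose d := e / (M *+ 2 + 1).
have p0 : 0 < M *+ 2 + 1 by rewrite ltr_wpDl// mulrn_wge0.
have d0 : 0 < d by rewrite divr_gt0.
have cov : near_covering (`[- M, M]%classic : set R).
  by apply/compact_near_coveringP; exact: segment_compact.
have : \forall y \near x,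
    `[- M, M]%classic `<=` (fun t => `|slice f x k t - slice f y k t| <= d).
  apply: (cov _ (nbhs x) (fun y t => `|slice f x k t - slice f y k t| <= d)).
  move=> t _.
  have c : {for (t, x), continuous (fun p : R * E => f (upd x k p.1) - f (upd p.2 k p.1))}.
    apply: cvgB.
      apply: (@continuous_comp _ _ _ (fun p : R * E => (x, p.1)) (fun p => f (upd p.1 k p.2))).
        by apply: (@cvg_pair _ _ _ _ (nbhs x) (nbhs t)); [exact: cvg_cst|exact: cvg_fst].
      apply: continuous_comp; [exact: upd_continuous|exact: fg.1].
    apply: (@continuous_comp _ _ _ (fun p : R * E => (p.2, p.1)) (fun p => f (upd p.1 k p.2))).
      by apply: (@cvg_pair _ _ _ _ (nbhs x) (nbhs t)); [exact: cvg_snd|exact: cvg_fst].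
    apply: continuous_comp; [exact: upd_continuous|exact: fg.1].
  move/(@cvgrPdist_le _ _ _ _ (nbhs_filter (t, x))) : c => /(_ d d0) /=; rewrite subrr.
  by apply: filterS => -[s' y] /=; rewrite sub0r normrN.
apply: filterS => y hy.
have bd t : `|-1 * slice f y k t + slice f x k t| <= d.
  rewrite mulN1r addrC; have [tM|tM] := leP `|t| M.
    by apply: hy; rewrite /= in_itv /= -ler_norml.
  by rewrite (fv x).2// (fv y).2// subr0 normr0 ltW.
have -> : int_coord k f x - int_coord k f y =
    \int[@lebesgue_measure R]_t (-1 * slice f y k t + slice f x k t).
  by rewrite (int1_lin _ (fv y) (fv x)) mulN1r addrC.
apply: (le_trans (int1_bound M0 (box_supp1_lin _ (fv y) (fv x)) bd)).
by rewrite /d mulrAC ler_pdivrMr// ler_wpM2l ?ltW// ltrDl.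
Qed.

Definition int_seq (s : seq 'I_n) f := foldr int_coord f s.

Lemma box_supp_int_seq s f : uniq s -> box_supp [::] f -> box_supp s (int_seq s f).
Proof.
by move=> + fg; elim: s => //= k s IH /andP[ks /IH]; move/box_supp_int; exact.
Qed.

Lemma box_supp_lin s a f g : box_supp s f -> box_supp s g -> box_supp s (a *: f + g).
Proof.
move=> [fc f0] [gc g0]; split.
  by move=> x; exact: (continuous_lin (fc x) (gc x)).
by move=> x i iS xM; rewrite !fctE /= (f0 x i)// (g0 x i)// scaler0 addr0.
Qed.

Lemma int_seq_lin s a f g : uniq s -> box_supp [::] f -> box_supp [::] g ->
  int_seq s (a *: f + g) = a *: int_seq s f + int_seq s g.
Proof.
move=> + fg gg; elim: s => //= k s IH /andP[ks us]; rewrite IH//.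
apply/funext => x.
have fv := box_supp_slice x (box_supp_int_seq us fg) ks.
have gv := box_supp_slice x (box_supp_int_seq us gg) ks.
exact: (int1_lin a fv gv).
Qed.

Lemma int_seq_bound s f (B : R) : uniq s -> box_supp [::] f ->
  (forall x, `|f x| <= B) ->
  forall x, `|int_seq s f x| <= B * (M *+ 2) ^+ size s.
Proof.
move=> + fg fB; elim: s => [_|k s IH] /=; first by move=> x; rewrite mulr1.
move=> /andP[ks us] x; rewrite exprSr mulrA.
apply: int1_bound => //; first exact: (box_supp_slice x (box_supp_int_seq us fg) ks).
by move=> t; exact: IH.
Qed.

End IntegralN.

Lemma compact_box (K : set E) : compact K ->
  exists2 M : R, 0 <= M & forall x, K x -> forall i, `|x ord0 i| <= M.
Proof.
move=> /compact_bounded[M [_ KM]]; exists (`|M| + 1); first by rewrite addr_ge0.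
move=> x Kx i; apply: (le_trans _ (KM (`|M| + 1) _ x Kx)).
  by rewrite [leRHS]mx_normrE; exact: (le_bigmax _ (fun ij => `|x ij.1 ij.2|) (ord0, i)).
by rewrite (le_lt_trans (ler_norm M))// ltrDl.
Qed.

Lemma prod_box_supp U (f : C0fun U) (phi : testfun U) (K : set E) (M : R) :
  supp phi `<=` K -> (forall x, K x -> forall i, `|x ord0 i| <= M) ->
  box_supp M [::] (fun x => f x * phi x).
Proof.
have [ps pc pU] := testP phi; move=> pK KM; split.
  move=> x; have [xU|xU] := pselect (x \ino U).
    have fx : {for x, continuous (f : E -> R^o)} := (C0P f).1 x xU.
    have px : {for x, continuous (phi : E -> R^o)} := (ps [::]).1 x.
    exact: (cvgM fx px).
  pose O := Opens (closed_openC (@closed_supp _ _ phi)).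
  have xO : x \ino O by move=> /pU.
  apply: (@near_continuous_at _ _ (cst 0)); last exact: cst_continuous.
  near=> y; have yO : y \ino O by near: y; exact: near_opens.
  by rewrite (suppN yO) mulr0.
move=> x i _ xM; rewrite (@suppN _ _ phi x) ?mulr0// => /pK/KM/(_ i).
by rewrite leNgt xM.
Unshelve. all: by end_near. Qed.

Definition lambda_form U (f : C0fun U) (phi : testfun U) : R :=
  Rn_int (fun x => f x * phi x).

Lemma lambda_form_linr U (f : C0fun U) : scalar (lambda_form f).
Proof.
move=> a p q; have [ps pc pU] := testP p; have [qs qc qU] := testP q.
have [M M0 KM] := compact_box (compactU pc qc).
have pg := prod_box_supp f (@subsetUl _ _ (supp q)) KM.
have qg := prod_box_supp f (@subsetUr _ (supp p) _) KM.
rewrite /lambda_form /Rn_int.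
have H := @int_seq_lin M M0 (enum 'I_n) a _ _ (enum_uniq _) pg qg.
apply: (etrans _ (congr1 (fun h => h 0) H)); congr (foldr _ _ _ _).
apply/funext => x; apply: (etrans (mulrDr (f x) (a * p x) (q x))).
by congr (_ + _); exact: mulrCA.
Qed.

Lemma lambda_is_distr U (f : C0fun U) : is_distr (lambda_form f).
Proof.
split; first exact: lambda_form_linr.
move=> K Kc KU; have [M M0 KM] := compact_box Kc.
have fc : {within K, continuous f}.
  apply: continuous_in_subspaceT => x; rewrite inE => /KU xU.
  exact: (C0P f).1.
have /compact_bounded[B [_ fB]] := continuous_compact fc Kc.
exists ((`|B| + 1) * (M *+ 2) ^+ n), 0%N => phi phiK.
have [ps pc pU] := testP phi.
have pg := prod_box_supp f phiK KM.
have bd x : `|f x * phi x| <= (`|B| + 1) * Cnorm 0 phi.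
  have [xs|xs] := pselect (supp phi x); last first.
    by rewrite (suppN xs) mulr0 normr0 mulr_ge0 ?addr_ge0// Cnorm_ge0.
  rewrite normrM ler_pM//; last exact: (@Cnorm_ub _ _ 0 phi [::] x).
  apply: (fB (`|B| + 1)); last by exists x => //; exact: phiK.
  by rewrite (le_lt_trans (ler_norm B))// ltrDl.
have := @int_seq_bound M M0 (enum 'I_n) _ _ (enum_uniq _) pg bd 0.
by rewrite size_enum_ord mulrAC.
Qed.

Definition lambda_fun U (f : C0 R n U) : Distr R n U :=
  MkDistr (asboolT (lambda_is_distr f)).

Lemma lambda_linear U : linear (@lambda_fun U).
Proof.
move=> a f g; apply: val_inj; apply/funext => p /=.
have [ps pc pU] := testP p; have [M M0 KM] := compact_box pc.
have fg := prod_box_supp f (@subset_refl _ (supp p)) KM.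
have gg := prod_box_supp g (@subset_refl _ (supp p)) KM.
have H := @int_seq_lin M M0 (enum 'I_n) a _ _ (enum_uniq _) fg gg.
apply: (etrans _ (congr1 (fun h => h 0) H)); congr (foldr _ _ _ _).
apply/funext => x; apply: (etrans (mulrDl (a * f x) (g x) (p x))).
by congr (_ + _); exact: esym (mulrA _ _ _).
Qed.

Lemma lambda_natural U V (VU : V `<=` U) (f : C0 R n U) :
  lambda_fun (res (C0 R n) VU f) = res (Distr R n) VU (lambda_fun f).
Proof.
apply: val_inj; apply/funext => phi /=; congr (Rn_int _).
apply/funext => x /=; have [xs|xs] := pselect (supp phi x); last first.
  by rewrite (suppN xs) !mulr0.
by have [_ _ /(_ x xs) xV] := testP phi; rewrite restrE.
Qed.

Definition lambda : morphism (C0 R n) (Distr R n) :=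
  Morphism lambda_linear lambda_natural.

End Integration.

Section Problem.
Variables (R : realType) (n : nat).
Local Notation E := 'rV[R]_n.
Implicit Types (U : opens E) (k : 'I_n).

Definition is_interval U : Prop := exists (c : E) (r : R), 0 < r /\
  U = [set x : E | forall i, c ord0 i - r < x ord0 i < c ord0 i + r] :> set E.

Definition independent_of U k (c : C0 R n U) : Prop :=
  forall x y : E, x \ino U -> y \ino U ->
    (forall i, i != k -> x ord0 i = y ord0 i) -> C0_val c x = C0_val c y.

Definition polynomial_in U k (d : nat) (theta : C0 R n U) : Prop :=
  exists c : 'I_d -> C0 R n U, (forall i, independent_of k (c i)) /\
    forall x : E, x \ino U ->
      C0_val theta x = \sum_(i < d) C0_val (c i) x * x ord0 k ^+ i.

Record problem (H : presheaf R E) (j : morphism (C0 R n) H)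
    (delta : 'I_n -> morphism H H) : Prop := Problem {
  problem_sheaf : is_sheaf H;
  problem_compat : forall k,
    delta k \oM (j \oM C1_incl R k) = j \oM dC1 R k;
  problem_poly : forall (alpha : 'I_n -> nat) U, is_interval U ->
    forall f : C0 R n U,
      (exists theta : 'I_n -> C0 R n U,
         (forall k, polynomial_in k (alpha k) (theta k)) /\
         f = \sum_k theta k) ->
      multi_iter (fun k => delta k U) alpha (j U f) = 0;
  problem_comm : forall h k, delta h \oM delta k = delta k \oM delta h }.

End Problem.

(* Main.v *)
(* Locally, every distribution is a derivative D^a f of a continuous function f: if
   |T phi| <= C ||phi||_m on a cube, then T is bounded for the scalar product
   int (d^S phi) (d^S psi), S = (m+1, .., m+1), by Poincare inequalities; minimising
   the associated quadratic functional represents T as in the Riesz theorem, and the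
   m-th derivatives of a minimising sequence converge uniformly.
   Conversely, D^a f = 0 on a cube forces f to be a sum of functions theta_k that are
   polynomials of degree < a_k in x_k: test against products of functions of one
   variable, apply the one-dimensional du Bois-Reymond lemma in one coordinate after
   the other, and subtract Lagrange interpolants.
   Hence psi (D^a f) = delta^a (j f) is forced on cubes; it is well defined, since two
   representations D^a f = D^b g can be written with the same order by taking
   antiderivatives, and their difference is then killed by condition (iv). These local
   sections glue, because H is a sheaf. *)
Require Import Defs.
From mathcomp Require Import all_boot all_order all_algebra.
From mathcomp Require Import all_classical all_reals all_analysis.
From mathcomp Require Import ring lra.

Set Implicit Arguments.
Unset Strict Implicit.
Unset Printing Implicit Defensive.

Import Order.TTheory GRing.Theory Num.Theory.
Import numFieldNormedType.Exports.

Local Open Scope classical_set_scope.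
Local Open Scope ring_scope.

(** * Calculus in one variable *)

(** All integrals are reduced to iterated one-variable integrals of continuous functions over
    [-M, M], with M so large that the integrands vanish outside; Fubini, differentiation under the
    integral sign and integration by parts then follow from the fundamental theorem of calculus. The
    Riesz argument is carried out without completing a Hilbert space: the Poincare inequalities turn
    a Cauchy sequence for the energy into a uniformly convergent one. The derivative in S beyond the
    order m pays for the passage from L^2 to the sup norm; moving one derivative per coordinate onto
    the test function gives the final order (m+2, .., m+2). The local f is continuous on all of R^n.
    A representation thus restricts unchanged to smaller cubes, and one antiderivative of f serves
    in D' and in H at once, which is how an equality passes from D' to H. In the kernel theorem,
    interpolants at fixed nodes are subtracted because their coefficients are built from values of
    the function, hence continuous in the other coordinates. *)

Section Continuity.
Variables (R : realType) (S T W : topologicalType).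

Lemma cont_comp (f : S -> T) (g : T -> W) :
  continuous f -> continuous g -> continuous (fun x => g (f x)).
Proof. by move=> fc gc x; apply: continuous_comp; [exact: fc|exact: gc]. Qed.

Lemma cont_pair (f : S -> T) (g : S -> W) :
  continuous f -> continuous g -> continuous (fun x => (f x, g x)).
Proof.
by move=> fc gc x; apply: (@cvg_pair _ _ _ _ (nbhs (f x)) (nbhs (g x))); [exact: fc|exact: gc].
Qed.

Lemma cont_fst : continuous (@fst S T). Proof. by move=> x; exact: cvg_fst. Qed.

Lemma cont_snd : continuous (@snd S T). Proof. by move=> x; exact: cvg_snd. Qed.

Lemma cont_cst (y : T) : continuous (fun _ : S => y).
Proof. by move=> x; exact: cvg_cst. Qed.

Lemma cont_id : continuous (fun x : S => x). Proof. by move=> x; exact: cvg_id. Qed.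

Implicit Types f g : S -> R.

Lemma contD f g : continuous f -> continuous g -> continuous (fun x => f x + g x).
Proof. by move=> fc gc x; apply: cvgD; [exact: fc|exact: gc]. Qed.

Lemma contB f g : continuous f -> continuous g -> continuous (fun x => f x - g x).
Proof. by move=> fc gc x; apply: cvgB; [exact: fc|exact: gc]. Qed.

Lemma contM f g : continuous f -> continuous g -> continuous (fun x => f x * g x).
Proof. by move=> fc gc x; apply: cvgM; [exact: fc|exact: gc]. Qed.

End Continuity.

Section OneVariable.
Variable R : realType.
Implicit Types (a b c x t : R) (u v : R -> R).

(** Not oriented: for b < a the interval is empty and the value is 0. Signed antiderivatives go
    through [primitive]. *)
Definition iint a b u : R := \int[@lebesgue_measure R]_(t in `[a, b]) u t.

Lemma iint_integrable a b u : continuous u ->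
  (@lebesgue_measure R).-integrable `[a, b] (EFin \o u).
Proof.
move=> uc; apply: continuous_compact_integrable; first exact: segment_compact.
exact: continuous_subspaceT.
Qed.

Lemma iint_lin a b c u v : continuous u -> continuous v ->
  iint a b (fun t => c * u t + v t) = c * iint a b u + iint a b v.
Proof.
move=> uc vc; rewrite /iint RintegralD//.
- by rewrite RintegralZl//; exact: iint_integrable.
- by apply: iint_integrable => t; apply: cvgM; [exact: cvg_cst|exact: uc].
- exact: iint_integrable.
Qed.

Lemma iintZ a b c u : continuous u -> iint a b (fun t => c * u t) = c * iint a b u.
Proof. by move=> uc; rewrite /iint RintegralZl//; exact: iint_integrable. Qed.

Lemma iintD a b u v : continuous u -> continuous v ->
  iint a b (fun t => u t + v t) = iint a b u + iint a b v.
Proof. by move=> uc vc; rewrite /iint RintegralD//; exact: iint_integrable. Qed.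

Lemma iintB a b u v : continuous u -> continuous v ->
  iint a b (fun t => u t - v t) = iint a b u - iint a b v.
Proof. by move=> uc vc; rewrite /iint RintegralB//; exact: iint_integrable. Qed.

Lemma iint_cst a b c : a <= b -> iint a b (fun=> c) = c * (b - a).
Proof.
move=> ab; rewrite /iint Rintegral_cst//= lebesgue_measure_itv /= lte_fin.
by case: ifPn => //; rewrite -leNgt => ba; rewrite (@le_anti _ _ a b) ?ab ?ba// subrr.
Qed.

Lemma eq_iint a b u v : (forall t, a <= t <= b -> u t = v t) ->
  iint a b u = iint a b v.
Proof.
by move=> uv; apply: eq_Rintegral => t; rewrite inE /= in_itv /=; exact: uv.
Qed.

Lemma le_iint a b u v : continuous u -> continuous v ->
  (forall t, a <= t <= b -> u t <= v t) -> iint a b u <= iint a b v.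
Proof.
move=> uc vc uv; apply: le_Rintegral => //; try exact: iint_integrable.
Qed.

Lemma iint_bound a b c u : a <= b -> continuous u ->
  (forall t, a <= t <= b -> `|u t| <= c) -> `|iint a b u| <= c * (b - a).
Proof.
move=> ab uc uB; rewrite ler_norml -mulNr -!iint_cst//.
have cc (d : R) : continuous (fun _ : R => d) by exact: cont_cst.
by apply/andP; split; apply: le_iint => // t /uB; rewrite ler_norml => /andP[].
Qed.

(** By compactness of [a, b], in the form of near-covering, [g y] is uniformly close to [g x] on
    [a, b] for y near x. The parameter space is arbitrary so that numbers, pairs and points of R^n
    can all play the part of x. *)
Lemma iint_cont (T : topologicalType) a b (g : T -> R -> R) : a <= b ->
  continuous (fun p : T * R => g p.1 p.2) -> continuous (fun x : T => iint a b (g x)).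
Proof.
move=> ab gc x; apply/(@cvgrPdist_le _ _ _ _ (nbhs_filter x)) => e e0.
have gsc y : continuous (g y).
  exact: (cont_comp (cont_pair (@cont_cst _ _ y) (@cont_id _)) gc).
pose d := e / (b - a + 1).
have p0 : 0 < b - a + 1 by rewrite ltr_wpDl// subr_ge0.
have d0 : 0 < d by rewrite divr_gt0.
have cov : near_covering (`[a, b]%classic : set R).
  by apply/compact_near_coveringP; exact: segment_compact.
have : \forall y \near x, `[a, b]%classic `<=` (fun t => `|g x t - g y t| <= d).
  apply: (cov _ (nbhs x) (fun y t => `|g x t - g y t| <= d)) => t _.
  have c : {for (t, x), continuous (fun p : R * T => g x p.1 - g p.2 p.1)}.
    apply: contB; first exact: (cont_comp (@cont_fst _ _) (@gsc x)).
    exact: (cont_comp (cont_pair (@cont_snd _ _) (@cont_fst _ _)) gc).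
  move/(@cvgrPdist_le _ _ _ _ (nbhs_filter (t, x))) : c => /(_ d d0) /=; rewrite subrr.
  by apply: filterS => -[s' y] /=; rewrite sub0r normrN.
apply: filterS => y hy; rewrite -iintB//.
have := @iint_bound a b d (fun t => g x t - g y t) ab.
move=> /(_ _ _)/le_trans; apply.
- by move=> t; apply: cvgB; exact: gsc.
- by move=> t tab; apply: hy; rewrite /= in_itv.
- by rewrite /d mulrAC ler_pdivrMr// ler_wpM2l ?ltW// ltrDl.
Qed.

Lemma is_derive_cont u x d : is_derive x 1 u d -> {for x, continuous u}.
Proof.
by move=> [ud _]; apply: differentiable_continuous; exact/derivable1_diffP.
Qed.

Lemma FTC2 a b u u' : a <= b -> (forall t, a <= t <= b -> is_derive t 1 u (u' t)) ->
  continuous u' -> iint a b u' = u b - u a.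
Proof.
rewrite le_eqVlt => /predU1P[<- _ _|ab du uc].
  by rewrite /iint set_itv1 Rintegral_set1 subrr.
rewrite /iint /Rintegral (@continuous_FTC2 _ _ u)//.
- exact: continuous_subspaceT.
- split.
  + by move=> x; rewrite in_itv /= => /andP[ax xb]; apply: (@ex_derive _ _ _ _ _ _ _ (du x _)); rewrite !ltW.
  + by apply: cvg_at_right_filter; apply: is_derive_cont (du a _); rewrite lexx ltW.
  + by apply: cvg_at_left_filter; apply: is_derive_cont (du b _); rewrite lexx ltW.
- move=> x; rewrite in_itv /= => /andP[ax xb].
  by rewrite derive1E; apply: (@derive_val _ _ _ _ _ _ _ (du x _)); rewrite !ltW.
Qed.

Lemma near_is_derive u v x d : (\forall y \near x, u y = v y) ->
  is_derive x 1 u d -> is_derive x 1 v d.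
Proof.
move=> uv [ud <-]; apply: (@DeriveDef _ _ _ x 1 v).
  exact: near_eq_derivable ud.
by rewrite (near_eq_derive _ uv).
Qed.

(** An integral from a fixed base point is an antiderivative only to the right of that point; the
    base point -(|x| + 1) leaves a ball that contains x. *)
Lemma FTC1_near u x : continuous u -> exists v (B : R), `|x| < B /\
  forall y : R, `|y| < B -> is_derive y 1 v (u y).
Proof.
move=> uc; exists (fun y => \int[@lebesgue_measure R]_(t in `[- (`|x| + 1), y]) u t), (`|x| + 1).
split; first by rewrite ltrDl.
move=> y; rewrite ltr_norml => /andP[y1 y2].
have [d1 d2] := @continuous_FTC1 R u (BLeft (- (`|x| + 1))) y _ y2
  (iint_integrable _ _ uc) y1 (uc y).
by apply: (DeriveDef d1); rewrite -derive1E.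
Qed.

Lemma is_derive_affine c d x : is_derive x 1 (fun s : R => c + s * d) d.
Proof.
have -> : (fun s : R => c + s * d) = cst c + (d \*: (@id R)).
  by apply/funext => s; rewrite !fctE /= [d *: s]mulrC.
have := is_deriveD (is_derive_cst c x 1) (is_deriveZ d (is_derive_id x 1)).
by rewrite add0r [d *: 1]mulr1.
Qed.

(** The substitution to [0, 1] carries the sign of y - x, so that both orders of x and y are covered
    at once. *)
Lemma FTC_segment u v x y (B : R) : continuous u -> `|x| < B -> `|y| < B ->
  (forall z : R, `|z| < B -> is_derive z 1 v (u z)) ->
  (y - x) * iint 0 1 (fun s => u (x + s * (y - x))) = v y - v x.
Proof.
move=> uc xB yB dv.
have ac : continuous (fun s : R => x + s * (y - x)).
  by move=> s; exact: is_derive_cont (is_derive_affine _ _ _).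
have uac : continuous (fun s : R => u (x + s * (y - x))) by exact: cont_comp uc.
rewrite -iintZ//; have -> : v y - v x = v (x + 1 * (y - x)) - v (x + 0 * (y - x)).
  by rewrite mul1r mul0r addr0 [x + (y - x)]addrC subrK.
apply: (@FTC2 0 1 (fun s => v (x + s * (y - x)))) => //.
- move=> s s01; rewrite [(y - x) * _]mulrC.
  apply: (@is_derive1_comp _ v (fun s => x + s * (y - x))); last exact: is_derive_affine.
  apply: dv; rewrite ltr_norml; move: xB yB s01; rewrite !ltr_norml.
  move=> /andP[? ?] /andP[? ?] /andP[? ?].
  (* One of s, 1 - s is at least 1/2, which puts the convex combination strictly inside (-B, B). *)
  by have [s2|s2] := lerP s (1 / 2); apply/andP; split; nra.
- by apply: contM; [exact: cont_cst|exact: uac].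
Qed.

(** The oriented integral of u from 0 to x, rescaled to [0, 1]: it has the right sign for x < 0, and
    parameters are handled by [iint_cont]. *)
Definition primitive u x : R := x * iint 0 1 (fun s => u (s * x)).

Lemma is_derive_primitive u x : continuous u -> is_derive x 1 (primitive u) (u x).
Proof.
move=> uc; have [v [B [xB dv]]] := FTC1_near x uc.
have B0 : `|0 : R| < B by rewrite normr0 (le_lt_trans _ xB).
apply: (@near_is_derive (fun y => v y - v 0)).
  near=> y; have yB : `|y| < B.
    near: y; apply: (@cvgr_lt _ _ _ _ (fun y : R => `|y|)) xB.
    exact: (@norm_continuous _ R x).
  rewrite -(FTC_segment uc B0 yB dv) subr0 /primitive; congr (_ * iint _ _ _).
  by apply/funext => s; rewrite add0r.
have := is_deriveB (dv x xB) (is_derive_cst (v 0) x 1).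
by rewrite subr0.
Unshelve. all: by end_near. Qed.

Lemma FTC_primitive u v t : continuous u -> (forall z : R, is_derive z 1 v (u z)) ->
  v t = v 0 + primitive u t.
Proof.
move=> uc dv; have t1 : `|t| < `|t| + 1 by rewrite ltrDl.
have t0 : `|0 : R| < `|t| + 1 by rewrite normr0 (le_lt_trans _ t1).
have -> : primitive u t = v t - v 0; last by rewrite addrC subrK.
rewrite -(FTC_segment uc t0 t1 (fun z _ => dv z)) subr0 /primitive.
by congr (_ * iint _ _ _); apply/funext => s; rewrite add0r.
Qed.

(** Caratheodory's criterion: the derivative is the value at 0 of a factor K of the increment that
    is continuous at 0. *)
Lemma is_derive_quotient u (K : R -> R) x : (forall h, u (x + h) - u x = h * K h) ->
  {for 0, continuous K} -> is_derive x 1 u (K 0).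
Proof.
move=> uK Kc.
have H : h^-1 *: (u (h *: 1 + x) - u x) @[h --> 0^'] --> K 0.
  have : K h @[h --> 0^'] --> K 0 by apply: cvg_within_filter.
  apply: cvg_trans; apply: near_eq_cvg; near=> h.
  have h0 : h != 0 by near: h; exact: nbhs_dnbhs_neq.
  rewrite [h *: 1]mulr1 [h + x]addrC uK /GRing.scale /= mulrA mulVf// mul1r.
  by [].
apply: DeriveDef; first exact: cvgP H.
exact: cvg_lim H.
Unshelve. all: by end_near. Qed.

(* Hadamard's lemma: the difference quotient is the mean of the derivative over
   the segment, hence extends continuously to increment 0. *)
Lemma is_derive_iint a b (F F1 : R -> R -> R) x : a <= b ->
  (forall x, continuous (F x)) ->
  continuous (fun p : R * R => F1 p.1 p.2) ->
  (forall x t, is_derive x 1 (F^~ t) (F1 x t)) ->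
  is_derive x 1 (fun x => iint a b (F x)) (iint a b (F1 x)).
Proof.
move=> ab Fc F1c dF.
pose k h t := iint 0 1 (fun s => F1 (x + s * h) t).
have kc : continuous (fun p : R * R => k p.1 p.2).
  apply: (@iint_cont _ 0 1 (fun p s => F1 (x + s * p.1) p.2)) => //.
  apply: (@cont_comp _ _ _ (fun p : R * R * R => (x + p.2 * p.1.1, p.1.2)) _ _ F1c).
  have c1 : continuous (fun p : R * R * R => p.1) := @cont_fst _ _.
  apply: cont_pair; last exact: cont_comp c1 (@cont_snd _ _).
  apply: contD; first exact: cont_cst.
  by apply: contM; [exact: cont_snd|exact: cont_comp c1 (@cont_fst _ _)].
have -> : iint a b (F1 x) = iint a b (k 0).
  apply: eq_iint => t _; rewrite -[LHS](mulr1) -{1}(subr0 1) -iint_cst//.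
  by apply: eq_iint => s _; rewrite mulr0 addr0.
apply: (@is_derive_quotient _ (fun h => iint a b (k h))); last first.
  by have h := @iint_cont R a b k ab kc; exact: h.
move=> h; rewrite -iintB// -iintZ//; last first.
  exact: (cont_comp (cont_pair (@cont_cst _ _ h) (@cont_id _)) kc).
apply: eq_iint => t _.
have F1t : continuous (F1^~ t).
  exact: (cont_comp (cont_pair (@cont_id _) (@cont_cst _ _ t)) F1c).
rewrite -(@FTC_segment (F1^~ t) (F^~ t) x (x + h) (`|x| + `|x + h| + 1))//.
- by rewrite [x + h - x]addrC addrA addNr add0r.
- by rewrite -addrA ltrDl ltr_wpDl.
- by rewrite -addrA addrCA ltrDl ltr_wpDl.
Qed.

(** Fubini by calculus: as functions of the upper end of [a, b], both sides have the same
    derivative. [H] integrates in s alone, and differentiation under the integral sign does the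
    rest. *)
Lemma iint_swap a b c d (h : R -> R -> R) : a <= b -> c <= d ->
  continuous (fun p : R * R => h p.1 p.2) ->
  iint a b (fun s => iint c d (h s)) = iint c d (fun t => iint a b (h^~ t)).
Proof.
move=> ab cd hc.
have h1 t : continuous (h^~ t).
  exact: (cont_comp (cont_pair (@cont_id _) (@cont_cst _ _ t)) hc).
pose H x t := primitive (h^~ t) x.
have Hc x : continuous (H x).
  apply: contM; first exact: cont_cst.
  apply: (@iint_cont _ 0 1 (fun t s => h (s * x) t)) => //.
  apply: (@cont_comp _ _ _ (fun p : R * R => (p.2 * x, p.1)) _ _ hc).
  apply: cont_pair; last exact: cont_fst.
  by apply: contM; [exact: cont_snd|exact: cont_cst].
have dH x t : is_derive x 1 (H^~ t) (h x t) by exact: is_derive_primitive.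
have -> : iint a b (fun s => iint c d (h s)) = iint c d (H b) - iint c d (H a).
  apply: (@FTC2 a b (fun x => iint c d (H x))) => //; last exact: iint_cont.
  by move=> s _; exact: is_derive_iint.
rewrite -iintB//; apply: eq_iint => t _; apply/esym.
by apply: (@FTC2 a b (H^~ t)).
Qed.

End OneVariable.

(** * Iterated integrals and partial derivatives *)

Section BoxIntegral.
Variables (R : realType) (n : nat).
Local Notation E := 'rV[R]_n.
Implicit Types (f g : E -> R) (x : E) (k l : 'I_n) (t : R) (s : seq 'I_n).

Lemma upd_eq x k t : upd x k t ord0 k = t. Proof. by rewrite mxE eqxx. Qed.

Lemma upd_neq x k l t : l != k -> upd x k t ord0 l = x ord0 l.
Proof. by move=> lk; rewrite mxE (negPf lk). Qed.

Lemma upd_upd x k t t' : upd (upd x k t) k t' = upd x k t'.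
Proof. by apply/rowP => i; rewrite !mxE; case: eqP. Qed.

Lemma updC x k l t t' : k != l -> upd (upd x k t) l t' = upd (upd x l t') k t.
Proof.
by move=> kl; apply/rowP => i; rewrite !mxE; do 2!case: eqP => // ?; subst; rewrite eqxx in kl.
Qed.

Lemma upd_cont (S : topologicalType) (y : S -> E) k (t : S -> R) :
  continuous y -> continuous t -> continuous (fun z => upd (y z) k (t z)).
Proof.
move=> yc tc; exact: (@cont_comp _ _ _ (fun z => (y z, t z)) (fun p => upd p.1 k p.2)
  (cont_pair yc tc) (@upd_continuous R n k)).
Qed.

Lemma coord_cont k : continuous (fun x : E => x ord0 k).
Proof. exact: coord_continuous. Qed.

Variable M : R.
Hypothesis M0 : 0 <= M.

Let NMM : - M <= M. Proof. by rewrite ge0_cp. Qed.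

(** The result remains a function on R^n, constant in x_k, so that integrations in various
    coordinates are operators that can be composed and permuted. *)
Definition bint k f x : R := iint (- M) M (slice f x k).

Lemma bint_upd k f x t : bint k f (upd x k t) = bint k f x.
Proof. by congr iint; apply/funext => t'; rewrite /slice upd_upd. Qed.

Lemma bint_cont k f : continuous f -> continuous (bint k f).
Proof.
move=> fc; apply: (@iint_cont _ _ _ _ (fun x t => f (upd x k t))) => //.
by apply: (cont_comp _ fc); apply: upd_cont; [exact: cont_fst|exact: cont_snd].
Qed.

Lemma bint_lin k c f g : continuous f -> continuous g ->
  bint k (c *: f + g) = c *: bint k f + bint k g.
Proof. by move=> fc gc; apply/funext => x; apply: iint_lin; exact: continuous_slice. Qed.

Lemma le_bint k f g : continuous f -> continuous g -> (forall x, f x <= g x) ->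
  forall x, bint k f x <= bint k g x.
Proof.
move=> fc gc fg x; apply: le_iint => [||t _]; [exact: continuous_slice..|exact: fg].
Qed.

Lemma bint_bound k f (B : R) : continuous f -> (forall x, `|f x| <= B) ->
  forall x, `|bint k f x| <= B * (M *+ 2).
Proof.
move=> fc fB x; have := @iint_bound R (- M) M B (slice f x k) NMM.
rewrite opprK -mulr2n => h; apply: h; first exact: continuous_slice.
by move=> t _; exact: fB.
Qed.

Lemma bintC k l f : continuous f -> bint k (bint l f) = bint l (bint k f).
Proof.
have [->//|kl] := eqVneq k l.
move=> fc; apply/funext => x.
have swap := @iint_swap R (- M) M (- M) M (fun s t : R => f (upd (upd x k s) l t)) NMM NMM.
apply: (etrans (swap _)); last first.
  by apply: eq_iint => t _; congr iint; apply/funext => t'; rewrite /slice updC.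
apply: (cont_comp _ fc); apply: upd_cont; last exact: cont_snd.
by apply: upd_cont; [exact: cont_cst|exact: cont_fst].
Qed.

Definition bint_seq s f : E -> R := foldr bint f s.

Lemma bint_seq_cont s f : continuous f -> continuous (bint_seq s f).
Proof. by move=> fc; elim: s => //= k s IH; exact: bint_cont. Qed.

Lemma bint_seq_lin s c f g : continuous f -> continuous g ->
  bint_seq s (c *: f + g) = c *: bint_seq s f + bint_seq s g.
Proof.
by move=> fc gc; elim: s => //= k s ->; apply: bint_lin; exact: bint_seq_cont.
Qed.

Lemma bint_seq_rcons s k f : bint_seq (rcons s k) f = bint_seq s (bint k f).
Proof. by rewrite /bint_seq foldr_rcons. Qed.

Lemma bint_seq_move s1 s2 k f : continuous f ->
  bint_seq (s1 ++ k :: s2) f = bint k (bint_seq (s1 ++ s2) f).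
Proof.
move=> fc; elim: s1 => //= l s ->; rewrite bintC//; exact: bint_seq_cont.
Qed.

Lemma perm_bint_seq s1 s2 f : continuous f -> perm_eq s1 s2 ->
  bint_seq s1 f = bint_seq s2 f.
Proof.
move=> fc; elim: s1 s2 => [|k s1 IH] s2 s12.
  by move: s12; rewrite perm_sym => /perm_nilP->.
have ks2 : k \in s2 by rewrite -(perm_mem s12) mem_head.
case/splitPr: ks2 s12 => p q; rewrite perm_sym perm_catC /= perm_cons perm_catC => s12.
by rewrite bint_seq_move//= (IH (p ++ q))// perm_sym.
Qed.

Lemma bint_seq0 s : bint_seq s (fun=> 0) = (fun=> 0).
Proof.
elim: s => //= k s ->; apply/funext => x; rewrite /bint /slice.
by rewrite iint_cst// mul0r.
Qed.

Lemma bint_seq_upd s k f x t : k \in s -> continuous f ->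
  bint_seq s f (upd x k t) = bint_seq s f x.
Proof.
move=> + fc; elim: s x => //= l s IH x; have [->_|kl] := eqVneq k l.
  exact: bint_upd.
rewrite inE (negPf kl) /= => ks; congr iint; apply/funext => t'.
by rewrite /slice updC// IH.
Qed.

Lemma bint_int_coord s k f : box_supp M s f -> k \notin s ->
  int_coord k f = bint k f.
Proof.
move=> fb ks; apply/funext => x.
exact: (box_supp1_itv (box_supp_slice x fb ks)).
Qed.

Lemma bint_int_seq s f : uniq s -> box_supp M [::] f -> int_seq s f = bint_seq s f.
Proof.
move=> + fb; elim: s => //= k s IH /andP[ks us].
by rewrite (bint_int_coord (box_supp_int_seq M0 us fb) ks) (IH us).
Qed.

Lemma bint_Rn_int f : box_supp M [::] f -> Rn_int f = bint_seq (enum 'I_n) f 0.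
Proof. by move=> fb; rewrite -bint_int_seq ?enum_uniq. Qed.

(** Replaces the coordinates of x by those of y one at a time; a full integral may thus be evaluated
    at any base point. *)
Lemma bint_seq_const s f x y : continuous f -> (forall k, k \in s) ->
  bint_seq s f x = bint_seq s f y.
Proof.
move=> fc sT.
have H (r : seq 'I_n) : exists z : E, (forall k, k \in r -> z ord0 k = y ord0 k) /\
    bint_seq s f x = bint_seq s f z.
  elim: r => [|k r [z [zy ->]]]; first by exists x.
  exists (upd z k (y ord0 k)); split; last by rewrite bint_seq_upd.
  move=> l; rewrite inE mxE; case: eqP => [->//|_ /=]; exact: zy.
have [z [zy ->]] := H (enum 'I_n); congr (bint_seq _ _ _).
by apply/rowP => k; rewrite zy// mem_enum.
Qed.

End BoxIntegral.

(** * Partial derivatives as a relation, and integration by parts *)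

Section Pderiv.
Variables (R : realType) (n : nat).
Local Notation E := 'rV[R]_n.
Implicit Types (f g : E -> R) (x : E) (k l : 'I_n) (t : R) (s : seq 'I_n).

(** As a relation it asserts that the derivative exists, which an equation on the total function
    [partial] would not, and it accepts any formula for f'. *)
Definition pderiv k f f' := forall x, is_derive (x ord0 k) 1 (slice f x k) (f' x).

Lemma slice_upd f x k t : slice f (upd x k t) k = slice f x k.
Proof. by apply/funext => t'; rewrite /slice upd_upd. Qed.

Lemma is_derive_slice k f f' x t : pderiv k f f' ->
  is_derive t 1 (slice f x k) (f' (upd x k t)).
Proof. by move=> /(_ (upd x k t)); rewrite upd_eq slice_upd. Qed.

Lemma pderiv_partial k f f' : pderiv k f f' -> partial k f = f'.
Proof. by move=> d; apply/funext => x; rewrite /partial derive1E; exact: derive_val. Qed.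

Lemma derivable_pderiv k f : (forall x, derivable (slice f x k) (x ord0 k) 1) ->
  pderiv k f (partial k f).
Proof. by move=> d x; rewrite /partial derive1E; apply: DeriveDef. Qed.

Lemma smooth_pderiv s k f : smooth f -> pderiv k (partials s f) (partials (k :: s) f).
Proof. by move=> fs; apply: derivable_pderiv; exact: (fs s).2. Qed.

Lemma pderivM k f f' g g' : pderiv k f f' -> pderiv k g g' ->
  pderiv k (fun x => f x * g x) (fun x => f' x * g x + f x * g' x).
Proof.
move=> df dg x; have := is_deriveM (df x) (dg x).
by rewrite /slice !upd_id addrC [X in _ X -> _](_ : _ = f' x * g x + f x * g' x)// [g x *: _]mulrC.
Qed.

Lemma pderivD k f f' g g' : pderiv k f f' -> pderiv k g g' ->
  pderiv k (fun x => f x + g x) (fun x => f' x + g' x).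
Proof. by move=> df dg x; exact: is_deriveD (df x) (dg x). Qed.

Lemma pderiv_cst k c : pderiv k (fun=> c) (fun=> 0).
Proof. by move=> x; exact: is_derive_cst. Qed.

Lemma bint_pderiv M k f f' x : 0 <= M -> pderiv k f f' -> continuous f' ->
  bint M k f' x = f (upd x k M) - f (upd x k (- M)).
Proof.
move=> M0 df fc; apply: (@FTC2 _ _ _ (slice f x k)); first by rewrite ge0_cp.
- by move=> t _; exact: is_derive_slice.
- exact: continuous_slice.
Qed.

Lemma box_supp_le (M M' : R) s f : M <= M' -> box_supp M s f -> box_supp M' s f.
Proof.
by move=> MM' [fc f0]; split=> // x i iS xM; apply: (f0 x i iS); exact: le_lt_trans xM.
Qed.

Lemma pderiv_supp0 k f f' x : pderiv k f f' -> ~ supp f x -> f' x = 0.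
Proof.
move=> /pderiv_partial <- fx; apply: contrapT => /eqP h; apply: fx.
by apply: (@supp_partial _ _ k); exact: subset_closure.
Qed.

Lemma box_supp_supp (M : R) f : box_supp M [::] f ->
  forall x, supp f x -> forall i, `|x ord0 i| <= M.
Proof.
move=> [fc f0] x + i; have cl : closed [set y : E | `|y ord0 i| <= M].
  have c : continuous (fun y : E => `|y ord0 i|).
    exact: (cont_comp (@coord_cont _ _ i) (@norm_continuous _ _)).
  exact: (closed_comp (fun y _ => c y) (@closed_le _ M)).
move/(@supp_sub _ _ f _ cl); apply.
by move=> y /negP; rewrite -ltNge; exact: f0.
Qed.

Lemma box_supp_pderiv M k f f' : pderiv k f f' -> continuous f' ->
  box_supp M [::] f -> box_supp M [::] f'.
Proof.
move=> df fc fb; split=> // x i _ xM; apply: (pderiv_supp0 df) => /(box_supp_supp fb)/(_ i).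
by rewrite leNgt xM.
Qed.

(** Integrating first in x_k leaves a difference of boundary values, and these vanish. *)
Lemma Rn_int_pderiv M k f f' : 0 <= M -> pderiv k f f' -> continuous f' ->
  box_supp M [::] f -> Rn_int f' = 0.
Proof.
(* [box_supp M] gives vanishing for |x_k| > M, so the boundary values are taken at M + 1 and -(M +
   1). *)
move=> M0 df fc fb; have M1 : 0 <= M + 1 by rewrite addr_ge0.
have MM : M <= M + 1 by rewrite lerDl.
have fb' := box_supp_pderiv df fc fb.
rewrite (bint_Rn_int M1 (box_supp_le MM fb')).
have ke : k \in enum 'I_n by rewrite mem_enum.
(* With k last in the list, [foldr] performs the k-th integration first. *)
rewrite (@perm_bint_seq _ _ _ M1 _ (rcons (rem k (enum 'I_n)) k))//; last first.
  by rewrite (perm_trans (perm_to_rem ke))// perm_sym perm_rcons.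
rewrite bint_seq_rcons (_ : bint _ _ _ = fun=> 0); first by rewrite bint_seq0.
apply/funext => x; rewrite (bint_pderiv _ _ df)//.
by rewrite !(fb.2 _ k)// ?subrr// upd_eq ?normrN ger0_norm// ltrDl.
Qed.

Lemma Rn_int_lin M c f g : 0 <= M -> box_supp M [::] f -> box_supp M [::] g ->
  Rn_int (fun x => c * f x + g x) = c * Rn_int f + Rn_int g.
Proof.
move=> M0 fb gb; have := @int_seq_lin _ _ M M0 (enum 'I_n) c f g (enum_uniq _) fb gb.
by move/(congr1 (fun h => h 0)).
Qed.

Lemma box_suppMl (M : R) f g : continuous f -> box_supp M [::] g ->
  box_supp M [::] (fun x => f x * g x).
Proof.
move=> fc [gc g0]; split; first exact: contM.
by move=> x i iS xM; rewrite (g0 x i)// mulr0.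
Qed.

Lemma Rn_int_parts M k f f' g g' : 0 <= M -> pderiv k f f' -> pderiv k g g' ->
  continuous f -> continuous f' -> continuous g' -> box_supp M [::] g ->
  Rn_int (fun x => f' x * g x) = - Rn_int (fun x => f x * g' x).
Proof.
move=> M0 df dg fc fc' gc' gb.
have gb' := box_supp_pderiv dg gc' gb.
have b1 := box_suppMl fc' gb; have b2 := box_suppMl fc gb'.
apply/eqP; rewrite -addr_eq0 addrC -[X in X + _](mul1r) -(Rn_int_lin _ M0)//; apply/eqP.
rewrite (_ : (fun x => _) = (fun x => f' x * g x + f x * g' x)); last first.
  by apply/funext => x; rewrite mul1r addrC.
apply: (Rn_int_pderiv M0 (pderivM df dg)); last exact: box_suppMl.
by apply: contD; apply: contM => //; exact: gb.1.
Qed.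

End Pderiv.

(** * Smooth functions *)

Section Smooth.
Variables (R : realType) (n : nat).
Local Notation E := 'rV[R]_n.
Implicit Types (f g : E -> R) (x : E) (h k l : 'I_n).

(* Differentiating f(.., 0) + int_0^t d_k f first in x_h, then in x_k = t. *)
Lemma pderivC h k f fh fk g : h != k -> pderiv k f fk -> pderiv h f fh ->
  pderiv h fk g -> continuous fk -> continuous g -> pderiv k fh g.
Proof.
move=> hk dk dh dg fkc gc x.
have [s0 [t0 xE]] : exists s0 t0 : R, x = upd (upd x h s0) k t0.
  by exists (x ord0 h), (x ord0 k); rewrite !upd_id.
pose F (q : E -> R) s t := q (upd (upd x h s) k t).
have Fc q : continuous q -> continuous (fun p : R * R => F q p.1 p.2).
  move=> qc; apply: (cont_comp _ qc); apply: upd_cont; last exact: cont_snd.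
  by apply: upd_cont; [exact: cont_cst|exact: cont_fst].
have Fc1 q s : continuous q -> continuous (F q s).
  by move=> qc; apply: (cont_comp _ qc); apply: upd_cont; [exact: cont_cst|exact: cont_id].
have dFk q q' (s t : R) : pderiv k q q' -> is_derive t 1 (F q s) (F q' s t).
  by move=> dq; exact: (is_derive_slice _ _ dq).
have dFh q q' (s t : R) : pderiv h q q' -> is_derive s 1 ((F q)^~ t) (F q' s t).
  move=> dq; rewrite /F (updC _ _ _ hk) (_ : (F q)^~ t = slice q (upd x k t) h).
    exact: (is_derive_slice _ _ dq).
  by apply/funext => s'; rewrite /F updC.
have E1 s t : F f s t = F f s 0 + primitive (F fk s) t.
  apply: FTC_primitive; first exact: Fc1.
  by move=> z; exact: dFk.
have E2 s t : F fh s t = F fh s 0 + primitive (F g s) t.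
  have d1 := dFh f fh s t dh.
  have d2 : is_derive s 1 (fun s => iint 0 1 (fun r => F fk s (r * t)))
                          (iint 0 1 (fun r => F g s (r * t))).
    have mc : continuous (fun r : R => r * t) by apply: contM; [exact: cont_id|exact: cont_cst].
    apply: (@is_derive_iint R 0 1 (fun s r => F fk s (r * t)) (fun s r => F g s (r * t))) => //.
    + by move=> s'; apply: cont_comp mc _; exact: Fc1.
    + apply: (@cont_comp _ _ _ (fun p : R * R => (p.1, p.2 * t)) _ _ (Fc _ gc)).
      apply: cont_pair; first exact: cont_fst.
      by apply: contM; [exact: cont_snd|exact: cont_cst].
    + by move=> s' r; exact: dFh.
  have d3 := is_deriveD (dFh f fh s 0 dh) (is_deriveZ t d2).
  rewrite -(@derive_val _ _ _ _ _ _ _ d1) -(@derive_val _ _ _ _ _ _ _ d3).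
  by congr ('D_(1 : R) _ _); apply/funext => s'; rewrite E1.
have slE : slice fh x k = fun t => F fh s0 0 + primitive (F g s0) t.
  by apply/funext => t; rewrite -E2 {1}xE /slice upd_upd.
have xk : x ord0 k = t0 by rewrite {1}xE upd_eq.
have gx : g x = F g s0 t0 by rewrite {1}xE.
rewrite slE xk gx -[F g s0 t0]add0r.
exact: is_deriveD (is_derive_cst (F fh s0 0) t0 1)
  (is_derive_primitive t0 (Fc1 g s0 gc)).
Qed.

(** Smoothness is the largest property of continuous functions stable under partial derivatives, so
    it can be proved by exhibiting any stable class. *)
Lemma smooth_coind (P : (E -> R) -> Prop) :
  (forall f, P f -> continuous f /\ forall k, exists2 f', pderiv k f f' & P f') ->
  forall f, P f -> smooth f.
Proof.
move=> H f Pf; have Ps s : P (partials s f).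
  elim: s => //= k s /H[_ /(_ k)[f' d Pf']].
  by rewrite (pderiv_partial d).
move=> s; have [c d] := H _ (Ps s); split=> // k x.
by have [f' df' _] := d k; exact: (@ex_derive _ _ _ _ _ _ _ (df' x)).
Qed.

Lemma smooth_cont f : smooth f -> continuous f.
Proof. by move=> fs; exact: (fs [::]).1. Qed.

Lemma smooth_pderiv0 k f : smooth f -> pderiv k f (partial k f).
Proof. by move=> fs; exact: (@smooth_pderiv _ _ [::] k f fs). Qed.

(** The stable class for products: Leibniz' rule leads from products of smooth functions to sums of
    such products. *)
Inductive sum_of_products : (E -> R) -> Prop :=
| sop_mul f g : smooth f -> smooth g -> sum_of_products (fun x => f x * g x)
| sop_add f g : sum_of_products f -> sum_of_products g ->
    sum_of_products (fun x => f x + g x).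

Lemma smoothM f g : smooth f -> smooth g -> smooth (fun x => f x * g x).
Proof.
move=> fs gs; apply: (@smooth_coind sum_of_products); last exact: sop_mul.
move=> h; elim=> {h fs gs}{f g} [f g fs gs|f g Pf [fc fd] Pg [gc gd]].
  split; first by apply: contM; exact: smooth_cont.
  move=> k; exists (fun x => partial k f x * g x + f x * partial k g x).
    by apply: pderivM; exact: smooth_pderiv0.
  exact: sop_add (sop_mul (smooth_partial k fs) gs) (sop_mul fs (smooth_partial k gs)).
split; first exact: contD.
move=> k; have [f' df Pf'] := fd k; have [g' dg Pg'] := gd k.
exists (fun x => f' x + g' x); first exact: pderivD.
exact: sop_add.
Qed.

Lemma smooth_cst c : smooth (fun _ : E => c).
Proof.
apply: (@smooth_coind (fun f => exists c, f = fun=> c)); last by exists c.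
move=> _ [d ->]; split; first exact: cont_cst.
by move=> k; exists (fun=> 0); [exact: pderiv_cst|exists 0].
Qed.

Lemma smoothD f g : smooth f -> smooth g -> smooth (fun x => f x + g x).
Proof.
move=> fs gs; have := @smooth_lin _ _ 1 f g fs gs.
by rewrite (_ : 1 *: f + g = fun x => f x + g x)// scale1r.
Qed.

Lemma smoothZ c f : smooth f -> smooth (fun x => c * f x).
Proof. by move=> fs; apply: smoothM => //; exact: smooth_cst. Qed.

Lemma partialC h k f : smooth f -> partial h (partial k f) = partial k (partial h f).
Proof.
move=> fs; have [->//|hk] := eqVneq h k; apply/esym; apply: pderiv_partial.
have fks := smooth_partial k fs.
apply: (pderivC hk (smooth_pderiv0 k fs) (smooth_pderiv0 h fs) (smooth_pderiv0 h fks)).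
  exact: smooth_cont.
by apply: smooth_cont; exact: smooth_partial.
Qed.

Lemma smooth_partials s f : smooth f -> smooth (partials s f).
Proof. by move=> fs; elim: s => [//|k s IH]; exact: (smooth_partial k IH). Qed.

Lemma partials_cat s1 s2 f : partials (s1 ++ s2) f = partials s1 (partials s2 f).
Proof. exact: foldr_cat. Qed.

Lemma perm_partials s1 s2 f : smooth f -> perm_eq s1 s2 -> partials s1 f = partials s2 f.
Proof.
move=> fs; elim: s1 s2 => [|k s1 IH] s2 s12.
  by move: s12; rewrite perm_sym => /perm_nilP->.
have mv p q : partials (p ++ k :: q) f = partial k (partials (p ++ q) f).
  elim: p => //= l p ->; apply: partialC; exact: smooth_partials.
have ks2 : k \in s2 by rewrite -(perm_mem s12) mem_head.
case/splitPr: ks2 s12 => p q; rewrite perm_sym perm_catC /= perm_cons perm_catC => s12.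
by rewrite mv /= (IH (p ++ q))// perm_sym.
Qed.

Lemma supp_mulr f g : supp (fun x => f x * g x) `<=` supp g.
Proof.
by apply: supp_sub; [exact: closed_supp|move=> x /suppN ->; rewrite mulr0].
Qed.

Lemma supp_mull f g : supp (fun x => f x * g x) `<=` supp f.
Proof.
by apply: supp_sub; [exact: closed_supp|move=> x /suppN ->; rewrite mul0r].
Qed.

Lemma supp_partials s f : supp (partials s f) `<=` supp f.
Proof. by elim: s => //= k s; apply: subset_trans; exact: supp_partial. Qed.

(** Multiplication by a fixed f is continuous for [Cnorm]; seminorm estimates thereby survive a
    partition of unity. The innermost derivative is split by Leibniz' rule, and the induction
    hypothesis serves both f and its partial derivatives; the summand [B] is for the empty list. *)
Lemma Leibniz_bound m f : smooth f -> compact (supp f) ->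
  exists2 C, 0 <= C & forall g, smooth g -> compact (supp g) ->
    Cnorm m (fun x => f x * g x) <= C * Cnorm m g.
Proof.
elim: m f => [|m IH] f fs fk; have [B fB] := compact_supp_bounded (smooth_cont fs) fk.
  have B0 : 0 <= B := le_trans (normr_ge0 _) (fB 0).
  exists B => // g gs gk; apply: Cnorm_le => -[|//] x _ /=.
  by rewrite normrM ler_pM//; exact: (@Cnorm_ub _ _ 0 g [::]).
have B0 : 0 <= B := le_trans (normr_ge0 _) (fB 0).
have [C1 C10 H1] := IH f fs fk.
have H2 k : exists C, 0 <= C /\ forall g, smooth g -> compact (supp g) ->
    Cnorm m (fun x => partial k f x * g x) <= C * Cnorm m g.
  have := IH _ (smooth_partial k fs) _.
  case; last by move=> C C0 HC; exists C.
  exact: (subclosed_compact (@closed_supp _ _ _) fk (@supp_partial _ _ _ _)).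
have [C2 {}H2] := choice H2.
have S0 : 0 <= \sum_k C2 k by apply: sumr_ge0 => k _; exact: (H2 k).1.
exists (B + C1 + \sum_k C2 k); first by rewrite !addr_ge0.
move=> g gs gk; have g0 := Cnorm_ge0 m.+1 gs gk.
apply: Cnorm_le => s x; case/lastP: s => [_|s k].
  rewrite /= normrM (@le_trans _ _ (B * Cnorm m.+1 g))//.
    by rewrite ler_pM//; exact: (@Cnorm_ub _ _ m.+1 g [::]).
  by rewrite ler_wpM2r// -addrA lerDl addr_ge0.
rewrite size_rcons ltnS => sm; rewrite /partials foldr_rcons -/(partials s _).
rewrite (pderiv_partial (pderivM (smooth_pderiv0 k fs) (smooth_pderiv0 k gs))).
have s1 : smooth (fun x => partial k f x * g x) :=
  smoothM (smooth_partial k fs) gs.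
have s2 : smooth (fun x => f x * partial k g x) :=
  smoothM fs (smooth_partial k gs).
have -> : (fun x => partial k f x * g x + f x * partial k g x) =
    1 *: (fun x => partial k f x * g x) + (fun x => f x * partial k g x).
  by rewrite scale1r.
have pgk : compact (supp (partial k g)).
  exact: (subclosed_compact (@closed_supp _ _ _) gk (@supp_partial _ _ _ _)).
have k1 := subclosed_compact (@closed_supp _ _ _) gk (@supp_mulr (partial k f) g).
have k2 := subclosed_compact (@closed_supp _ _ _) pgk (@supp_mulr f (partial k g)).
rewrite partials_lin// scale1r (le_trans (ler_normD _ _))//.
have n1 := le_trans (Cnorm_ub x s1 k1 sm) ((H2 k).2 g gs gk).
have n2 := le_trans (Cnorm_ub x s2 k2 sm) (H1 _ (smooth_partial k gs) pgk).
apply: (le_trans (lerD n1 n2)); rewrite addrC (mulrDl (B + C1)) lerD//.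
  rewrite (@le_trans _ _ (C1 * Cnorm m.+1 g))//.
    by rewrite ler_wpM2l// Cnorm_partial.
  by rewrite ler_wpM2r// lerDr.
rewrite (@le_trans _ _ (C2 k * Cnorm m.+1 g))//.
  by rewrite ler_wpM2l ?(H2 k).1// Cnorm_mono.
rewrite ler_wpM2r// (bigD1 k)//= lerDl sumr_ge0// => i _; exact: (H2 i).1.
Qed.

End Smooth.

(** * Bump functions *)

Section Smooth1.
Variable R : realType.
Implicit Types (u v w : R -> R) (a b c r t x : R) (p q : {poly R}).

(** An impredicative coinductive definition: u lies in some class stable under differentiation.
    Proofs consist in naming that class. *)
Definition smooth1 u := exists2 P : (R -> R) -> Prop, P u &
  forall v, P v -> exists2 v', (forall x : R, is_derive x 1 v (v' x)) & P v'.

Lemma smooth1_deriv u : smooth1 u ->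
  (forall x : R, is_derive x 1 u (derive1 u x)) /\ smooth1 (derive1 u).
Proof.
move=> [P Pu H]; have [u' du Pu'] := H u Pu.
have -> : derive1 u = u' by apply/funext => x; rewrite derive1E; exact: derive_val.
by split=> //; exists P.
Qed.

Lemma smooth1_cont u : smooth1 u -> continuous u.
Proof. by move=> /smooth1_deriv[du _] x; exact: is_derive_cont (du x). Qed.

Lemma smooth1_antideriv u u' : (forall x : R, is_derive x 1 u (u' x)) ->
  smooth1 u' -> smooth1 u.
Proof.
move=> du [P Pu' H]; exists (fun v => v = u \/ P v); first by left.
move=> v [->|/H[v' dv Pv']]; first by exists u' => //; right.
by exists v' => //; right.
Qed.

Lemma smooth1_cst c : smooth1 (fun=> c).
Proof.
exists (fun v => exists c, v = fun=> c); first by exists c.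
by move=> _ [d ->]; exists (fun=> 0); [move=> x; exact: is_derive_cst|exists 0].
Qed.

Lemma smooth1D u v : smooth1 u -> smooth1 v -> smooth1 (fun x => u x + v x).
Proof.
move=> us vs.
exists (fun w => exists f g, [/\ smooth1 f, smooth1 g & w = fun x => f x + g x]).
  by exists u, v.
move=> _ [f [g [/smooth1_deriv[df f's] /smooth1_deriv[dg g's] ->]]].
exists (fun x => derive1 f x + derive1 g x).
  by move=> x; exact: is_deriveD (df x) (dg x).
by exists (derive1 f), (derive1 g).
Qed.

Inductive sum_of_products1 : (R -> R) -> Prop :=
| sop1_mul u v : smooth1 u -> smooth1 v -> sum_of_products1 (fun x => u x * v x)
| sop1_add u v : sum_of_products1 u -> sum_of_products1 v ->
    sum_of_products1 (fun x => u x + v x).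

Lemma smooth1M u v : smooth1 u -> smooth1 v -> smooth1 (fun x => u x * v x).
Proof.
move=> us vs; exists sum_of_products1; first exact: sop1_mul.
move=> w; elim=> {w us vs} {u v} [u v us vs|u v _ [u' du Pu] _ [v' dv Pv]].
  have [du u's] := smooth1_deriv us; have [dv v's] := smooth1_deriv vs.
  exists (fun x => derive1 u x * v x + u x * derive1 v x).
    move=> x; have := is_deriveM (du x) (dv x).
    by rewrite addrC [v x *: _]mulrC.
  by apply: sop1_add; exact: sop1_mul.
exists (fun x => u' x + v' x); first by move=> x; exact: is_deriveD (du x) (dv x).
exact: sop1_add.
Qed.

Lemma smooth1Z c u : smooth1 u -> smooth1 (fun x => c * u x).
Proof. by move=> us; apply: smooth1M => //; exact: smooth1_cst. Qed.

Lemma smooth1_affine a b u : smooth1 u -> smooth1 (fun x => u (a + x * b)).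
Proof.
move=> us.
exists (fun w => exists d v, smooth1 v /\ w = fun x => d * v (a + x * b)).
  by exists 1, u; split => //; apply/funext => x; rewrite mul1r.
move=> _ [d [v [/smooth1_deriv[dv v's] ->]]].
exists (fun x => (d * b) * derive1 v (a + x * b)); last by exists (d * b), (derive1 v).
move=> x; have h := @is_derive1_comp _ v (fun s => a + s * b) x _ _ (dv _) (is_derive_affine a b x).
by have := is_deriveZ d h; rewrite -mulrA [b * _]mulrC; exact.
Qed.

(** Horner induction for all m at once: the factor X of the leading part raises m by one, and the
    constant term is bounded by means of y^(m+1) <= (m+1)! e^y. *)
Lemma poly_expR_bound p m : exists C, forall y : R, 1 <= y ->
  `|p.[y]| * y ^+ m * expR (- y) <= C.
Proof.
elim/poly_ind: p m => [|p c IH] m.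
  by exists 0 => y _; rewrite horner0 normr0 !mul0r.
have [C HC] := IH m.+1.
exists (C + `|c| * m.+1`!%:R) => y y1; have y0 : 0 <= y := le_trans ler01 y1.
have e0 : 0 <= expR (- y) := expR_ge0 _.
have ym (j : nat) : 0 <= y ^+ j := exprn_ge0 _ y0.
rewrite hornerMXaddC -mulrA.
apply: (@le_trans _ _ ((`|p.[y]| * y + `|c|) * (y ^+ m * expR (- y)))).
  rewrite ler_wpM2r ?mulr_ge0//; apply: le_trans (ler_normD _ _) _.
  by rewrite normrM (ger0_norm y0).
rewrite mulrDl lerD//; first by have := HC y y1; rewrite exprS !mulrA.
rewrite ler_wpM2l//.
have h := expR_ge1Dxn m y0.
have {}h : y ^+ m.+1 / m.+1`!%:R <= expR y by rewrite (le_trans _ h)// lerDr.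
rewrite expRN ler_pdivrMr ?expR_gt0// mulrC.
move: h; rewrite ler_pdivrMr ?ltr0n ?fact_gt0//; apply: le_trans.
by rewrite exprS ler_peMl.
Qed.

(* The functions p(1/t) exp(-1/t), extended by 0 to t <= 0, form a class closed
   under differentiation. *)
Definition flat p t : R := if 0 < t then p.[t^-1] * expR (- t^-1) else 0.

(** The case m = 2 of [poly_expR_bound] at y = 1/t. The exponent 2 makes the difference quotient at
    0 tend to 0. *)
Lemma flat_quadratic p : exists C, forall t, `|t| <= 1 -> `|flat p t| <= C * t ^+ 2.
Proof.
have [C HC] := poly_expR_bound p 2; have C0 : 0 <= C.
  by apply: le_trans (HC 1 (lexx _)); rewrite !mulr_ge0// ?expR_ge0// expr1n.
exists C => t t1; rewrite /flat; case: ifPn => [t0|_]; last first.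
  by rewrite normr0 mulr_ge0// sqr_ge0.
move: t1; rewrite (gtr0_norm t0) => t1; have ti : 1 <= t^-1 by rewrite invf_ge1.
have := HC _ ti; rewrite normrM (ger0_norm (expR_ge0 _)) exprVn.
by rewrite mulrAC ler_pdivrMr// exprn_gt0.
Qed.

Lemma near0_le r : 0 < r -> \forall h \near (0 : R), `|h| <= r.
Proof.
move=> r0; have := (@cvgrPdist_le _ _ _ _ (nbhs_filter (0 : R)) id 0).1 (@cvg_id _ _) r r0.
by apply: filterS => h; rewrite sub0r normrN.
Qed.

(** For t > 0 the chain rule brings out -1/t^2, hence the factor X^2 and the difference p - p'. *)
Lemma is_derive_flat p t : is_derive t 1 (flat p) (flat ('X^2 * (p - p^`())) t).
Proof.
have [t0|t0|->] := ltgtP t 0.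
- rewrite {2}/flat ltNge (ltW t0) /=.
  apply: (@near_is_derive _ (cst 0)).
  by near=> s; rewrite /flat ltNge ltW//; near: s; exact: lt_nbhsl.
- rewrite {2}/flat t0.
  apply: (@near_is_derive _ (fun s => p.[s^-1] * expR (- s^-1))).
    by near=> s; rewrite /flat ifT//; near: s; exact: lt_nbhsr.
  have tn : t != 0 by rewrite gt_eqF.
  have dV : is_derive t 1 (fun s : R => s^-1) (- t ^- 2).
    by have := is_deriveV tn (is_derive_id t 1); rewrite [_ *: 1]mulr1.
  have d1 := is_derive1_comp (is_derive_poly p t^-1) dV.
  have d2 := @is_derive1_comp _ expR (fun s => - s^-1) t _ _ (is_derive_expR _) (is_deriveN dV).
  have := is_deriveM d1 d2.
  set D := (X in is_derive _ _ _ X -> _); set D' := (X in _ -> is_derive _ _ _ X).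
  suff -> : D = D' by [].
  rewrite /D /D' /GRing.scale /= hornerM hornerXn hornerD hornerN opprK exprVn.
  by ring.
- rewrite {2}/flat ltxx; have [C HC] := flat_quadratic p.
  have f0 : flat p 0 = 0 by rewrite /flat ltxx.
  (* Division by 0 returns 0, so the quotient flat p h / h already takes the value of the derivative
     at h = 0. *)
  have K0 : flat p 0 / 0 = 0 by rewrite invr0 mulr0.
  rewrite -[X in is_derive _ _ _ X]K0.
  apply: (@is_derive_quotient _ _ (fun h => flat p h / h)).
    move=> h; rewrite add0r f0 subr0; have [->|h0] := eqVneq h 0; first by rewrite f0 mul0r.
    by rewrite mulrC divfK.
  apply/(@cvgrPdist_le _ _ _ _ (nbhs_filter 0)) => e e0; rewrite K0.
  near=> h; rewrite sub0r normrN; have [->|h0] := eqVneq h 0.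
    by rewrite invr0 mulr0 normr0 ltW.
  have h1 : `|h| <= 1.
    by near: h; exact: near0_le.
  have h2 : `|h| <= e / (`|C| + 1).
    near: h; apply: near0_le.
    by rewrite divr_gt0// ltr_wpDl.
  rewrite normf_div ler_pdivrMr ?normr_gt0// (le_trans (HC h h1))//.
  rewrite -real_normK ?num_real// mulrA ler_wpM2r//.
  move: h2; rewrite ler_pdivlMr ?ltr_wpDl// => h2; apply: le_trans h2.
  rewrite mulrC ler_wpM2l// (le_trans (ler_norm C))// lerDl//.
Unshelve. all: by end_near. Qed.

Lemma smooth1_flat p : smooth1 (flat p).
Proof.
exists (fun v => exists p, v = flat p); first by exists p.
move=> _ [q ->]; exists (flat ('X^2 * (q - q^`()))); last by eexists.
exact: is_derive_flat.
Qed.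

Lemma bump1_exists a b : a < b -> exists2 u, smooth1 u &
  [/\ forall t, 0 <= u t, forall t, a < t < b -> 0 < u t &
      forall t, ~~ (a < t < b) -> u t = 0].
Proof.
move=> ab; exists (fun t => flat 1 (- a + t * 1) * flat 1 (b + t * -1)).
  by apply: smooth1M; apply: smooth1_affine; exact: smooth1_flat.
have f0 t : 0 <= flat 1 t.
  by rewrite /flat; case: ifP => // _; rewrite hornerC mul1r expR_ge0.
have fp t : 0 < t -> 0 < flat 1 t.
  by move=> t0; rewrite /flat t0 hornerC mul1r expR_gt0.
split => t; first by rewrite mulr_ge0.
  by move=> /andP[a1 b1]; rewrite mulr_gt0// fp//; lra.
rewrite negb_and -!leNgt => /orP[ta|bt].
  by rewrite {1}/flat ifF ?mul0r// ; apply/negbTE; rewrite -leNgt; lra.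
by rewrite {2}/flat [X in _ * X]ifF ?mulr0// ; apply/negbTE; rewrite -leNgt; lra.
Qed.

(** Nonnegativity makes the integrals over subintervals of [a, b] vanish as well, so the primitive
    is constant on [a, b] and its derivative u is 0 inside. *)
Lemma iint_ge0_eq0 a b u : continuous u -> (forall t, a <= t <= b -> 0 <= u t) ->
  iint a b u = 0 -> forall t, a < t < b -> u t = 0.
Proof.
move=> uc u0 I0 t /andP[ta tb].
have U c d : c <= d -> iint c d u = primitive u d - primitive u c.
  by move=> cd; apply: FTC2 => // s _; exact: is_derive_primitive.
have Ige c d : a <= c -> d <= b -> 0 <= iint c d u.
  move=> ac db; rewrite (_ : 0 = iint c d (fun=> 0)).
    apply: le_iint => //; first exact: cont_cst.
    by move=> s /andP[cs sd]; apply: u0; rewrite (le_trans ac)// (le_trans sd).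
  by rewrite /iint Rintegral_cst//= mul0r.
have Uc s : a <= s <= b -> primitive u s = primitive u a.
  move=> /andP[as_ sb]; have := Ige a s (lexx a) sb; have := Ige s b as_ (lexx b).
  have := I0; rewrite !U//; last by rewrite (le_trans as_).
  by move=> ? ? ?; lra.
have d1 := is_derive_primitive t uc.
have d2 : is_derive t 1 (primitive u) 0.
  apply: (@near_is_derive _ (cst (primitive u a))).
  near=> s; rewrite Uc//; apply/andP; split; apply: ltW.
    by near: s; exact: lt_nbhsr.
  by near: s; exact: lt_nbhsl.
by rewrite -(@derive_val _ _ _ _ _ _ _ d1) (@derive_val _ _ _ _ _ _ _ d2).
Unshelve. all: by end_near. Qed.

Lemma step1_exists : exists2 u, smooth1 u &
  (forall t, t <= 0 -> u t = 0) /\ (forall t, 1 <= t -> u t = 1).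
Proof.
have [u us [u0 up uz]] := bump1_exists ltr01.
have uc := smooth1_cont us.
have p1 : primitive u 1 != 0.
  apply/eqP; rewrite /primitive mul1r => I0.
  have I0' : iint 0 1 u = 0.
    by rewrite -[RHS]I0; congr iint; apply/funext => s; rewrite mulr1.
  have h2 : 0 < (1 / 2 : R) < 1 by apply/andP; split; lra.
  have := up _ h2; rewrite (iint_ge0_eq0 uc _ I0' h2) ?ltxx//.
have ps : smooth1 (primitive u).
  apply: smooth1_antideriv us => x; exact: is_derive_primitive.
exists (fun t => (primitive u 1)^-1 * primitive u t); first exact: smooth1Z.
split=> t t0; last first.
  rewrite (_ : primitive u t = primitive u 1) ?mulVf//; apply/eqP; rewrite -subr_eq0.
  have <- := @FTC2 _ 1 t (primitive u) u t0 (fun s _ => is_derive_primitive s uc) uc.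
  rewrite (@eq_iint _ _ _ _ (fun=> 0)) ?iint_cst ?mul0r//.
  by move=> s /andP[s1 _]; rewrite uz// negb_and -!leNgt s1 orbT.
rewrite [X in _ * X](_ : _ = 0) ?mulr0// /primitive.
rewrite (@eq_iint _ _ _ _ (fun=> 0)) ?iint_cst ?mul0r ?mulr0//.
move=> s /andP[s1 _]; rewrite uz// negb_and -!leNgt; apply/orP; left; nra.
Qed.

(** Two opposite steps in the variable (t - c)/r, shifted by 2: both arguments are at least 1 when
    |t - c| <= r, and one is at most 0 when |t - c| >= 2r. *)
Lemma plateau1_exists c r : 0 < r -> exists2 u, smooth1 u &
  (forall t, `|t - c| <= r -> u t = 1) /\ (forall t, r *+ 2 <= `|t - c| -> u t = 0).
Proof.
move=> r0; have [u us [u0 u1]] := step1_exists.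
exists (fun t => u (2 - c / r + t * r^-1) * u (2 + c / r + t * - r^-1)).
  by apply: smooth1M; exact: smooth1_affine.
have e1 t : 2 - c / r + t * r^-1 = 2 + (t - c) / r by ring.
have e2 t : 2 + c / r + t * - r^-1 = 2 - (t - c) / r by ring.
split=> t; rewrite e1 e2.
  rewrite ler_norml => /andP[h1 h2].
  have a1 : - 1 <= (t - c) / r by rewrite ler_pdivlMr// mulN1r.
  have a2 : (t - c) / r <= 1 by rewrite ler_pdivrMr// mul1r.
  by rewrite !u1 ?mulr1//; lra.
rewrite ler_normr => /orP[h|h].
  have a1 : 2 <= (t - c) / r by rewrite ler_pdivlMr// mulr_natl.
  by rewrite [X in _ * X]u0 ?mulr0//; lra.
have a1 : (t - c) / r <= - 2 by rewrite ler_pdivrMr// mulNr mulr_natl lerNr.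
by rewrite u0 ?mul0r//; lra.
Qed.

End Smooth1.

(** * Partitions of unity *)

Section Tensor.
Variables (R : realType) (n : nat).
Local Notation E := 'rV[R]_n.
Implicit Types (v : 'I_n -> R -> R) (f g : E -> R) (x c : E) (k : 'I_n) (r t : R)
  (U V : opens E).

Definition tensor v : E -> R := fun x => \prod_i v i (x ord0 i).

Lemma tensor_upd v x k t :
  tensor v (upd x k t) = v k t * \prod_(i | i != k) v i (x ord0 i).
Proof.
rewrite /tensor (bigD1 k)//= upd_eq; congr (_ * _).
by apply: eq_bigr => i ik; rewrite upd_neq.
Qed.

Lemma cont_prod (I : Type) (s : seq I) (P : pred I) (F : I -> E -> R) :
  (forall i, continuous (F i)) -> continuous (fun x => \prod_(i <- s | P i) F i x).
Proof.
move=> Fc; elim: s => [|i s IH].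
  by under eq_fun do rewrite big_nil; exact: cont_cst.
case Pi: (P i); under eq_fun do rewrite big_cons Pi; last exact: IH.
exact: contM.
Qed.

Lemma tensor_cont v : (forall i, continuous (v i)) -> continuous (tensor v).
Proof.
move=> vc; apply: cont_prod => i; exact: cont_comp (@coord_cont _ _ i) (vc i).
Qed.

Definition dtensor v k : 'I_n -> R -> R :=
  fun i => if i == k then derive1 (v i) else v i.

Lemma pderiv_tensor v k : (forall x : R, is_derive x 1 (v k) (derive1 (v k) x)) ->
  pderiv k (tensor v) (tensor (dtensor v k)).
Proof.
move=> dv x; set P := \prod_(i | i != k) v i (x ord0 i).
have -> : tensor (dtensor v k) x = P *: derive1 (v k) (x ord0 k).
  rewrite -{1}(upd_id x k) tensor_upd /dtensor eqxx [RHS]mulrC; congr (_ * _).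
  by apply: eq_bigr => i /negPf ->.
have -> : slice (tensor v) x k = P \*: v k.
  by apply/funext => t; rewrite /slice tensor_upd mulrC.
exact: is_deriveZ.
Qed.

Lemma smooth_tensor v : (forall i, smooth1 (v i)) -> smooth (tensor v).
Proof.
move=> vs; apply: (@smooth_coind _ _ (fun f => exists2 v, forall i, smooth1 (v i) & f = tensor v)).
  move=> _ {vs} [{}v vs ->]; split.
    by apply: tensor_cont => i; exact: smooth1_cont.
  move=> k; exists (tensor (dtensor v k)).
    by apply: pderiv_tensor; exact: (smooth1_deriv (vs k)).1.
  exists (dtensor v k) => // i; rewrite /dtensor; case: eqP => // _.
  exact: (smooth1_deriv (vs i)).2.
by exists v.
Qed.

Definition box c r : set E := [set x | forall i, `|x ord0 i - c ord0 i| <= r].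

Lemma box_compact c r : compact (box c r).
Proof.
have -> : box c r = [set x : E | forall i, `[c ord0 i - r, c ord0 i + r]%classic (x ord0 i)].
  apply/seteqP; split=> x /= H i; have := H i; rewrite /= in_itv /= ler_distl//.
by apply: (@rV_compact _ _ (fun i => `[c ord0 i - r, c ord0 i + r]%classic)) => i; exact: segment_compact.
Qed.

Definition cube_set c r : set E := [set x | forall i, `|x ord0 i - c ord0 i| < r].

Lemma cube_open c r : open (cube_set c r).
Proof.
rewrite openE => x xc; exists (fun _ j t => `|t - c ord0 j| < r); last first.
  by move=> y yc i; exact: yc.
move=> i j; rewrite (ord1 i).
have cc : continuous (fun t : R => `|t - c ord0 j|).
  apply: cont_comp (@norm_continuous _ _); apply: contB; [exact: cont_id|exact: cont_cst].
exact: (@cvgr_lt _ _ _ _ _ _ (cc (x ord0 j)) _ (xc j)).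
Qed.

Definition cube c r : opens E := Opens (@cube_open c r).

Lemma nbhs_box U x : x \ino U -> exists2 r, 0 < r & box x r `<=` U.
Proof.
move=> /near_opens /nbhs_ballP[e /= e0 eU]; exists (e / 2); first by rewrite divr_gt0.
move=> y yx; apply: eU; split=> // i j; rewrite (ord1 i).
rewrite /ball /= distrC; apply: le_lt_trans (yx j) _.
by rewrite ltr_pdivrMr// ltr_pMr// ltr1n.
Qed.

Lemma cube_center c r : 0 < r -> c \ino cube c r.
Proof. by move=> r0 i /=; rewrite subrr normr0. Qed.

Lemma cube_sub_box c r : cube c r `<=` box c r.
Proof. by move=> x xc i; exact: ltW (xc i). Qed.

Lemma box_sub_cube c r r' : r < r' -> box c r `<=` cube c r'.
Proof. by move=> rr x xc i; exact: le_lt_trans (xc i) rr. Qed.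

Lemma box_closed c r : closed (box c r).
Proof. exact: compact_closed (@norm_hausdorff _ _) (@box_compact c r). Qed.

Lemma supp_box f c r : (forall x, ~ box c r x -> f x = 0) -> supp f `<=` box c r.
Proof. by move=> f0; apply: supp_sub => //; exact: box_closed. Qed.

Lemma plateau_exists U x : x \ino U ->
  exists (chi : testfun U) r, 0 < r /\ forall y, y \ino cube x r -> chi y = 1.
Proof.
move=> /nbhs_box[r r0 rU]; have r20 : 0 < r / 2 by rewrite divr_gt0.
have Hi i : exists u, smooth1 u /\
    (forall t, `|t - x ord0 i| <= r / 2 -> u t = 1) /\
    (forall t, r / 2 *+ 2 <= `|t - x ord0 i| -> u t = 0).
  by have [u us uP] := plateau1_exists (x ord0 i) r20; exists u.
have [v Hv] := choice Hi.
have sb : supp (tensor v) `<=` box x r.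
  apply: supp_box => y /existsNP[i /negP]; rewrite -ltNge => yi.
  rewrite /tensor (bigD1 i)//= (Hv i).2.2 ?mul0r//.
  by rewrite -mulr_natr divfK// ltW.
have T : [/\ smooth (tensor v), compact (supp (tensor v)) & supp (tensor v) `<=` U].
  split; first by apply: smooth_tensor => i; exact: (Hv i).1.
    exact: subclosed_compact (@closed_supp _ _ _) (@box_compact x r) sb.
  exact: subset_trans rU.
exists (MkTest (asboolT T)), (r / 2); split => // y yx /=.
by rewrite /tensor big1// => i _; rewrite (Hv i).2.1// ltW.
Qed.

End Tensor.

Section PartitionOfUnity.
Variables (R : realType) (n : nat).
Local Notation E := 'rV[R]_n.
Implicit Types (f g : E -> R) (x c : E) (U V W : opens E).

Lemma test_mul_subproof V f (chi : testfun V) : smooth f ->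
  [/\ smooth (fun x => chi x * f x), compact (supp (fun x => chi x * f x)) &
      supp (fun x => chi x * f x) `<=` V].
Proof.
move=> fs; have [cs cc cV] := testP chi; have sc := @supp_mull _ _ chi f.
split; first exact: smoothM.
  exact: subclosed_compact (@closed_supp _ _ _) cc sc.
exact: subset_trans cV.
Qed.

Definition test_mul V f (fs : smooth f) (chi : testfun V) : testfun V :=
  MkTest (asboolT (test_mul_subproof chi fs)).

Lemma test_smooth V (phi : testfun V) : smooth phi.
Proof. by have [] := testP phi. Qed.

Lemma testfunP V (f g : testfun V) : (forall x, f x = g x) -> f = g.
Proof. by move=> fg; apply: val_inj; apply/funext. Qed.

Lemma partition_of_unity (I : Type) (V : I -> opens E) (K : set E) :
  compact K -> K `<=` \bigcup_i V i ->
  exists r : seq {i : I & testfun (V i)},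
    forall x, K x -> \sum_(p <- r) tagged p x = 1.
Proof.
(* An index is needed for the default pair at points outside K; if there is none, K is empty. *)
move=> Kc KV; have [[i0 _]|nI] := pselect (exists i : I, True); last first.
  by exists [::] => x /KV[i _ _]; case: nI; exists i.
have Hx x : exists p : {i : I & testfun (V i)} * R, K x ->
    0 < p.2 /\ forall y, y \ino cube x p.2 -> tagged p.1 y = 1.
  have [/KV[i _ xi]|nK] := pselect (K x).
    by have [chi [r [r0 H]]] := plateau_exists xi; exists (existT _ i chi, r).
  by exists (existT (fun i => testfun (V i)) i0 (0 : testfun (V i0)), 1 : R).
have [b Hb] := choice Hx.
move: Kc; rewrite compact_cover => /(_ _ K (fun x => cube x (b x).2)) [].
- by move=> x _; exact: cube_open.
- by move=> x Kx; exists x => //; apply: cube_center; exact: (Hb x Kx).1.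
move=> D DK KD.
(* 1 minus a product of factors 1 - chi, expanded as a sum of multiples of the chi. *)
have [r Hr] : exists r : seq {i : I & testfun (V i)},
    forall x, \sum_(p <- r) tagged p x = 1 - \prod_(z <- finmap.enum_fset D) (1 - tagged (b z).1 x).
  elim: (finmap.enum_fset D) => [|z s [r Hr]].
    by exists [::] => x; rewrite !big_nil subrr.
  have bs : smooth (fun x => 1 + -1 * tagged (b z).1 x).
    by apply: smoothD; [exact: smooth_cst|apply: smoothZ; exact: test_smooth].
  exists ((b z).1 :: [seq existT _ (tag p) (test_mul bs (tagged p)) | p <- r]) => x.
  rewrite !big_cons big_map /=.
  under eq_bigr do rewrite /= mulrC.
  by rewrite -mulr_sumr Hr; ring.
exists r => x Kx; rewrite Hr.
have [z zD xz] := KD x Kx.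
rewrite (big_rem z)//= (Hb z _).2 ?subrr ?mul0r ?subr0//.
by have := DK _ zD; rewrite inE.
Qed.

End PartitionOfUnity.

(** * Gluing distributions *)

Section DistrSheaf.
Variables (R : realType) (n : nat).
Local Notation E := 'rV[R]_n.
Implicit Types (f g : E -> R) (x c : E) (U V W : opens E).

Section Scalar.
Variables (U : opens E) (T : testfun U -> R).
Hypothesis Tl : scalar T.

Lemma scalarD phi psi : T (phi + psi) = T phi + T psi.
Proof. by have := Tl 1 phi psi; rewrite scale1r mul1r. Qed.

Lemma scalar0 : T 0 = 0.
Proof. by have := scalarD 0 0; rewrite addr0 => /eqP; rewrite -subr_eq0 opprD addrA subrr sub0r oppr_eq0 => /eqP. Qed.

Lemma scalar_sum (J : Type) (r : seq J) (phi : J -> testfun U) :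
  T (\sum_(p <- r) phi p) = \sum_(p <- r) T (phi p).
Proof. by apply: (big_morph T scalarD scalar0). Qed.

End Scalar.

Lemma test_sumE U (J : Type) (r : seq J) (phi : J -> testfun U) x :
  (\sum_(p <- r) phi p : testfun U) x = \sum_(p <- r) phi p x.
Proof. exact: (big_morph (fun h : testfun U => h x) (fun _ _ => erefl) erefl). Qed.

Lemma distr_scalar U (T : distr U) : scalar T.
Proof. exact: (distrP T).1. Qed.

Section Gluing.
Variables (I : Type) (V : I -> opens E) (s : forall i, Distr R n (V i)).
Hypothesis compat : forall i j, res (Distr R n) (@opensIl _ (V i) (V j)) (s i) =
                                res (Distr R n) (@opensIr _ (V i) (V j)) (s j).

(** The common function is supported in both sets, hence is a test function on their
    intersection. *)
Lemma glue_compat i j (f : testfun (V i)) (g : testfun (V j)) :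
  (forall x, f x = g x) -> distr_val (s i) f = distr_val (s j) g.
Proof.
move=> fg; have fgE : (f : E -> R) = g by apply/funext.
have [fs fc fV] := testP f; have [_ _ gV] := testP g.
have T : [/\ smooth f, compact (supp f) & supp f `<=` opensI (V i) (V j)].
  by split=> // x xf; split; [exact: fV|apply: gV; rewrite -fgE].
pose h : testfun (opensI (V i) (V j)) := MkTest (asboolT T).
have := congr1 (fun S : distr _ => distr_val S h) (compat i j) => /=.
rewrite (_ : test_incl _ h = f); last exact: testfunP.
by rewrite (_ : test_incl _ h = g)//; exact: testfunP.
Qed.

Definition unity_on (r : seq {i : I & testfun (V i)}) (K : set E) : Prop :=
  forall x, K x -> \sum_(p <- r) tagged p x = 1.

Definition glue_val (r : seq {i : I & testfun (V i)}) f (fs : smooth f) : R :=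
  \sum_(p <- r) distr_val (s (tag p)) (test_mul fs (tagged p)).

(** Inserting one partition into the other turns both sides into double sums over the products of
    their members; corresponding terms agree by [glue_compat]. *)
Lemma glue_val_eq r r' f (fs : smooth f) :
  unity_on r (supp f) ->
  unity_on r' (supp f) ->
  glue_val r fs = glue_val r' fs.
Proof.
have dec (q q' : seq {i : I & testfun (V i)}) :
    unity_on q' (supp f) ->
    glue_val q fs = \sum_(p <- q) \sum_(p' <- q')
      distr_val (s (tag p)) (test_mul fs (test_mul (test_smooth (tagged p')) (tagged p))).
  move=> q'1; apply: eq_bigr => p _; rewrite -(scalar_sum (distr_scalar _)).
  congr (distr_val _ _); apply: testfunP => x; rewrite test_sumE /=.
  have [xf|/suppN ->] := pselect (supp f x); last first.
    by rewrite mulr0 big1// => p' _; rewrite mulr0.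
  by rewrite -mulr_suml -mulr_sumr q'1// mulr1.
move=> r1 r'1; rewrite (dec r r')// (dec r' r)// exchange_big /=.
apply: eq_bigr => p' _; apply: eq_bigr => p _; apply: glue_compat => x /=.
by rewrite [_ (tagged p) x * _]mulrC.
Qed.

Lemma glue_val_bound r : exists C m, 0 <= C /\
  forall f (fs : smooth f), compact (supp f) -> `|glue_val r fs| <= C * Cnorm m f.
Proof.
elim: r => [|p r [C [m [C0 H]]]].
  by exists 0, 0%N; split=> // f fs fk; rewrite /glue_val big_nil normr0 mul0r.
have [ps pk pV] := testP (tagged p).
(* The estimate is taken on the support of the partition member, a compact set independent of f. *)
have [D [l SD]] := (distrP (s (tag p))).2 _ pk pV.
have [L L0 HL] := Leibniz_bound l ps pk.
exists (`|D| * L + C), (maxn l m); split; first by rewrite addr_ge0// mulr_ge0.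
move=> f fs fk; rewrite /glue_val big_cons -/(glue_val r fs) mulrDl.
apply: le_trans (ler_normD _ _) _; apply: lerD.
  apply: le_trans (SD (test_mul fs (tagged p)) (@supp_mull _ _ _ _)) _.
  have [ts tk _] := testP (test_mul fs (tagged p)).
  apply: le_trans (ler_wpM2r (Cnorm_ge0 l ts tk) (ler_norm D)) _.
  rewrite -mulrA ler_wpM2l//; apply: le_trans (HL f fs fk) _.
  by rewrite ler_wpM2l// Cnorm_mono// leq_maxl.
apply: le_trans (H f fs fk) _.
by rewrite ler_wpM2l// Cnorm_mono// leq_maxr.
Qed.

Lemma glue_val_lin r a f g (fs : smooth f) (gs : smooth g) (hs : smooth (a *: f + g)) :
  glue_val r hs = a * glue_val r fs + glue_val r gs.
Proof.
rewrite /glue_val mulr_sumr -big_split; apply: eq_bigr => p _ /=.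
rewrite -(distr_scalar (s (tag p))); congr (distr_val _ _); apply: testfunP => x /=.
by apply: (etrans (mulrDr _ (a * f x) (g x))); congr (_ + _); exact: mulrCA.
Qed.

Variables (U : opens E) (VU : forall i, V i `<=` U).
Hypothesis cover : \bigcup_i V i = U.

Lemma supp_partition (phi : testfun U) : exists r, unity_on r (supp phi).
Proof.
by have [_ pk pU] := testP phi; apply: partition_of_unity => //; rewrite cover.
Qed.

(** The partition is chosen anew for each phi; by [glue_funE] any other adapted one may replace it,
    in particular one common to several phi or to all phi supported in a given compact set. *)
Definition glue_fun (phi : testfun U) : R :=
  glue_val (sval (cid (supp_partition phi))) (test_smooth phi).

Lemma glue_funE r (phi : testfun U) : unity_on r (supp phi) ->
  glue_fun phi = glue_val r (test_smooth phi).
Proof.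
by move=> r1; apply: glue_val_eq r1; exact: (svalP (cid (supp_partition phi))).
Qed.

Lemma glue_is_distr : is_distr glue_fun.
Proof.
split.
  move=> a f g; have [_ fk fU] := testP f; have [_ gk gU] := testP g.
  have [||r r1] := @partition_of_unity _ _ _ V (supp f `|` supp g).
  - exact: compactU.
  - by rewrite cover => x [/fU|/gU].
  have rf : unity_on r (supp f) by move=> x xf; apply: r1; left.
  have rg : unity_on r (supp g) by move=> x xg; apply: r1; right.
  have rh : unity_on r (supp (a *: f + g : testfun U)) by move=> x /supp_lin; exact: r1.
  rewrite (glue_funE rf) (glue_funE rg) (glue_funE rh).
  exact: glue_val_lin.
move=> K Kc KU; have [|r r1] := @partition_of_unity _ _ _ V K Kc; first by rewrite cover.
have [C [m [C0 H]]] := glue_val_bound r; exists C, m => phi phiK.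
rewrite (@glue_funE r); last by move=> x /phiK; exact: r1.
by apply: H; have [] := testP phi.
Qed.

Lemma glue_res i : res (Distr R n) (@VU i) (MkDistr (asboolT glue_is_distr) : Distr R n U) = s i.
Proof.
apply: val_inj; apply/funext => phi /=.
have [r r1] := supp_partition (test_incl (@VU i) phi).
rewrite (glue_funE r1) /glue_val.
rewrite (eq_bigr (fun p : {i : I & testfun (V i)} => distr_val (s i) (test_mul (test_smooth (tagged p)) phi))).
  rewrite -(scalar_sum (distr_scalar _)); congr (distr_val _ _); apply: testfunP => x.
  rewrite test_sumE /= -mulr_sumr.
  have [xf|/suppN ->] := pselect (supp phi x); last by rewrite mul0r.
  by rewrite (r1 x xf) mulr1.
by move=> p _; apply: glue_compat => x /=; rewrite mulrC.
Qed.

Lemma glue_unique (t : Distr R n U) : (forall i, res (Distr R n) (@VU i) t = s i) ->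
  t = (MkDistr (asboolT glue_is_distr) : Distr R n U).
Proof.
move=> ts; apply: val_inj; apply/funext => phi /=.
have [r r1] := supp_partition phi; rewrite (glue_funE r1) /glue_val.
rewrite (eq_bigr (fun p : {i : I & testfun (V i)} => distr_val t
  (test_incl (@VU (tag p)) (test_mul (test_smooth phi) (tagged p))))).
  rewrite -(scalar_sum (distr_scalar _)); congr (distr_val _ _); apply: testfunP => x.
  rewrite test_sumE /= -mulr_suml.
  have [xf|/suppN ->] := pselect (supp phi x); last by rewrite mulr0.
  by rewrite (r1 x xf) mul1r.
by move=> p _; rewrite -(ts (tag p)).
Qed.

End Gluing.

Lemma Distr_sheaf : is_sheaf (Distr R n).
Proof.
move=> I U V VU cover s compat.
exists (MkDistr (asboolT (glue_is_distr compat cover))); split.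
  exact: glue_res.
by move=> t /(glue_unique compat).
Qed.

End DistrSheaf.

(** * Distributions solve the problem *)

Section MultiIter.
Variables (R : realType) (n : nat) (X : lmodType R) (op : 'I_n -> X -> X).
Hypothesis opl : forall k, linear (op k).
Hypothesis opC : forall h k x, op h (op k x) = op k (op h x).
Implicit Types (a : 'I_n -> nat) (k : 'I_n).

Lemma iter_lin m k : linear (iter m (op k)).
Proof. by elim: m => //= m IH c x y /=; rewrite IH opl. Qed.

Lemma multi_iter_lin a : linear (multi_iter op a).
Proof.
by rewrite /multi_iter; elim: (enum _) => //= k s IH c x y /=; rewrite IH iter_lin.
Qed.

Lemma lin0 (f : X -> X) : linear f -> f 0 = 0.
Proof.
move=> fl; have := fl 1 0 0; rewrite !scale1r addr0 => /eqP.
by rewrite -subr_eq0 opprD addrA subrr sub0r oppr_eq0 => /eqP.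
Qed.

Lemma op_iterC h k m x : op h (iter m (op k) x) = iter m (op k) (op h x).
Proof. by elim: m => //= m IH; rewrite opC IH. Qed.

Lemma op_foldrC h a s x : op h (foldr (fun k => iter (a k) (op k)) x s) =
  foldr (fun k => iter (a k) (op k)) (op h x) s.
Proof. by elim: s => //= k s IH; rewrite op_iterC IH. Qed.

Lemma multi_iter_op k a x : multi_iter op a (op k x) = op k (multi_iter op a x).
Proof. by rewrite /multi_iter op_foldrC. Qed.

Lemma multi_iter_iter k a x m : multi_iter op a (iter m (op k) x) =
  iter m (op k) (multi_iter op a x).
Proof. by elim: m => //= m IH; rewrite multi_iter_op IH. Qed.

(** Commutation lets the k-th power act first. A single power that kills x then kills everything,
    and one more [op k] adds 1 to the k-th order. *)
Lemma multi_iterE k a x : multi_iter op a x =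
  multi_iter op (fun i => if i == k then 0%N else a i) (iter (a k) (op k) x).
Proof.
rewrite multi_iter_iter /multi_iter.
have : k \in enum 'I_n by rewrite mem_enum.
have := enum_uniq 'I_n; elim: (enum _) => //= l s IH /andP[ls us].
rewrite inE; have [->|lk] := eqVneq k l; rewrite /= => ks.
  congr (iter _ _ _); elim: {IH us ks} s ls => //= i s IH.
  by rewrite inE negb_or => /andP[li /IH ->]; rewrite eq_sym (negPf li).
rewrite IH//.
set y := foldr _ _ _; elim: (a l) => //= m ->.
by rewrite -op_iterC.
Qed.

Lemma multi_iter_eq0 k a x : iter (a k) (op k) x = 0 -> multi_iter op a x = 0.
Proof. by move=> x0; rewrite (multi_iterE k) x0 lin0//; exact: multi_iter_lin. Qed.

Lemma eq_multi_iter a b x : (forall k, a k = b k) -> multi_iter op a x = multi_iter op b x.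
Proof. by move=> ab; congr multi_iter; apply/funext. Qed.

Lemma multi_iterS k a x :
  multi_iter op (fun i => if i == k then (a i).+1 else a i) x = multi_iter op a (op k x).
Proof.
rewrite (multi_iterE k) eqxx [RHS](multi_iterE k) -iterSr; apply: eq_multi_iter => i.
by case: eqP.
Qed.

End MultiIter.

(** * Classical derivatives as distributions, and condition (iv) *)

Section LocalC1.
Variables (R : realType) (n : nat).
Local Notation E := 'rV[R]_n.
Implicit Types (f g : E -> R) (x : E) (U V : opens E) (k : 'I_n).

Lemma C0_ext U (f g : C0fun U) : (forall x, x \ino U -> f x = g x) -> f = g.
Proof.
move=> fg; apply: val_inj; apply/funext => x; have [xU|xU] := pselect (x \ino U).
  exact: fg.
by rewrite [LHS](C0P f).2// [RHS](C0P g).2.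
Qed.

(* It suffices to differentiate at the points of U, the slices through a point of
   U being also slices through nearby points. *)
Lemma is_C1P k U f f' :
  (forall x, x \ino U -> is_derive (x ord0 k) 1 (slice f x k) (f' x)) ->
  (forall x, x \ino U -> {for x, continuous f'}) ->
  is_C1 k U f /\ forall x, x \ino U -> partial k f x = f' x.
Proof.
move=> df fc.
have pE x : x \ino U -> partial k f x = f' x.
  by move=> xU; rewrite /partial derive1E; have := df x xU => d; exact: derive_val.
split=> //; split=> x xU; last first.
  apply: (@eq_continuous_at _ _ U f' _ _ _ xU); last exact: fc.
  by move=> y yU; rewrite pE.
have dt t : upd x k t \ino U -> is_derive t 1 (slice f x k) (f' (upd x k t)).
  by move=> /df; rewrite upd_eq slice_upd.
move=> t tU; split; first exact: (@ex_derive _ _ _ _ _ _ _ (dt t tU)).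
apply: (@near_continuous_at _ _ (fun t => f' (upd x k t))).
  near=> s; have sU : upd x k s \ino U by near: s; exact: near_upd.
  by rewrite derive1E; have := dt s sU => d; rewrite (@derive_val _ _ _ _ _ _ _ d).
apply: continuous_comp; first exact: upd_continuousr.
exact: fc.
Unshelve. all: by end_near. Qed.

Lemma is_C1_derive k U f x : is_C1 k U f -> x \ino U ->
  is_derive (x ord0 k) 1 (slice f x k) (partial k f x).
Proof.
move=> [fd _] xU; have xk : upd x k (x ord0 k) \ino U by rewrite upd_id.
by rewrite /partial derive1E; apply: DeriveDef => //; exact: (fd x xU _ xk).1.
Qed.

(** f is differentiable on U only, but near a point outside U the product is 0 because phi is. *)
Lemma mul_test_pderiv k U (f : C1fun k U) (phi : testfun U) :
  pderiv k (fun x => f x * phi x)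
    (fun x => dC1_fun f x * phi x + f x * partial k phi x).
Proof.
move=> x; have [ps pc pU] := testP phi; have dp := smooth_pderiv0 k ps.
have [xU|xU] := pselect (x \ino U).
  have := is_deriveM (is_C1_derive (C1P f) xU) (dp x).
  by rewrite /slice !upd_id addrC /= restrE// [phi x *: _]mulrC.
pose O := Opens (closed_openC (@closed_supp _ _ phi)).
have xO : x \ino O by move=> /pU.
rewrite (suppN xO) (pderiv_supp0 dp)// !mulr0 addr0.
apply: (@near_is_derive _ (cst 0)).
near=> s; rewrite /slice (@suppN _ _ phi) ?mulr0//.
by near: s; apply: (@near_upd _ _ O); rewrite upd_id.
Unshelve. all: by end_near. Qed.

Lemma dDistr_lambda k U (f : C1fun k U) :
  dDistr R k U (lambda R n U (f : C0fun U)) = lambda R n U (dC1_fun f).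
Proof.
apply: val_inj; apply/funext => phi /=; have [ps pc pU] := testP phi.
have [M M0 KM] := compact_box pc.
have b1 := prod_box_supp f (@subset_refl _ (supp phi)) KM.
have b2 := prod_box_supp (dC1_fun f) (@subset_refl _ (supp phi)) KM.
have b3 := prod_box_supp f (phi := test_partial k phi) (@supp_partial _ _ k phi) KM.
have h0 : Rn_int (fun x => 1 * (dC1_fun f x * phi x) + f x * partial k phi x) = 0.
  apply: (@Rn_int_pderiv _ _ M k (fun x => f x * phi x)) => //.
    by move=> x; rewrite mul1r; exact: mul_test_pderiv.
  by apply: contD; [apply: contM; [exact: cont_cst|exact: b2.1]|exact: b3.1].
move: h0; rewrite (Rn_int_lin _ M0 b2 b3) mul1r => /eqP.
by rewrite addr_eq0 /lambda_form => /eqP ->.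
Qed.

Lemma lambda_compat k : dDistr R k \oM (lambda R n \oM C1_incl R k) =
  lambda R n \oM dC1 R k.
Proof. by apply: morphismP => U f /=; exact: dDistr_lambda. Qed.

Lemma dDistrC h k : dDistr R h \oM dDistr R k = dDistr R k \oM dDistr R h :> morphism (Distr R n) _.
Proof.
apply: morphismP => U T; apply: val_inj; apply/funext => phi /=.
rewrite !opprK; congr (distr_val T _); apply: testfunP => x /=.
by have [ps _ _] := testP phi; rewrite partialC.
Qed.

Lemma is_derive_sumX d (c : nat -> R) (t : R) :
  is_derive t 1 (fun s : R => \sum_(i < d.+1) c i * s ^+ i)
    (\sum_(i < d) (c i.+1 *+ i.+1) * t ^+ i).
Proof.
have := is_derive_poly (\poly_(i < d.+1) c i) t.
rewrite (_ : deriv _ = \poly_(i < d) (c i.+1 *+ i.+1)); last first.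
  by apply/polyP => i; rewrite coef_deriv !coef_poly ltnS; case: ifP => //; rewrite mul0rn.
rewrite horner_poly (_ : horner _ = fun s : R => \sum_(i < d.+1) c i * s ^+ i)//.
by apply/funext => s; rewrite horner_poly.
Qed.

Lemma cont_sum_at (J : Type) (s : seq J) (F : J -> E -> R) x :
  (forall i, {for x, continuous (F i)}) ->
  {for x, continuous (fun y => \sum_(i <- s) F i y)}.
Proof.
move=> Fc; elim: s => [|i s IH].
  apply: (@near_continuous_at _ _ (cst 0)); last exact: cst_continuous.
  by near=> y; rewrite big_nil.
apply: (@near_continuous_at _ _ (fun y => F i y + \sum_(i <- s) F i y)).
  by near=> y; rewrite big_cons.
exact: cvgD (Fc i) IH.
Unshelve. all: by end_near. Qed.

Section Polynomial.
Variables (H : presheaf R E) (j : morphism (C0 R n) H) (delta : 'I_n -> morphism H H).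
Hypothesis compat : forall k, delta k \oM (j \oM C1_incl R k) = j \oM dC1 R k.

Lemma compatE k U (f : C1fun k U) :
  delta k U (j U (f : C0fun U)) = j U (dC1_fun f).
Proof. by have := congr1 (fun m : morphism (C1 R k) H => m U f) (compat k). Qed.

(** Condition (iii) for a derivative given by any section f', in place of the one built by
    [dC1_fun]. *)
Lemma compat_C0 k U (f f' : C0fun U) :
  (forall x, x \ino U -> is_derive (x ord0 k) 1 (slice f x k) (f' x)) ->
  delta k U (j U f) = j U f'.
Proof.
move=> df; have [fC pE] := is_C1P df (C0P f').1.
have -> : f' = dC1_fun (MkC1 (asboolT fC)).
  by apply: C0_ext => x xU /=; rewrite restrE// pE.
exact: (compatE (MkC1 (asboolT fC))).
Qed.

Lemma polynomial_in_deriv k U d (theta : C0 R n U) : polynomial_in k d.+1 theta ->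
  exists2 theta' : C0 R n U, polynomial_in k d theta' &
    forall x, x \ino U -> is_derive (x ord0 k) 1 (slice theta x k) (C0_val theta' x).
Proof.
move=> [c [ci thetaE]].
(* Formal derivative: the coefficient of x_k^i is (i + 1) c_(i+1). *)
pose c' (i : 'I_d) : C0 R n U := i.+1%:R *: c (inord i.+1).
have c'E i x : C0_val (c' i) x = C0_val (c (inord i.+1)) x *+ i.+1.
  by rewrite -mulr_natl.
have tc : forall x, x \ino U ->
    {for x, continuous (fun x : E => \sum_(i < d) C0_val (c' i) x * x ord0 k ^+ i)}.
  move=> x xU; apply: cont_sum_at => i.
  have h1 : {for x, continuous (C0_val (c' i) : E -> R^o)} := (@C0P _ _ U (c' i)).1 x xU.
  apply: cvgM h1 _.
  apply: (@continuous_comp _ _ _ (fun x : E => x ord0 k) (fun t => t ^+ i)).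
    exact: coord_cont.
  exact: exprn_continuous.
exists (C0_mk tc).
  exists c'; split; last by move=> x xU /=; rewrite restrE.
  by move=> i x y xU yU xy; rewrite !c'E (ci _ x y).
move=> x xU /=; rewrite restrE//.
rewrite (eq_bigr (fun i : 'I_d => (C0_val (c (inord i.+1)) x *+ i.+1) * x ord0 k ^+ i)); last first.
  by move=> i _; have := c'E i x => /= ->.
(* Along the slice the coefficients keep their value at x, since they do not depend on x_k. *)
apply: near_is_derive (is_derive_sumX d (fun i => C0_val (c (inord i)) x) (x ord0 k)).
near=> s; have sU : upd x k s \ino U by near: s; apply: near_upd; rewrite upd_id.
rewrite /slice thetaE// upd_eq; apply: eq_bigr => i _; rewrite inord_val; congr (_ * _).
by apply: ci => // l lk; rewrite upd_neq.
Unshelve. all: by end_near. Qed.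

(** Each delta_k lowers the degree in x_k by one. Applied to D' itself this gives condition (iv)
    there. *)
Lemma iter_delta_polynomial k U d (theta : C0 R n U) : polynomial_in k d theta ->
  iter d (delta k U) (j U theta) = 0.
Proof.
elim: d theta => [|d IH] theta.
  move=> [c [_ thetaE]] /=; rewrite (_ : theta = 0) ?linear0//.
  by apply: C0_ext => x xU; rewrite thetaE// big_ord0.
move=> /polynomial_in_deriv[theta' p d'].
by rewrite iterSr (compat_C0 d') IH.
Qed.

End Polynomial.

End LocalC1.

Lemma Distr_problem (R : realType) (n : nat) : problem (lambda R n) (@dDistr R n).
Proof.
split.
- exact: Distr_sheaf.
- exact: lambda_compat.
- move=> a U _ f [theta [thetaP ->]].
  have dC h k (T : Distr R n U) : dDistr R h U (dDistr R k U T) = dDistr R k U (dDistr R h U T).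
    exact: (congr1 (fun m : morphism (Distr R n) (Distr R n) => m U T) (dDistrC R h k)).
  have dl k : linear (dDistr R k U) by exact: component_linear.
  (* The operator contains the power D_k^(a_k), which by itself kills theta_k. *)
  have H k : multi_iter (fun k => dDistr R k U) a (lambda R n U (theta k)) = 0.
    apply: (multi_iter_eq0 dl dC (k := k)).
    exact: (iter_delta_polynomial (@lambda_compat R n) (thetaP k)).
  rewrite linear_sum /=.
  have lin := multi_iter_lin dl a.
  apply: (big_ind (fun T => multi_iter _ a T = 0)); [exact: lin0 lin| |by move=> k _; exact: H].
  by move=> S T S0 T0; rewrite -[S]scale1r lin S0 T0 scaler0 addr0.
- exact: dDistrC.
Qed.

(** * Local structure of distributions *)

Section Energy.
Variables (R : realType) (n : nat).
Local Notation E := 'rV[R]_n.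
Implicit Types (f g u : E -> R) (x : E) (k : 'I_n) (s : seq 'I_n).

Lemma iint_split (a b c : R) (u : R -> R) : a <= b -> b <= c -> continuous u ->
  iint a c u = iint a b u + iint b c u.
Proof.
move=> ab bc uc; have U d e : d <= e -> iint d e u = primitive u e - primitive u d.
  by move=> de; apply: FTC2 => // s _; exact: is_derive_primitive.
by rewrite !U//; [ring|exact: le_trans bc].
Qed.

(** The square of u minus its mean c has a nonnegative integral. *)
Lemma iint_Cauchy_Schwarz (a b : R) (u : R -> R) : a <= b -> continuous u ->
  iint a b u ^+ 2 <= (b - a) * iint a b (fun t => u t ^+ 2).
Proof.
rewrite le_eqVlt => /predU1P[<- _|ab uc].
  by rewrite /iint set_itv1 !Rintegral_set1 expr0n subrr mul0r.
have u2c : continuous (fun t => u t ^+ 2) by apply: contM.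
have b0 : 0 < b - a by rewrite subr_gt0.
pose c := iint a b u / (b - a).
have cc (d : R) : continuous (fun _ : R => d) by exact: cont_cst.
have h0 : 0 <= iint a b (fun t => (u t - c) ^+ 2).
  rewrite (_ : 0 = iint a b (fun=> 0)); last by rewrite iint_cst ?mul0r// ltW.
  apply: le_iint => //; last by move=> t _; rewrite sqr_ge0.
  by apply: contM; apply: contB.
have h1 : iint a b (fun t => (u t - c) ^+ 2) =
    iint a b (fun t => u t ^+ 2) - (c *+ 2) * iint a b u + c ^+ 2 * (b - a).
  rewrite -iint_cst ?ltW// -iintZ// -iintB//; last by apply: contM.
  rewrite -iintD//; last by apply: contB => //; apply: contM.
  by apply: eq_iint => t _; ring.
move: h0; rewrite h1.
have -> : iint a b u = c * (b - a) by rewrite /c divfK// gt_eqF.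
move: (iint a b _) => q; nra.
Qed.

Variable M : R.
Hypothesis M0 : 0 <= M.
(** Half-width of a larger box, on whose faces functions with [box_supp M] vanish; also L >= 1, so
    that powers of 2L increase with the exponent. *)
Let L := M + 1.
Let L1 : 1 <= L. Proof. by rewrite lerDr. Qed.
Let L0 : 0 <= L. Proof. exact: le_trans L1. Qed.

(** Write u(x) as the integral of its k-th derivative from the face x_k = -L and apply
    Cauchy-Schwarz; inside the box the length x_k + L is at most 2L. *)
Lemma energy1 k u u' : pderiv k u u' -> continuous u' -> box_supp M [::] u ->
  forall x, u x ^+ 2 <= L *+ 2 * bint L k (fun y => u' y ^+ 2) x.
Proof.
move=> du uc [_ u0] x.
have sc : continuous (slice u' x k) by exact: continuous_slice.
have s2c : continuous (fun t => slice u' x k t ^+ 2) by apply: contM.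
have Ige a b : a <= b -> 0 <= iint a b (fun t => slice u' x k t ^+ 2).
  move=> ab; rewrite (_ : 0 = iint a b (fun=> 0)); last by rewrite iint_cst// mul0r.
  by apply: le_iint => [||t _]//; [exact: cont_cst|rewrite sqr_ge0].
have NL : - L <= L by rewrite ge0_cp.
have [xL|xL] := lerP `|x ord0 k| L; last first.
  rewrite (u0 x k)// ?expr0n ?mulr_ge0 ?mulrn_wge0//; first exact: Ige.
  by rewrite (lt_trans _ xL)// ltrDl.
move: xL; rewrite ler_norml => /andP[x1 x2].
have ux : u x = iint (- L) (x ord0 k) (slice u' x k).
  have -> := @FTC2 _ _ _ (slice u x k) _ x1 (fun t _ => is_derive_slice x t du) sc.
  rewrite /slice upd_id (u0 (upd x k (- L)) k) ?subr0//.
  by rewrite upd_eq normrN ger0_norm// ltrDl.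
rewrite ux; apply: le_trans (iint_Cauchy_Schwarz x1 sc) _.
rewrite /bint; have := iint_split x1 x2 s2c => ->.
have := Ige _ _ x1; have := Ige _ _ x2.
set p := iint _ _ _; set q := iint (- L) _ _ => p0 q0.
by move: x1 x2 p0 q0; move: p q (x ord0 k) => p q t; move: L0; rewrite mulr2n; nra.
Qed.

Lemma bintZ k (c : R) f : continuous f ->
  bint L k (fun x => c * f x) = (fun x => c * bint L k f x).
Proof.
move=> fc; apply/funext => x; rewrite /bint -iintZ//; exact: continuous_slice.
Qed.

Lemma box_supp_partials s u : smooth u -> box_supp M [::] u ->
  box_supp M [::] (partials s u).
Proof.
move=> us ub; elim: s => [//|k s IH].
exact: box_supp_pderiv (smooth_pderiv s k us) (us (k :: s)).1 IH.
Qed.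

Lemma energy_seq s u : smooth u -> box_supp M [::] u ->
  forall x, u x ^+ 2 <= (L *+ 2) ^+ size s * bint_seq L s (fun y => partials s u y ^+ 2) x.
Proof.
elim: s u => [|k s IH] u us ub x /=; first by rewrite mul1r.
have uk := smooth_pderiv0 k us; have uks := smooth_partial k us.
apply: le_trans (energy1 uk (smooth_cont uks) ub x) _.
rewrite exprS -mulrA ler_wpM2l ?mulrn_wge0//.
have c1 : continuous (fun y => partial k u y ^+ 2).
  by apply: contM; exact: smooth_cont.
have c2 : continuous (fun y => partials s (partial k u) y ^+ 2).
  by apply: contM; exact: (uks s).1.
have pE : partials s (partial k u) = partial k (partials s u).
  have := @perm_partials _ _ (rcons s k) (k :: s) u us; rewrite perm_rcons => /(_ (perm_refl _)) /= <-.
  by rewrite /partials foldr_rcons.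
have c3 := @bint_seq_cont _ _ _ L0 s _ c2.
rewrite -pE.
have := congr1 (fun h : E -> R => h x) (bintZ k ((L *+ 2) ^+ size s) c3) => /= <-.
apply: le_bint => //.
  by apply: contM; [exact: cont_cst|exact: c3].
by move=> y; apply: IH => //; exact: box_supp_pderiv uk (smooth_cont uks) ub.
Qed.

(** With all coordinates integrated, the right-hand side of [energy_seq] no longer depends on x: an
    elementary Sobolev inequality. *)
Lemma energy_Rn_int u : smooth u -> box_supp M [::] u -> forall x,
  u x ^+ 2 <= (L *+ 2) ^+ n * Rn_int (fun y => partials (enum 'I_n) u y ^+ 2).
Proof.
move=> us ub x; have pb := box_supp_partials (enum 'I_n) us ub.
have p2 : box_supp L [::] (fun y => partials (enum 'I_n) u y ^+ 2).
  by apply: (@box_supp_le _ _ M); [rewrite lerDl|exact: box_suppMl pb.1 pb].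
rewrite (bint_Rn_int L0 p2) (@bint_seq_const _ _ L _ _ 0 x)//; last first.
- by move=> k; rewrite mem_enum.
- exact: p2.1.
by have := energy_seq (enum 'I_n) us ub x; rewrite size_enum_ord.
Qed.

Lemma partial_bound k u (B : R) : smooth u -> box_supp M [::] u ->
  (forall x, `|partial k u x| <= B) -> forall x, `|u x| <= L *+ 2 * B.
Proof.
move=> us ub uB x; have B0 : 0 <= B := le_trans (normr_ge0 _) (uB 0).
have L20 : 0 <= L *+ 2 by rewrite mulrn_wge0.
rewrite -ler_sqr ?nnegrE ?mulr_ge0// real_normK ?num_real//.
have uks := smooth_partial k us.
have c1 : continuous (fun y => partial k u y ^+ 2) by apply: contM; exact: smooth_cont.
apply: le_trans (energy1 (smooth_pderiv0 k us) (smooth_cont uks) ub x) _.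
rewrite exprMn expr2 -mulrA ler_wpM2l//.
apply: le_trans (ler_norm _) _; rewrite mulrC; apply: bint_bound => // y.
by rewrite normrX lerXn2r// nnegrE.
Qed.

Lemma partials_bound s u (B : R) : smooth u -> box_supp M [::] u ->
  (forall x, `|partials s u x| <= B) -> forall x, `|u x| <= (L *+ 2) ^+ size s * B.
Proof.
elim: s u B => [|k s IH] u B us ub uB x /=; first by rewrite mul1r.
rewrite exprSr -mulrA; apply: IH => // y.
apply: (@partial_bound k) => //; first exact: smooth_partials.
exact: box_supp_partials.
Qed.

(** The multi-index (m, .., m) as a list; [all_partials m.+1] unfolds to one round of all
    coordinates followed by [all_partials m]. *)
Definition all_partials m : seq 'I_n := flatten (nseq m (enum 'I_n)).

Lemma count_all_partials m k : count_mem k (all_partials m) = m.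
Proof.
rewrite count_flatten map_nseq sumn_nseq count_uniq_mem ?enum_uniq// mem_enum.
by rewrite mul1n.
Qed.

Lemma perm_count (A : eqType) (r1 r2 : seq A) :
  (forall a, count_mem a r1 = count_mem a r2) -> perm_eq r1 r2.
Proof. by move=> H; apply/allP => a _; apply/eqP; exact: H. Qed.

(** No coordinate occurs more than m times in s, so the missing derivatives can be added. Every
    derivative of order at most m is thereby controlled by the one of order (m, .., m). *)
Lemma all_partials_complement m s : (size s <= m)%N ->
  exists s', perm_eq (s' ++ s) (all_partials m).
Proof.
move=> sm; have /count_subseqP[s1 s1S ss1] :
    forall k, (count_mem k s <= count_mem k (all_partials m))%N.
  by move=> k; rewrite count_all_partials (leq_trans (count_size _ _)).
have [s3 Hs3] := perm_to_subseq s1S; exists s3.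
by rewrite perm_sym (perm_trans Hs3)// perm_catC perm_cat2l perm_sym.
Qed.

(* Poincare inequalities: one more derivative in every coordinate turns the
   L^2 norm into a bound for the sup norm. *)
Lemma Cnorm_energy m : exists2 A, 0 <= A & forall u, smooth u -> box_supp M [::] u ->
  Cnorm m u ^+ 2 <= A * Rn_int (fun y => partials (all_partials m.+1) u y ^+ 2).
Proof.
have L20 : 0 <= L *+ 2 by rewrite mulrn_wge0.
pose C := (L *+ 2) ^+ size (all_partials m).
exists (C ^+ 2 * (L *+ 2) ^+ n); first by rewrite mulr_ge0 ?exprn_ge0.
move=> u us ub; set q := Rn_int _.
have key s x : (size s <= m)%N -> `|partials s u x| <= C * Num.sqrt ((L *+ 2) ^+ n * q).
  (* Complete s to (m, .., m), undo the added derivatives by [partials_bound], and bound the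
     derivative of order (m, .., m) by the energy. *)
  move=> /all_partials_complement[s' Hs'].
  apply: (@le_trans _ _ ((L *+ 2) ^+ size s' * Num.sqrt ((L *+ 2) ^+ n * q))).
    apply: partials_bound; [exact: smooth_partials|exact: box_supp_partials|].
    move=> y; rewrite -partials_cat (perm_partials us Hs').
    have ws := smooth_partials (all_partials m) us.
    have wb := box_supp_partials (all_partials m) us ub.
    have := energy_Rn_int ws wb y; rewrite -/q.
    by move/ler_wsqrtr; rewrite sqrtr_sqr -partials_cat.
  rewrite ler_wpM2r ?sqrtr_ge0// /C ler_weXn2l//.
    by apply: (le_trans L1); rewrite mulr2n lerDl.
  by rewrite -(perm_size Hs') size_cat leq_addr.
have q0 : 0 <= (L *+ 2) ^+ n * q.
  have ws := smooth_partials (all_partials m) us.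
  have wb := box_supp_partials (all_partials m) us ub.
  have := energy_Rn_int ws wb 0; rewrite -partials_cat; apply: le_trans.
  exact: sqr_ge0.
have uk : compact (supp u).
  apply: subclosed_compact (@closed_supp _ _ _) (@box_compact _ _ 0 M) _.
  by move=> x /(box_supp_supp ub) xM i; rewrite mxE subr0.
apply: (@le_trans _ _ ((C * Num.sqrt ((L *+ 2) ^+ n * q)) ^+ 2)).
  by rewrite lerXn2r ?nnegrE ?mulr_ge0 ?sqrtr_ge0 ?exprn_ge0 ?Cnorm_ge0//; exact: Cnorm_le.
by rewrite exprMn sqr_sqrtr// mulrA.
Qed.

End Energy.

(* The minimising sequence of q - 2T: this is the Riesz representation theorem
   before completion. *)
Section Minimisation.
Variables (R : realType) (X : lmodType R) (b : X -> X -> R) (T : X -> R) (A : R).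
Hypothesis bl : forall y, scalar (b^~ y).
Hypothesis bC : forall x y, b x y = b y x.
Hypothesis b0 : forall x, 0 <= b x x.
Hypothesis Tl : scalar T.
Hypothesis A0 : 0 <= A.
Hypothesis TA : forall x, T x ^+ 2 <= A * b x x.
Implicit Types (x y : X) (t e : R).

Let Q x := b x x - T x *+ 2.

Let bDl a x y z : b (a *: x + y) z = a * b x z + b y z. Proof. exact: bl. Qed.

Let bDr a x y z : b z (a *: x + y) = a * b z x + b z y.
Proof. by rewrite bC bDl !(bC _ z). Qed.

(** T x <= sqrt (A b(x, x)) <= (A + b(x, x)) / 2. *)
Let Q_ge x : - A <= Q x.
Proof.
have h : T x <= (b x x + A) / 2.
  apply: le_trans (ler_norm _) _.
  rewrite -ler_sqr ?nnegrE ?divr_ge0 ?addr_ge0// real_normK ?num_real//.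
  apply: le_trans (TA x) _; rewrite expr_div_n ler_pdivlMr ?exprn_gt0//.
  have := sqr_ge0 (b x x - A); nra.
by rewrite /Q mulr2n; lra.
Qed.

Let d := inf (range Q).

Let has_inf_Q : has_inf (range Q).
Proof.
split; first by exists (Q 0), 0.
by exists (- A) => _ [x _ <-]; exact: Q_ge.
Qed.

Let Q_ge_inf x : d <= Q x.
Proof. by apply: ge_inf; [exact: has_inf_Q.2|exists x]. Qed.

Lemma minimising_sequence : exists phi : nat -> X,
  (forall j y, (b (phi j) y - T y) ^+ 2 <= j.+1%:R^-1 * b y y) /\
  (forall i j, b (phi i - phi j) (phi i - phi j) <= 2 / i.+1%:R + 2 / j.+1%:R).
Proof.
have H (j : nat) : exists x, Q x < d + j.+1%:R^-1.
  have j0 : 0 < j.+1%:R^-1 :> R by rewrite invr_gt0.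
  by have [_ [x _ <-] xd] := inf_adherent j0 has_inf_Q; exists x.
have [phi Hphi] := choice H; exists phi; split=> [j y|i j].
  set e := j.+1%:R^-1; set be := b (phi j) y - T y.
  (* Near-minimality of phi_j makes this quadratic polynomial in t nonnegative. *)
  have h t : 0 <= t ^+ 2 * b y y + t * be *+ 2 + e.
    have := Q_ge_inf (t *: y + phi j); have := Hphi j; rewrite -/e.
    rewrite /Q bDl !bDr Tl (bC y (phi j)) /be !mulr2n; nra.
  have e0 : 0 < e by rewrite invr_gt0.
  have [q0|q0] := eqVneq (b y y) 0.
    have [-> | be0] := eqVneq be 0; first by rewrite q0 mulr0 expr0n.
    (* The polynomial is affine in t here, and this t gives it the value -e < 0. *)
    by have := h (- e / be); rewrite q0 mulr0 add0r divfK// mulr2n; lra.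
  have q1 : 0 < b y y by rewrite lt_neqAle eq_sym q0 b0.
  (* The minimum over t, attained here, is e - be^2 / q. *)
  have := h (- be / b y y); set q := b y y.
  have -> : (- be / q) ^+ 2 * q + - be / q * be *+ 2 + e = e - be ^+ 2 / q.
    by rewrite mulr2n; field.
  by rewrite subr_ge0 ler_pdivrMr.
(* Parallelogram identity, in which the linear terms of Q cancel; at the midpoint Q is at least
   d. *)
have m : b (phi i - phi j) (phi i - phi j) =
    Q (phi i) *+ 2 + Q (phi j) *+ 2 - Q (2^-1 *: phi i + 2^-1 *: phi j) *+ 4.
  have E1 : phi i - phi j = -1 *: phi j + phi i by rewrite scaleN1r addrC.
  have E2 : 2^-1 *: phi j = 2^-1 *: phi j + 0 by rewrite addr0.
  have b0l y : b 0 y = 0.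
    by have := bl y 1 0 0; rewrite scale1r addr0 /= mul1r; lra.
  have T0 : T 0 = 0 by have := Tl 1 0 0; rewrite scale1r addr0 mul1r; lra.
  rewrite E1 E2 /Q !(bDl, bDr) !Tl !b0l T0 (bC (phi j) (phi i)) ?(bC _ 0) ?b0l.
  move: (b (phi i) (phi i)) (b (phi j) (phi j)) (b (phi i) (phi j)) (T (phi i)) (T (phi j)).
  by move=> p q r u w; field.
have := Hphi i; have := Hphi j; have := Q_ge_inf (2^-1 *: phi i + 2^-1 *: phi j).
rewrite m.
move: (Q _) (Q (phi i)) (Q (phi j)) i.+1%:R^-1 j.+1%:R^-1 => p q r u w; lra.
Qed.

End Minimisation.

(** * Uniform limits of Cauchy sequences of continuous functions *)

Section UniformLimit.
Variables (R : realType) (S : topologicalType).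
Implicit Types (F : nat -> S -> R).

Lemma uniform_limit F (a : R) : 0 <= a -> (forall i, continuous (F i)) ->
  (forall i j x, (F i x - F j x) ^+ 2 <= a / i.+1%:R + a / j.+1%:R) ->
  exists2 v : S -> R, continuous v & forall e, 0 < e ->
    \forall i \near \oo, forall x, `|F i x - v x| <= e.
Proof.
move=> a0 Fc HF.
have cauchy (e : R) : 0 < e -> \forall N \near \oo, forall i j x,
    (N <= i)%N -> (N <= j)%N -> `|F i x - F j x| <= e.
  (* Chosen so that 2a / (m + 1) <= e^2. *)
  move=> e0; pose m := Num.truncn (a *+ 2 / e ^+ 2).
  have e2 : 0 < e ^+ 2 by rewrite exprn_gt0.
  exists m => // N /= mN i j x Ni Nj.
  have e0' := ltW e0; rewrite -ler_sqr ?nnegrE// real_normK ?num_real//.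
  apply: le_trans (HF i j x) _.
  have H k : (N <= k)%N -> a / k.+1%:R <= a / m.+1%:R.
    by move=> Nk; rewrite ler_wpM2l// lef_pV2 ?posrE// ler_nat ltnS (leq_trans mN).
  apply: le_trans (lerD (H i Ni) (H j Nj)) _.
  rewrite -mulr2n -mulrnAl ler_pdivrMr ?ltr0n// mulrC -ler_pdivrMr//.
  exact/ltW/truncnS_gt.
pose v x := lim (F^~ x @ \oo).
have cv x : cvg (F^~ x @ \oo).
  apply/cauchy_cvgP/cauchy_exP => e e0.
  have [|N _ HN] := cauchy (e / 2); first by rewrite divr_gt0.
  exists (F N x); exists N => // i /= Ni.
  apply: (le_lt_trans (HN N (leqnn N) N i x (leqnn N) Ni)).
  by rewrite ltr_pdivrMr// ltr_pMr// ltr1n.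
have Hv (e : R) : 0 < e -> \forall i \near \oo, forall x, `|F i x - v x| <= e.
  move=> e0; have [N _ HN] := cauchy e e0; exists N => // i /= Ni x.
  have Hij j : (N <= j)%N -> F i x - e <= F j x <= F i x + e.
    move=> Nj; have := HN N (leqnn N) i j x Ni Nj.
    by rewrite ler_norml => /andP[? ?]; apply/andP; split; lra.
  have v1 : F i x - e <= v x.
    by apply: limr_ge; [exact: cv|exists N => // j /= /Hij/andP[]].
  have v2 : v x <= F i x + e.
    by apply: limr_le; [exact: cv|exists N => // j /= /Hij/andP[]].
  by rewrite ler_norml; apply/andP; split; lra.
exists v => // x; apply/(@cvgrPdist_le _ _ _ _ (nbhs_filter x)) => e e0.
have e3 : 0 < e / 3 by rewrite divr_gt0.
have [N _ /(_ N (leqnn N)) HN] := Hv _ e3.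
have := (@cvgrPdist_le _ _ _ _ (nbhs_filter x) (F N) (F N x)).1 (@Fc N x) _ e3.
apply: filterS => y; have := HN x; have := HN y; rewrite !ler_norml.
by move=> /andP[? ?] /andP[? ?] /andP[? ?]; apply/andP; split; lra.
Qed.

End UniformLimit.

(** * Local representation by derivatives of continuous functions *)

Section Structure.
Variables (R : realType) (n : nat).
Local Notation E := 'rV[R]_n.
Implicit Types (f g : E -> R) (x c : E) (U V : opens E) (k : 'I_n) (s : seq 'I_n)
  (a : 'I_n -> nat).

Definition C0r U f (fc : continuous f) : C0 R n U := C0_mk (fun x (_ : x \ino U) => fc x).

Lemma C0rE U f (fc : continuous f) x : x \ino U -> C0_val (C0r U fc) x = f x.
Proof. by move=> xU /=; rewrite restrE. Qed.

Lemma test_partials_subproof s U (phi : testfun U) :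
  [/\ smooth (partials s phi), compact (supp (partials s phi)) &
      supp (partials s phi) `<=` U].
Proof.
have [ps pc pU] := testP phi; have sp := @supp_partials _ _ s phi; split.
- exact: smooth_partials.
- exact: (subclosed_compact (@closed_supp _ _ _) pc sp).
- exact: subset_trans pU.
Qed.

Definition test_partials s U (phi : testfun U) : testfun U :=
  MkTest (asboolT (test_partials_subproof s phi)).

(** Passing to the test function reverses the order of the derivatives, so each block is appended at
    the end. *)
Definition coord_list a (ks : seq 'I_n) : seq 'I_n :=
  foldr (fun k l => l ++ nseq (a k) k) [::] ks.

Lemma count_coord_list a k : count_mem k (coord_list a (enum 'I_n)) = a k.
Proof.
have : k \in enum 'I_n by rewrite mem_enum.
have := enum_uniq 'I_n; elim: (enum _) => //= l s IH /andP[ls us].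
rewrite inE count_cat count_nseq => /predU1P[->|ks].
  rewrite /= eqxx mul1n; have -> : count_mem l (coord_list a s) = 0%N; last by [].
  elim: s ls {IH us} => //= i s IH; rewrite inE negb_or => /andP[li /IH H].
  by rewrite count_cat H count_nseq /= eq_sym (negPf li) mul0n.
rewrite IH// [pred1 k l](_ : _ = false) ?mul0n ?addn0//.
by apply/negbTE; apply: contraNneq ls => /= ->.
Qed.

Lemma iter_dDistrE m k U (T : Distr R n U) (phi : testfun U) :
  distr_val (iter m (dDistr R k U) T) phi =
  (-1) ^+ m * distr_val T (test_partials (nseq m k) phi).
Proof.
elim: m phi => [|m IH] phi.
  by rewrite mul1r; congr (distr_val T _); exact: testfunP.
rewrite iterS [LHS]/= IH exprS mulN1r mulNr; congr (- (_ * distr_val T _)).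
apply: testfunP => x /=; have [ps _ _] := testP phi.
rewrite -[partial k (partials _ _)]/(partials (k :: nseq m k) phi).
rewrite (_ : k :: nseq m k = rcons (nseq m k) k); last by elim: m {IH} => //= m ->.
by rewrite /partials foldr_rcons.
Qed.

Lemma multi_iter_dDistrE a U (T : Distr R n U) (phi : testfun U) :
  let l := coord_list a (enum 'I_n) in
  distr_val (multi_iter (fun k => dDistr R k U) a T) phi =
  (-1) ^+ size l * distr_val T (test_partials l phi).
Proof.
rewrite /multi_iter /=; elim: (enum 'I_n) phi => [|k s IH] phi.
  by rewrite mul1r; congr (distr_val T _); exact: testfunP.
rewrite [in LHS]/= iter_dDistrE IH mulrA -exprD /= size_cat size_nseq addnC.
congr (_ * distr_val T _); apply: testfunP => x /=.
by rewrite partials_cat.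
Qed.

Lemma Rn_int_partials M s f g : 0 <= M -> smooth f -> smooth g -> box_supp M [::] g ->
  Rn_int (fun x => partials s f x * g x) =
  (-1) ^+ size s * Rn_int (fun x => f x * partials s g x).
Proof.
move=> M0 fs; elim: s g => [|k s IH] g gs gb /=; first by rewrite mul1r.
have dg := smooth_pderiv0 k gs; have gks := smooth_partial k gs.
rewrite (Rn_int_parts M0 (smooth_pderiv s k fs) dg)//; last first.
- exact: smooth_cont.
- exact: (fs (k :: s)).1.
- exact: (fs s).1.
rewrite (IH (partial k g))//; last exact: box_supp_pderiv dg (smooth_cont gks) gb.
rewrite exprS mulN1r mulNr; congr (- (_ * Rn_int _)); apply/funext => x.
have := @perm_partials _ _ (rcons s k) (k :: s) g gs; rewrite perm_rcons => /(_ (perm_refl _)).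
by rewrite /partials foldr_rcons => ->.
Qed.

Lemma near_div (q e : R) : 0 <= q -> 0 < e -> \forall j \near \oo, j.+1%:R^-1 * q <= e.
Proof.
move=> q0 e0; exists (Num.truncn (q / e)) => // j /= mj.
rewrite mulrC ler_pdivrMr ?ltr0n// mulrC -ler_pdivrMr//.
by apply/ltW/(lt_le_trans (truncnS_gt _)); rewrite ler_nat.
Qed.

Lemma Rn_int_bound M f (B : R) : 0 <= M -> box_supp M [::] f -> (forall x, `|f x| <= B) ->
  `|Rn_int f| <= B * (M *+ 2) ^+ n.
Proof.
move=> M0 fb fB; have := int_seq_bound M0 (enum_uniq 'I_n) fb fB 0.
by rewrite size_enum_ord.
Qed.

Lemma box_bound c r : exists2 M : R, 0 <= M & forall x, box c r x -> forall i, `|x ord0 i| <= M.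
Proof. exact: compact_box (@box_compact _ _ c r). Qed.

Lemma test_box_supp c r M (phi : testfun (cube c r)) :
  (forall x, box c r x -> forall i, `|x ord0 i| <= M) -> box_supp M [::] phi.
Proof.
move=> HM; have [ps _ pU] := testP phi; split; first exact: smooth_cont.
move=> x i _ xM; apply: suppN => /pU/(@cube_sub_box _ _ _ _)/HM/(_ i).
by rewrite leNgt xM.
Qed.

(* For b(phi, psi) = int (d^S phi) (d^S psi) with S = (m+1, .., m+1), a sequence
   phi_i minimising b(phi, phi) - 2 T phi satisfies b(phi_i, psi) -> T psi, and it
   is Cauchy for b, so the derivatives of phi_i of order (m, .., m) converge
   uniformly, to some v; integrate b(phi_i, psi) by parts and let i tend to infinity. *)
Lemma distr_local_form c r (T : distr (cube c r)) (C : R) m :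
  (forall phi : testfun (cube c r), `|T phi| <= C * Cnorm m phi) ->
  exists2 v : E -> R, continuous v & forall psi : testfun (cube c r),
    T psi = (-1) ^+ n * Rn_int (fun x => v x * partials (all_partials n m.+2) psi x).
Proof.
move=> TC; have [M M0 HM] := box_bound c r.
pose V := cube c r; pose S := all_partials n m.+1.
have tb (phi : testfun V) : box_supp M [::] phi by exact: test_box_supp.
have ts (phi : testfun V) : smooth phi := test_smooth phi.
have pb s (phi : testfun V) : box_supp M [::] (partials s phi).
  by apply: box_supp_partials.
have prb s (phi psi : testfun V) : box_supp M [::] (fun x => partials s phi x * partials s psi x).
  by apply: box_suppMl (pb _ _); exact: (ts phi s).1.
pose b (phi psi : testfun V) := Rn_int (fun x => partials S phi x * partials S psi x).
have bl psi : scalar (b^~ psi).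
  move=> a p q; rewrite /b -(Rn_int_lin _ M0)//; congr Rn_int; apply/funext => x.
  rewrite (partials_lin _ _ (ts p) (ts q)) !fctE /=.
  by apply: (etrans (mulrDl (a * _) _ _)); rewrite mulrA.
have bC p q : b p q = b q p by congr Rn_int; apply/funext => x; rewrite mulrC.
(* The bound of T by [Cnorm] becomes a bound by the energy b, as the minimisation requires. *)
have [A A0 HA] := Cnorm_energy n M0 m.
have TA p : T p ^+ 2 <= (C ^+ 2 * A) * b p p.
  apply: (@le_trans _ _ ((C * Cnorm m p) ^+ 2)).
    by rewrite -(real_normK (num_real (T p))) lerXn2r ?nnegrE// (le_trans _ (TC p)).
  by rewrite exprMn -mulrA ler_wpM2l ?sqr_ge0// HA.
pose K := (M + 1) *+ 2.
have K1 : 0 < K by rewrite /K mulrn_wgt0// ltr_wpDl.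
(* b has one more derivative in each coordinate than (m, .., m), which is what the sup norm of that
   derivative costs. *)
have Eb (p : testfun V) x : partials (all_partials n m) p x ^+ 2 <= K ^+ n * b p p.
  apply: le_trans (energy_Rn_int M0 (smooth_partials _ (ts p)) (pb _ p) x) _.
  by rewrite -partials_cat.
have b0 p : 0 <= b p p.
  by have := le_trans (sqr_ge0 _) (Eb p 0); rewrite pmulr_rge0// exprn_gt0.
have CA : 0 <= C ^+ 2 * A by rewrite mulr_ge0 ?sqr_ge0.
have [phi [H1 H2]] := minimising_sequence bl bC b0 (distr_scalar T) CA TA.
pose F j := partials (all_partials n m) (phi j).
have Fc j : continuous (F j) := (ts (phi j) _).1.
have KA : 0 <= K ^+ n *+ 2 by rewrite mulrn_wge0// exprn_ge0// ltW.
have HF i j x : (F i x - F j x) ^+ 2 <= K ^+ n *+ 2 / i.+1%:R + K ^+ n *+ 2 / j.+1%:R.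
  have -> : F i x - F j x = partials (all_partials n m) (phi i - phi j : testfun V) x.
    have -> : phi i - phi j = -1 *: phi j + phi i by rewrite scaleN1r addrC.
    rewrite (partials_lin _ _ (ts (phi j)) (ts (phi i))) !fctE /=.
    by rewrite [-1 *: _]mulN1r addrC.
  apply: le_trans (Eb _ x) _; apply: le_trans (ler_wpM2l _ (H2 i j)) _.
    by rewrite exprn_ge0// ltW.
  by rewrite mulrDr !mulrA mulr_natr.
have [v vc Hv] := uniform_limit KA Fc HF; exists v => // psi.
pose chi := partials (all_partials n m.+2) psi.
have cb : box_supp M [::] chi by exact: pb.
have [B chiB] : exists B, forall x, `|chi x| <= B.
  have [_ ck _] := testP (test_partials (all_partials n m.+2) psi).
  exact: compact_supp_bounded cb.1 ck.
(* The surplus derivative in each coordinate goes over to psi: its order rises from m + 1 to m + 2,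
   with sign (-1)^n. *)
have bE j : b (phi j) psi = (-1) ^+ n * Rn_int (fun x => F j x * chi x).
  rewrite /b -[X in (-1) ^+ X](size_enum_ord n).
  have := Rn_int_partials (enum 'I_n) M0 (smooth_partials (all_partials n m) (ts (phi j)))
    (smooth_partials S (ts psi)) (pb S psi).
  by rewrite -!partials_cat.
have bD j : (-1) ^+ n * Rn_int (fun x => F j x * chi x) - (-1) ^+ n * Rn_int (fun x => v x * chi x)
    = (-1) ^+ n * Rn_int (fun x => (F j x - v x) * chi x).
  rewrite -mulrBr -[X in _ = _ * X]addr0; congr (_ * _).
  have := Rn_int_lin (-1) M0 (box_suppMl vc cb) (box_suppMl (Fc j) cb).
  rewrite mulN1r addr0 addrC => <-; congr Rn_int; apply/funext => x; ring.
apply/eqP; rewrite -subr_eq0 -normr_le0; apply/ler_addgt0Pr => e e0; rewrite add0r.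
have e2 : 0 < e / 2 by rewrite divr_gt0.
have e20 : 0 < (e / 2) ^+ 2 by rewrite exprn_gt0.
have B0 : 0 <= B := le_trans (normr_ge0 _) (chiB 0).
have D0 : 0 < B * (M *+ 2) ^+ n + 1 by rewrite ltr_wpDl// mulr_ge0// exprn_ge0// mulrn_wge0.
near \oo => j.
have n1 : `|T psi - b (phi j) psi| <= e / 2.
  have e2' := ltW e2; rewrite -ler_sqr ?nnegrE// real_normK ?num_real//.
  rewrite -sqrrN opprB; apply: le_trans (H1 j psi) _.
  by near: j; exact: near_div.
have n2 : `|b (phi j) psi - (-1) ^+ n * Rn_int (fun x => v x * chi x)| <= e / 2.
  rewrite bE bD normrM normrX normrN1 expr1n mul1r.
  have Fv : forall x, `|F j x - v x| <= e / 2 / (B * (M *+ 2) ^+ n + 1).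
    by near: j; apply: Hv; rewrite divr_gt0.
  set d := _ / (_ + 1) in Fv.
  have d0 : 0 <= d by rewrite divr_ge0 ?ltW.
  have := @Rn_int_bound M (fun x => (F j x - v x) * chi x) (d * B) M0.
  move=> /(_ _ _)/le_trans; apply.
  - by apply: box_suppMl cb; exact: contB.
  - by move=> x; rewrite normrM ler_pM.
  - by rewrite -mulrA /d mulrAC ler_pdivrMr// ler_wpM2l ?ltW// ltrDl.
have -> : T psi - (-1) ^+ n * Rn_int (fun x => v x * chi x) =
    (T psi - b (phi j) psi) + (b (phi j) psi - (-1) ^+ n * Rn_int (fun x => v x * chi x)).
  by rewrite addrA subrK.
apply: le_trans (ler_normD _ _) _; rewrite [leRHS](splitr e) lerD//.
Unshelve. all: by end_near. Qed.

Lemma lambda_multi_iterE a V f (fc : continuous f) (psi : testfun V) :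
  let l := coord_list a (enum 'I_n) in
  distr_val (multi_iter (fun k => dDistr R k V) a (lambda R n V (C0r V fc))) psi =
  (-1) ^+ size l * Rn_int (fun x => f x * partials l psi x).
Proof.
rewrite /= multi_iter_dDistrE /= /lambda_form; congr (_ * Rn_int _); apply/funext => x /=.
have [_ _ pV] := testP (test_partials (coord_list a (enum 'I_n)) psi).
have [xV|xV] := pselect (x \ino V); first by rewrite restrE.
have -> : partials (coord_list a (enum 'I_n)) psi x = 0 by apply: suppN => /pV.
by rewrite !mulr0.
Qed.

(** The closed box of radius r lies in U, so one seminorm estimate of T covers all test functions on
    the cube. *)
Lemma distr_structure U (T : Distr R n U) x0 : x0 \ino U -> exists r (f : E -> R) (fc : continuous f) a,
  [/\ 0 < r, cube x0 r `<=` U & forall VU : cube x0 r `<=` U,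
    res (Distr R n) VU T =
    multi_iter (fun k => dDistr R k (cube x0 r)) a (lambda R n (cube x0 r) (C0r (cube x0 r) fc))].
Proof.
move=> /nbhs_box[r r0 rU]; have VU : cube x0 r `<=` U.
  by move=> x /(@cube_sub_box _ _ _ _)/rU.
have [C [m HT]] := (distrP T).2 _ (@box_compact _ _ x0 r) rU.
have [phi|v vc Hv] := @distr_local_form x0 r (res (Distr R n) VU T) C m.
  by apply: HT; have [_ _ pV] := testP phi; move=> x /pV/(@cube_sub_box _ _ _ _).
pose a (k : 'I_n) := m.+2.
pose l := coord_list a (enum 'I_n).
have lS : perm_eq l (all_partials n m.+2).
  by apply: perm_count => k; rewrite count_coord_list count_all_partials.
(* The sign in [distr_local_form] times the sign from moving D^a onto psi. *)
pose sg : R := (-1) ^+ n * (-1) ^+ size l.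
have fc : continuous (fun x => sg * v x) by apply: contM => //; exact: cont_cst.
exists r, _, fc, a; split=> // VU'.
rewrite (Prop_irrelevance VU' VU); apply: val_inj; apply/funext => psi.
apply: (etrans (Hv psi)); apply/esym; apply: (etrans (lambda_multi_iterE _ _ _)); rewrite /= -/l.
have [M M0 HM] := box_bound x0 r.
have pb : box_supp M [::] (fun x => v x * partials (all_partials n m.+2) psi x).
  apply: box_suppMl => //; apply: box_supp_partials (test_smooth psi) _.
  exact: test_box_supp.
have z0 : box_supp M [::] (fun _ : E => 0 : R) by split; [exact: cont_cst|].
have := Rn_int_lin sg M0 pb z0.
rewrite (_ : Rn_int (fun=> 0) = 0); last first.
  by rewrite (bint_Rn_int M0 z0) bint_seq0.
rewrite addr0 (perm_partials (test_smooth psi) lS) => h.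
rewrite (_ : (fun x => _) = (fun x => sg * (v x * partials (all_partials n m.+2) psi x) + 0)); last first.
  by apply/funext => x; rewrite addr0 mulrA.
by rewrite h /sg mulrA [_ ^+ n * _]mulrC mulrA -exprD -signr_odd oddD addbb mul1r.
Qed.

End Structure.

(** * The kernel of a distributional derivative *)

Section DuBoisReymond.
Variables (R : realType) (c r M : R).
Hypothesis r0 : 0 < r.
Hypothesis cM : - M <= c - r /\ c + r <= M.
Implicit Types (phi h u : R -> R) (t : R).

(** The radius rho < r keeps the support in a compact part of the open interval (c - r, c + r). *)
Definition test1 phi := smooth1 phi /\
  exists2 rho, rho < r & forall t, rho <= `|t - c| -> phi t = 0.

Let NM : - M <= M. Proof. by have r0' := r0; have [? ?] := cM; lra. Qed.

Lemma test1_deriv phi : test1 phi -> test1 (derive1 phi).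
Proof.
move=> [/smooth1_deriv[dphi ds] [rho rr H]]; split=> //.
(* A radius strictly between rho and r, so that phi vanishes near every t concerned. *)
exists ((rho + r) / 2); first lra.
move=> t tr; rewrite derive1E; have tr' : rho < `|t - c| by lra.
have d0 : is_derive t 1 phi 0.
  have cc : continuous (fun t : R => `|t - c|).
    by apply: cont_comp (@norm_continuous _ _); apply: contB; [exact: cont_id|exact: cont_cst].
  apply: (@near_is_derive _ (cst 0)); near=> s; rewrite H//.
  by apply/ltW; near: s; exact: (@cvgr_gt _ _ _ _ _ _ (cc t) _ tr').
exact: derive_val.
Unshelve. all: by end_near. Qed.

Lemma derive1nSr m phi : derive1n m.+1 phi = derive1n m (derive1 phi).
Proof. by rewrite /derive1n iterSr. Qed.

Lemma test1_deriven m phi : test1 phi -> test1 (derive1n m phi).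
Proof. by elim: m phi => [//|m IH] phi /test1_deriv; rewrite derive1nSr; exact: IH. Qed.

Lemma test1_cont phi : test1 phi -> continuous phi.
Proof. by move=> [/smooth1_cont]. Qed.

Lemma test1_lin a phi psi : test1 phi -> test1 psi -> test1 (fun t => a * phi t + psi t).
Proof.
move=> [phis [p pr P]] [psis [q qr Q]]; split.
  by apply: smooth1D => //; exact: smooth1Z.
exists (Num.max p q); first by rewrite gt_max pr qr.
by move=> t; rewrite ge_max => /andP[pt qt]; rewrite P// Q// mulr0 addr0.
Qed.

Lemma test1_bump t0 e : `|t0 - c| < r -> 0 < e -> exists2 phi, test1 phi &
  [/\ forall t, 0 <= phi t, 0 < phi t0 & forall t, e <= `|t - t0| -> phi t = 0].
Proof.
move=> tc e0; have r0' := r0; pose d := Num.min e ((r - `|t0 - c|) / 2).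
have d0 : 0 < d by rewrite lt_min e0 divr_gt0// subr_gt0.
have de : d <= e by rewrite ge_min lexx.
have dr : d <= (r - `|t0 - c|) / 2 by rewrite ge_min lexx orbT.
have tt : t0 - d < t0 + d by lra.
have [phi phis [p0 pp pz]] := bump1_exists tt.
have z t : d <= `|t - t0| -> phi t = 0.
  move=> dt; apply: pz; apply/negP => /andP[t1 t2].
  by move: dt; apply/negP; rewrite -ltNge ltr_norml; apply/andP; split; lra.
exists phi.
  split=> //; exists (`|t0 - c| + d); first lra.
  move=> t ht; apply: z; have := ler_normD (t - t0) (t0 - c).
  by rewrite addrA subrK => hh; lra.
split=> //; first by apply: pp; apply/andP; split; lra.
by move=> t et; apply: z; lra.
Qed.

(** The antiderivative that vanishes left of the support is constant right of it, and that constant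
    is the total integral. *)
Lemma test1_primitive psi : test1 psi -> iint (- M) M psi = 0 ->
  exists2 phi, test1 phi & derive1 phi = psi.
Proof.
move=> [psis [rho rr Z]] I0; have pc := smooth1_cont psis.
have U a b : a <= b -> iint a b psi = primitive psi b - primitive psi a.
  by move=> ab; apply: FTC2 => // s _; exact: is_derive_primitive.
have I00 a b : a <= b -> (forall t, a <= t <= b -> psi t = 0) ->
    primitive psi b = primitive psi a.
  move=> ab H; apply/eqP; rewrite -subr_eq0 -U// (@eq_iint _ _ _ _ (fun=> 0))//.
  by rewrite iint_cst// mul0r.
have r0' := r0; have [cM1 cM2] := cM.
pose a0 := primitive psi (- M).
have aM : primitive psi M = a0 by move: I0; rewrite (U _ _ NM) => /eqP; rewrite subr_eq0 => /eqP.
have dphi t : is_derive t 1 (fun t => - a0 + primitive psi t) (psi t).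
  have := is_deriveD (is_derive_cst (- a0) t 1) (is_derive_primitive t pc).
  by rewrite add0r.
exists (fun t => - a0 + primitive psi t); last first.
  by apply/funext => t; rewrite derive1E; have := dphi t => d; exact: derive_val.
split; first exact: smooth1_antideriv psis.
(* rho may be negative, in which case psi is 0 everywhere. *)
pose rho' := Num.max rho 0; have rr' : rho' < r by rewrite /rho' gt_max rr.
have rho0 : 0 <= rho' by rewrite le_max lexx orbT.
have Z' t : rho' <= `|t - c| -> psi t = 0.
  by move=> h; apply: Z; apply: le_trans h; rewrite le_max lexx.
have left_ t : t <= c - rho' -> primitive psi t = a0.
  have H a b : a <= b -> b <= c - rho' -> primitive psi b = primitive psi a.
    move=> ab bc; apply: I00 => // s /andP[sa sb]; apply: Z'.
    by rewrite ler_normr; apply/orP; right; lra.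
  move=> tc; have [tM|tM] := leP t (- M); first by rewrite /a0 (H t (- M))//; lra.
  by rewrite (H (- M) t)//; lra.
have right_ t : c + rho' <= t -> primitive psi t = a0.
  have H a b : a <= b -> c + rho' <= a -> primitive psi b = primitive psi a.
    move=> ab bc; apply: I00 => // s /andP[sa sb]; apply: Z'.
    by rewrite ler_normr; apply/orP; left; lra.
  move=> tc; have [tM|tM] := leP t M; first by rewrite -aM (H t M)//; lra.
  by rewrite (H M t) ?aM//; lra.
exists rho' => // t; rewrite ler_normr => /orP[h|h].
  by rewrite right_ ?addNr//; lra.
by rewrite left_ ?addNr//; lra.
Qed.

(** The pairing of t^m with m-th derivatives determines the monomial to subtract in
    [du_Bois_Reymond]. *)
Lemma iint_pow m phi : test1 phi ->
  iint (- M) M (fun t => t ^+ m * derive1n m phi t) = (-1) ^+ m * m`!%:R * iint (- M) M phi.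
Proof.
elim: m phi => [|m IH] phi tp.
  by rewrite !mul1r; apply: eq_iint => t _; rewrite mul1r.
have tpm := test1_deriven m tp.
have tps := test1_deriven m.+1 tp.
have r0' := r0; have [cM1 cM2] := cM.
have d t : is_derive t 1 (fun t => t ^+ m.+1 * derive1n m phi t)
    (m.+1%:R * (t ^+ m * derive1n m phi t) + t ^+ m.+1 * derive1n m.+1 phi t).
  have dX : is_derive t 1 (fun t : R => t ^+ m.+1) (m.+1%:R * t ^+ m).
    have := is_derive_poly ('X^(m.+1) : {poly R}) t; rewrite derivXn hornerMn hornerXn mulr_natl.
    by rewrite (_ : horner ('X^(m.+1) : {poly R}) = fun t => t ^+ m.+1)//; apply/funext => s; rewrite hornerXn.
  have := is_deriveM dX ((smooth1_deriv tpm.1).1 t).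
  by rewrite addrC [_ *: (_ * _)]mulrC -mulrA.
have Xc (j : nat) : continuous (fun t : R => t ^+ j) by exact: exprn_continuous.
have c1 : continuous (fun t => t ^+ m * derive1n m phi t).
  by apply: contM => //; exact: test1_cont.
have c2 : continuous (fun t => t ^+ m.+1 * derive1n m.+1 phi t).
  by apply: contM => //; exact: test1_cont.
have h : iint (- M) M (fun t => m.+1%:R * (t ^+ m * derive1n m phi t) +
    t ^+ m.+1 * derive1n m.+1 phi t) = 0.
  have dc : continuous (fun t => m.+1%:R * (t ^+ m * derive1n m phi t) +
      t ^+ m.+1 * derive1n m.+1 phi t).
    by apply: contD => //; apply: contM => //; exact: cont_cst.
  have -> := @FTC2 _ _ _ _ _ NM (fun t _ => d t) dc.
  have [_ [rho rr Z]] := tpm.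
  have Z1 : derive1n m phi M = 0 by apply: Z; rewrite ler_normr; apply/orP; left; lra.
  have Z2 : derive1n m phi (- M) = 0 by apply: Z; rewrite ler_normr; apply/orP; right; lra.
  by rewrite Z1 Z2 !mulr0 subrr.
move: h; rewrite iintD//; last by apply: contM => //; exact: cont_cst.
rewrite iintZ// IH// => /eqP; rewrite addrC addr_eq0 => /eqP ->.
by rewrite factS natrM exprS; ring.
Qed.

(** Up to a multiple of a fixed [eta0], each test function is the derivative of another, so pairing
    h with m-th derivatives is s times the integral; a monomial s' t^m has the same pairing, and the
    induction hypothesis applies to the difference. *)
Lemma du_Bois_Reymond m h : continuous h ->
  (forall phi, test1 phi -> iint (- M) M (fun t => h t * derive1n m phi t) = 0) ->
  exists2 p : {poly R}, (size p <= m)%N & forall t, `|t - c| < r -> h t = p.[t].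
Proof.
have r0' := r0; have [cM1 cM2] := cM.
elim: m h => [|m IH] h hc H.
  exists 0; first by rewrite size_poly0.
  move=> t0 t0c; rewrite horner0; apply/eqP; apply: contraT => h0.
  (* Multiplication by h t0 settles the sign: near t0 the product h t0 * h t is positive. *)
  have h2 : 0 < h t0 * h t0 by rewrite -expr2 exprn_even_gt0.
  have hh : continuous (fun t => h t0 * h t) by apply: contM => //; exact: cont_cst.
  have := @cvgr_gt _ _ _ (nbhs_filter t0) _ _ (hh t0) _ h2.
  move=> /nbhs_ballP[e /= e0 eP].
  have [phi tp [p0 pp pz]] := test1_bump t0c e0.
  have pc := test1_cont tp.
  have c1 : continuous (fun t => h t * phi t) by exact: contM.
  have I0 : iint (- M) M (fun t => h t0 * (h t * phi t)) = 0.
    by rewrite iintZ// (H phi tp) mulr0.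
  have := iint_ge0_eq0 _ _ I0 => /(_ _ _ t0).
  have -> : - M < t0 < M by move: t0c; rewrite ltr_norml => /andP[? ?]; apply/andP; split; lra.
  move=> E; have {E} : h t0 * (h t0 * phi t0) = 0.
    apply: E => //; first by apply: contM => //; exact: cont_cst.
    move=> t _; rewrite mulrA; have [te|te] := ltP `|t - t0| e.
      by rewrite mulr_ge0// ltW//; apply: eP; rewrite /ball /= distrC.
    by rewrite pz// mulr0.
  by move/eqP; rewrite mulrA mulf_eq0 (gt_eqF h2) (gt_eqF pp).
have cc : `|c - c| < r by rewrite subrr normr0.
have [eta0 te [e0 ep _]] := test1_bump cc r0.
have ec := test1_cont te.
have Ie : iint (- M) M eta0 != 0.
  apply/eqP => I0; have := iint_ge0_eq0 ec (fun t _ => e0 t) I0 => /(_ c).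
  by rewrite (_ : - M < c < M) ?(gt_eqF ep)//; [move=> /(_ isT) E; rewrite E ltxx in ep|apply/andP; split; lra].
pose s := iint (- M) M (fun t => h t * derive1n m eta0 t) / iint (- M) M eta0.
have hd phi j : test1 phi -> continuous (fun t => h t * derive1n j phi t).
  by move=> tp; apply: contM => //; apply: test1_cont; exact: test1_deriven.
have lin j a phi psi : test1 phi -> test1 psi ->
    derive1n j (fun t => a * phi t + psi t) = fun t => a * derive1n j phi t + derive1n j psi t.
  elim: j phi psi => [//|j IHj] phi psi tp tq.
  rewrite !derive1nSr -(IHj _ _ (test1_deriv tp) (test1_deriv tq)); congr derive1n.
  apply/funext => t; rewrite derive1E.
  have d := is_deriveD (is_deriveZ a ((smooth1_deriv tp.1).1 t)) ((smooth1_deriv tq.1).1 t).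
  exact: (@derive_val _ _ _ _ _ _ _ d).
have Hs phi : test1 phi -> iint (- M) M (fun t => h t * derive1n m phi t) = s * iint (- M) M phi.
  (* Chosen to give a eta0 + phi the integral 0. *)
  move=> tp; pose a := - (iint (- M) M phi / iint (- M) M eta0).
  have tq := test1_lin a te tp.
  have pc := test1_cont tp.
  have [|Phi tP dP] := test1_primitive tq.
    by rewrite iint_lin// /a mulNr divfK// addNr.
  have := H Phi tP; rewrite derive1nSr dP (lin m a _ _ te tp).
  rewrite (_ : (fun t => _) = (fun t => a * (h t * derive1n m eta0 t) + h t * derive1n m phi t)); last first.
    by apply/funext => t; ring.
  rewrite iint_lin//; [|exact: hd..]; move/eqP; rewrite addrC addr_eq0 => /eqP ->.
  by rewrite /a /s mulNr opprK; ring.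
(* By [iint_pow], s' t^m paired with m-th derivatives is s times the integral. *)
pose s' := s * (-1) ^+ m / m`!%:R.
have Xc (j : nat) : continuous (fun t : R => t ^+ j) by exact: exprn_continuous.
have X'c : continuous (fun t : R => s' * t ^+ m) by apply: contM => //; exact: cont_cst.
have [||p pm hp] := IH (fun t => h t - s' * t ^+ m); first exact: contB.
  move=> phi tp; have tpm := test1_cont (test1_deriven m tp).
  rewrite (_ : (fun t => _) = (fun t => h t * derive1n m phi t - s' * (t ^+ m * derive1n m phi t))).
    rewrite iintB//; [|exact: hd|by apply: contM; [exact: cont_cst|exact: contM]].
    rewrite iintZ//; last exact: contM.
    rewrite iint_pow// Hs// /s'.
    have f0 : m`!%:R != 0 :> R by rewrite pnatr_eq0 -lt0n fact_gt0.
    have -> : s * (-1) ^+ m / m`!%:R * ((-1) ^+ m * m`!%:R * iint (- M) M phi) =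
      s * ((-1) ^+ m * (-1) ^+ m) * iint (- M) M phi by field.
    by rewrite -expr2 sqrr_sign mulr1 subrr.
  by apply/funext => t; ring.
exists (p + s' *: 'X^m).
  rewrite (leq_trans (size_polyD _ _))// geq_max (leq_trans pm)//.
  by rewrite (leq_trans (size_scale_leq _ _))// size_polyXn.
by move=> t tc; rewrite hornerD hornerZ hornerXn -hp// subrK.
Qed.

(** Nodes and basis are fixed before h is given, so in several variables they do not vary with the
    other coordinates. *)
Lemma interpolation m : exists (x : nat -> R) (l : nat -> {poly R}),
  [/\ forall i, `|x i - c| < r, forall i, (size (l i) <= m)%N &
    forall h, continuous h ->
    (forall phi, test1 phi -> iint (- M) M (fun t => h t * derive1n m phi t) = 0) ->
    forall t, `|t - c| < r -> h t = \sum_(i < m) h (x i) * (l i).[t]].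
Proof.
pose x (i : nat) := c + r / i.+2%:R.
have xc i : `|x i - c| < r.
  rewrite /x addrC addrA addNr add0r normrM normfV (gtr0_norm r0) normr_nat.
  by rewrite ltr_pdivrMr// ltr_pMr// ltr1n.
have [m0|m0] := posnP m.
  exists x, (fun=> 0); split=> [//|i|h hc H t tc]; first by rewrite size_poly0.
  subst m; rewrite big_ord0; have [p pm hp] := du_Bois_Reymond hc H.
  by rewrite hp//; move: pm; rewrite leqn0 size_poly_eq0 => /eqP ->; rewrite horner0.
have xi : injective x.
  move=> i j /addrI/(mulfI (lt0r_neq0 r0))/invr_inj/eqP.
  by rewrite eqr_nat => /eqP[].
exists x, (fun i => if insub i is Some j then tnth (qpoly.lagrange m x) j : {poly R} else 0).
split=> // [i|h hc H t tc].
  by case: insubP => [j _ _|_]; rewrite ?size_poly0// qpoly.size_lagrange_.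
have [p pm hp] := du_Bois_Reymond hc H.
rewrite hp// {1}(qpoly.lagrange_gen m0 xi pm) horner_sum; apply: eq_bigr => i _.
by rewrite valK hornerM hornerC -hp.
Qed.

End DuBoisReymond.

(** * Elimination of the coordinates one after the other *)

Section Kernel.
Variables (R : realType) (n : nat).
Local Notation E := 'rV[R]_n.
Implicit Types (f g G : E -> R) (x y c : E) (k l : 'I_n) (s : seq 'I_n) (v : 'I_n -> R -> R).

Lemma partials_tensor s v : (forall i, smooth1 (v i)) ->
  partials s (tensor v) = tensor (fun i => derive1n (count_mem i s) (v i)).
Proof.
move=> vs; elim: s => [//|k s IH] /=.
have vss i m : smooth1 (derive1n m (v i)).
  by elim: m => [|m H]; [exact: vs|exact: (smooth1_deriv H).2].
rewrite IH (pderiv_partial (pderiv_tensor _)); last first.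
  exact: (smooth1_deriv (vss k _)).1.
congr tensor; apply/funext => i; rewrite /dtensor /= eq_sym.
by case: eqP => // ->.
Qed.

Lemma cont_sum (J : Type) (r : seq J) (F : J -> E -> R) :
  (forall i, continuous (F i)) -> continuous (fun y => \sum_(i <- r) F i y).
Proof. by move=> Fc y; apply: cont_sum_at => i; exact: Fc. Qed.

Section Slices.
Variables (M : R) (M0 : 0 <= M).

Lemma bint_seq_factor s k (w : R -> R) G x : k \notin s -> continuous G ->
  bint_seq M s (fun y => w (y ord0 k) * G y) x = w (x ord0 k) * bint_seq M s G x.
Proof.
move=> + Gc; elim: s x => [//|l s IH] x; rewrite inE negb_or => /andP[kl ks] /=.
rewrite /bint -iintZ; last by apply: continuous_slice; exact: bint_seq_cont.
congr iint; apply/funext => t; rewrite /slice IH// upd_neq//.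
Qed.

Lemma bint_seq_updC s k G x t : k \notin s ->
  bint_seq M s G (upd x k t) = bint_seq M s (fun y => G (upd y k t)) x.
Proof.
elim: s x => [//|l s IH] x; rewrite inE negb_or => /andP[kl ks] /=.
by rewrite /bint; congr iint; apply/funext => u; rewrite /slice updC// IH.
Qed.

Lemma bint_seq_sum s (J : Type) (r : seq J) (F : J -> E -> R) x :
  (forall i, continuous (F i)) ->
  bint_seq M s (fun y => \sum_(i <- r) F i y) x = \sum_(i <- r) bint_seq M s (F i) x.
Proof.
move=> Fc; elim: r => [|i r IH].
  rewrite big_nil (_ : (fun y => _) = fun=> 0); last by apply/funext => y; rewrite big_nil.
  by rewrite bint_seq0.
rewrite big_cons -IH.
have sc : continuous (fun y => \sum_(i <- r) F i y) by exact: cont_sum.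
rewrite (_ : (fun y => _) = 1 *: F i + fun y => \sum_(i <- r) F i y); last first.
  by apply/funext => y; rewrite big_cons scale1r.
by rewrite bint_seq_lin// scale1r.
Qed.

End Slices.

Variables (c : E) (r M : R) (a : 'I_n -> nat).
Hypothesis r0 : 0 < r.
Hypothesis M0 : 0 <= M.
Hypothesis cM : forall i, - M <= c ord0 i - r /\ c ord0 i + r <= M.

Let test_at i := test1 (c ord0 i) r.

Lemma tensor_test v : (forall i, test_at i (v i)) ->
  [/\ smooth (tensor v), compact (supp (tensor v)) & supp (tensor v) `<=` cube c r].
Proof.
move=> vt; have r0' := r0.
have H i : exists rho, rho < r /\ forall t, rho <= `|t - c ord0 i| -> v i t = 0.
  by have [_ [rho ? ?]] := vt i; exists rho.
have [rho Hrho] := choice H.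
pose q := \big[Num.max/0]_i rho i.
have qr : q < r by apply: bigmax_lt => // i _; exact: (Hrho i).1.
have sb : supp (tensor v) `<=` box c ((q + r) / 2).
  apply: supp_box => x /existsNP[i /negP]; rewrite -ltNge => xi.
  rewrite /tensor (bigD1 i)//= (Hrho i).2 ?mul0r//.
  have : rho i <= q by exact: le_bigmax.
  lra.
split; first by apply: smooth_tensor => i; exact: (vt i).1.
  exact: subclosed_compact (@closed_supp _ _ _) (@box_compact _ _ _ _) sb.
by apply: subset_trans sb _; apply: box_sub_cube; lra.
Qed.

Let weight s (phi : 'I_n -> R -> R) y := \prod_(i <- s) derive1n (a i) (phi i) (y ord0 i).

(** The coordinates in s are integrated, the others stay at x. For s all coordinates this is D^a g =
    0 tested on tensor products; for s empty it says that g vanishes on the cube. *)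
Definition orthogonal s g := forall phi, (forall i, test_at i (phi i)) ->
  forall x, x \ino cube c r -> bint_seq M s (fun y => g y * weight s phi y) x = 0.

Let weight_cont s phi : (forall i, test_at i (phi i)) -> continuous (weight s phi).
Proof.
move=> tphi; apply: cont_prod => i.
apply: cont_comp (@coord_cont _ _ i) _; exact: smooth1_cont (test1_deriven (a i) (tphi i)).1.
Qed.

Let weight_upd s phi k y t : k \notin s -> weight s phi (upd y k t) = weight s phi y.
Proof.
move=> ks; apply: eq_big_seq => i is_; rewrite upd_neq//.
by apply: contraNneq ks => <-.
Qed.

Definition interp k (xs : nat -> R) (p : nat -> {poly R}) g y : R :=
  \sum_(i < a k) g (upd y k (xs i)) * (p i).[y ord0 k].

Lemma interp_cont k xs p g : continuous g -> continuous (interp k xs p g).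
Proof.
move=> gc; apply: cont_sum => i; apply: contM.
  by apply: cont_comp gc; apply: upd_cont; [exact: cont_id|exact: cont_cst].
apply: cont_comp (@coord_cont _ _ k) _; exact: continuous_horner.
Qed.

(* Integrating out the coordinates in s leaves a function of the k-th coordinate
   which is a polynomial of degree < a k on the interval, hence equal to the
   interpolation of its values at fixed nodes; interpolating g itself at these
   nodes gives the term to subtract. *)
Lemma orthogonal_cons k s : k \notin s -> exists (x : nat -> R) (p : nat -> {poly R}),
  (forall i, (size (p i) <= a k)%N) /\
  forall g, continuous g -> orthogonal (k :: s) g -> orthogonal s (fun y => g y - interp k x p g y).
Proof.
move=> ks; have [x [p [xc ps H]]] := @interpolation R (c ord0 k) r M r0 (cM k) (a k).
exists x, p; split=> // g gc og phi tphi z zc.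
have wc := weight_cont (s := s) tphi.
pose G y := g y * weight s phi y.
have Gc : continuous G by exact: contM.
pose h t := bint_seq M s G (upd z k t).
have hc : continuous h.
  exact: (@continuous_slice R n _ z k (bint_seq_cont M0 (s := s) Gc)).
have hE t : `|t - c ord0 k| < r -> h t = \sum_(i < a k) h (x i) * (p i).[t].
  apply: (H h hc) => phik tphik.
  (* The one-variable test function takes the k-th place in the family. *)
  pose phi' i := if i == k then phik else phi i.
  have tphi' i : test_at i (phi' i) by rewrite /phi'; case: eqP => // ->.
  rewrite -(og phi' tphi' z zc) /= /bint; congr iint; apply/funext => u.
  rewrite /slice (_ : (fun y => _) =
      fun y => derive1n (a k) phik (y ord0 k) * G y); last first.
    apply/funext => y; rewrite /weight big_cons {1}/phi' eqxx mulrCA; congr (_ * (_ * _)).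
    apply: eq_big_seq => i is_; rewrite /phi'; case: eqP => // ik.
    by rewrite -ik is_ in ks.
  by rewrite bint_seq_factor// upd_eq mulrC.
have := hE _ (zc k); rewrite {1}/h upd_id => E0.
have ic := @interp_cont k x p g gc.
rewrite (_ : (fun y => _) = (-1) *: (fun y => interp k x p g y * weight s phi y) + G); last first.
  by apply/funext => y; rewrite !fctE /= [-1 *: _]mulN1r /G mulrBl addrC.
rewrite bint_seq_lin//; last exact: contM.
rewrite !fctE /= [-1 *: _]mulN1r E0.
rewrite (_ : (fun y => interp k x p g y * _) = fun y =>
    \sum_(i < a k) (p i).[y ord0 k] * G (upd y k (x i))); last first.
  apply/funext => y; rewrite /interp mulr_suml; apply: eq_bigr => i _.
  by rewrite /G weight_upd//; ring.
have Guc i : continuous (fun y => G (upd y k (x i))).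
  by apply: cont_comp Gc; apply: upd_cont; [exact: cont_id|exact: cont_cst].
rewrite bint_seq_sum//; last first.
  move=> i; apply: contM => //.
  by apply: cont_comp (@coord_cont _ _ k) _; exact: continuous_horner.
rewrite -sumrN -big_split big1// => i _ /=.
rewrite (bint_seq_factor M0 (fun t => (p i).[t]) _ ks)//.
by rewrite /h bint_seq_updC// mulrC addNr.
Qed.

Definition polynomial_along k f := exists C : nat -> E -> R,
  [/\ forall i, continuous (C i), forall i y t, C i (upd y k t) = C i y &
      forall y, f y = \sum_(i < a k) C i y * y ord0 k ^+ i].

Lemma interp_polynomial k xs (p : nat -> {poly R}) g : continuous g -> (forall i, (size (p i) <= a k)%N) ->
  polynomial_along k (interp k xs p g).
Proof.
move=> gc ps; exists (fun j y => \sum_(i < a k) g (upd y k (xs i)) * (p i)`_j); split.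
- move=> j; apply: cont_sum => i; apply: contM; last exact: cont_cst.
  by apply: cont_comp gc; apply: upd_cont; [exact: cont_id|exact: cont_cst].
- by move=> j y t; apply: eq_bigr => i _; rewrite upd_upd.
- move=> y; rewrite /interp.
  under [RHS]eq_bigr do rewrite mulr_suml.
  rewrite exchange_big /=; apply: eq_bigr => i _.
  rewrite (horner_coef_wide _ (ps i)) mulr_sumr; apply: eq_bigr => j _.
  by rewrite mulrA.
Qed.

Lemma orthogonal_sum s g : uniq s -> continuous g -> orthogonal s g ->
  exists theta : 'I_n -> E -> R,
    [/\ forall k, continuous (theta k), forall k, polynomial_along k (theta k) &
        forall x, x \ino cube c r -> g x = \sum_(k <- s) theta k x].
Proof.
elim: s g => [|k s IH] g /=.
  move=> _ gc og; exists (fun _ _ => 0); split=> [k|k|x xc]; first exact: cont_cst.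
    exists (fun _ _ => 0); split=> //; first by move=> i; exact: cont_cst.
    by move=> y; rewrite big1// => i _; rewrite mul0r.
  rewrite big_nil.
  have t0 i : test_at i (fun=> 0) by split; [exact: smooth1_cst|exists 0].
  have := og (fun _ _ => 0) t0 x xc.
  by rewrite /= /weight big_nil mulr1.
move=> /andP[ks us] gc og.
have [x [p [ps H]]] := orthogonal_cons ks.
have ic := @interp_cont k x p g gc.
have [|theta [thc thp thE]] := IH _ us _ (H g gc og); first exact: contB.
exists (fun i => if i == k then interp k x p g else theta i); split=> [i|i|y yc].
- by case: eqP.
- by case: eqP => [->|_]; [exact: interp_polynomial|exact: thp].
- rewrite big_cons eqxx; have := thE y yc => /eqP; rewrite subr_eq addrC => /eqP ->.
  congr (_ + _); apply: eq_big_seq => i is_; case: eqP => // ik.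
  by rewrite -ik is_ in ks.
Qed.

End Kernel.

Section KernelOfDerivatives.
Variables (R : realType) (n : nat).
Local Notation E := 'rV[R]_n.
Implicit Types (f : E -> R) (c x : E) (a : 'I_n -> nat).

Lemma cube_is_interval c r : 0 < r -> @Defs.is_interval R n (cube c r).
Proof.
move=> r0; exists c, r; split => //; apply/seteqP; split=> x /= H i.
  by have := H i; rewrite ltr_distl.
by have := H i; rewrite -ltr_distl.
Qed.

Lemma derivatives_eq0_polynomial c r f (fc : continuous f) a : 0 < r ->
  multi_iter (fun k => dDistr R k (cube c r)) a
    (lambda R n (cube c r) (C0r (cube c r) fc)) = 0 ->
  exists theta : 'I_n -> C0 R n (cube c r),
    (forall k, polynomial_in k (a k) (theta k)) /\ C0r (cube c r) fc = \sum_k theta k.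
Proof.
move=> r0 D0; have [M M0 HM] := box_bound c r.
have cM i : - M <= c ord0 i - r /\ c ord0 i + r <= M.
  (* The point c + t (1, .., 1) lies in the box. *)
  have b1 t : `|t| <= r -> `|c ord0 i + t| <= M.
    move=> tr; have := HM (\row_j (c ord0 j + t)) _ i; rewrite mxE; apply.
    by move=> j; rewrite mxE addrAC subrr add0r.
  have := b1 r; have := b1 (- r); rewrite normrN gtr0_norm// => /(_ (lexx _)) h1 /(_ (lexx _)) h2.
  by move: h1 h2; rewrite !ler_norml => /andP[? ?] /andP[? ?].
have og : orthogonal c r M a (enum 'I_n) f.
  move=> phi tphi x xc.
  pose psi : testfun (cube c r) := MkTest (asboolT (tensor_test r0 tphi)).
  have := congr1 (fun S : Distr R n (cube c r) => distr_val S psi) D0.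
  have smo i : smooth1 (phi i) := (tphi i).1.
  rewrite /= (lambda_multi_iterE a fc psi) /= (partials_tensor _ smo) => /eqP.
  rewrite mulf_eq0 expf_eq0 oppr_eq0 oner_eq0 andbF /= => /eqP I0.
  pose w i := derive1n (a i) (phi i).
  have wE : (fun i => derive1n (count_mem i (coord_list a (enum 'I_n))) (phi i)) = w.
    by apply/funext => i; rewrite count_coord_list.
  have tw i : test1 (c ord0 i) r (w i) by apply: test1_deriven.
  pose om : testfun (cube c r) := MkTest (asboolT (tensor_test r0 tw)).
  have ob : box_supp M [::] (tensor w) by exact: (@test_box_supp _ _ c r M om).
  rewrite wE (bint_Rn_int M0 (box_suppMl fc ob)) in I0.
  rewrite (_ : (fun y => _) = fun y => f y * tensor w y); last first.
    by apply/funext => y; rewrite /tensor big_enum.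
  rewrite (@bint_seq_const _ _ M _ _ x 0)//.
    by apply: contM => //; exact: ob.1.
  by move=> k; rewrite mem_enum.
have [theta [thc thp thE]] := orthogonal_sum r0 M0 cM (enum_uniq _) fc og.
exists (fun k => C0r (cube c r) (thc k)); split=> [k|].
  have [C [Cc Ci CE]] := thp k.
  exists (fun i => C0r (cube c r) (Cc i)); split=> [i x y xc yc xy|x xc].
    rewrite !C0rE// (_ : y = upd x k (y ord0 k)) ?Ci//.
    by apply/rowP => l; rewrite mxE; case: eqP => [->//|/eqP /xy].
  by rewrite C0rE// CE; apply: eq_bigr => i _; rewrite C0rE.
apply: C0_ext => x xc; rewrite C0rE// thE// big_enum /=.
have C0sum (s : seq 'I_n) : C0_val (\sum_(k <- s) C0r (cube c r) (thc k)) x =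
    \sum_(k <- s) theta k x.
  elim: s => [|k s IH]; first by rewrite !big_nil.
  by rewrite !big_cons -IH -(C0rE (thc k) xc).
by rewrite C0sum.
Qed.

End KernelOfDerivatives.

(** * The universal morphism *)

Section Forms.
Variables (R : realType) (n : nat).
Local Notation E := 'rV[R]_n.
Implicit Types (f g : E -> R) (x : E) (U V W : opens E) (k : 'I_n) (a b : 'I_n -> nat)
  (s : seq 'I_n).

Section OneSolution.
Variables (H : presheaf R E) (j : morphism (C0 R n) H) (delta : 'I_n -> morphism H H).

(** The section delta^a (j f), used with D' and with H in parallel. *)
Definition form V a f (fc : continuous f) : H V :=
  multi_iter (fun k => delta k V) a (j V (C0r V fc)).

Lemma res_C0r U V (VU : V `<=` U) f (fc : continuous f) :
  res (C0 R n) VU (C0r U fc) = C0r V fc.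
Proof.
by apply: C0_ext => x xV; rewrite C0rE//= restrE// restrE//; exact: VU.
Qed.

Lemma res_multi_iter U V (VU : V `<=` U) a (u : H U) :
  res H VU (multi_iter (fun k => delta k U) a u) =
  multi_iter (fun k => delta k V) a (res H VU u).
Proof.
rewrite /multi_iter; elim: (enum _) => //= k s <-.
by elim: (a k) => //= m <-; rewrite component_natural.
Qed.

Lemma res_form U V (VU : V `<=` U) a f (fc : continuous f) :
  res H VU (form U a fc) = form V a fc.
Proof. by rewrite /form res_multi_iter -component_natural res_C0r. Qed.

Hypothesis pr : problem j delta.

Lemma deltaC U h k (u : H U) : delta h U (delta k U u) = delta k U (delta h U u).
Proof. exact: (congr1 (fun m : morphism H H => m U u) (problem_comm pr h k)). Qed.

Lemma delta_form V k a f (fc : continuous f) :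
  delta k V (form V a fc) = form V (fun i => if i == k then (a i).+1 else a i) fc.
Proof.
have dC h i u : delta h V (delta i V u) = delta i V (delta h V u) := deltaC h i u.
by rewrite /form (multi_iterS dC) (multi_iter_op dC).
Qed.

Lemma form_lin V a c f (fc : continuous f) g (gc : continuous g)
    (hc : continuous (fun x => c * f x + g x)) :
  form V a hc = c *: form V a fc + form V a gc.
Proof.
have dl i : linear (delta i V) by exact: component_linear.
rewrite /form -(multi_iter_lin dl) -linearP; congr (multi_iter _ _ (j V _)).
apply: C0_ext => x xV; rewrite C0rE//.
by rewrite -[RHS]/(c * C0_val (C0r V fc) x + C0_val (C0r V gc) x) !C0rE.
Qed.

End OneSolution.

Lemma antiderivative k f : continuous f -> exists2 F, continuous F & pderiv k F f.
Proof.
move=> fc; exists (fun x => primitive (slice f x k) (x ord0 k)).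
  apply: contM; first exact: coord_cont.
  have c : continuous (fun p : E * R => f (upd p.1 k (p.2 * p.1 ord0 k))).
    apply: (cont_comp _ fc); apply: upd_cont; first exact: cont_fst.
    apply: contM; first exact: cont_snd.
    exact: cont_comp (@cont_fst _ _) (@coord_cont _ _ k).
  have h := @iint_cont R E 0 1 (fun (x : E) t => f (upd x k (t * x ord0 k))) ler01 c.
  exact: h.
move=> x; have := is_derive_primitive (x ord0 k) (continuous_slice (x := x) (k := k) fc).
rewrite {2}/slice upd_id => d.
rewrite (_ : slice _ x k = primitive (slice f x k))//.
by apply/funext => t; rewrite /slice upd_eq; congr primitive; apply/funext => u; rewrite upd_upd.
Qed.

(* F does not depend on the solution of the problem. *)
Lemma raise_form s f (fc : continuous f) : exists F (Fc : continuous F),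
  forall (H : presheaf R E) (j : morphism (C0 R n) H) (delta : 'I_n -> morphism H H),
  problem j delta -> forall V a,
    form j delta V a fc = form j delta V (fun i => (a i + count_mem i s)%N) Fc.
Proof.
elim: s f fc => [|k s IH] f fc.
  by exists f, fc => H j delta pr V a; congr (multi_iter _ _ _); apply/funext => i; rewrite addn0.
have [F Fc dF] := antiderivative k fc; have [G [Gc HG]] := IH F Fc.
exists G, Gc => H j delta pr V a.
have dC h i u : delta h V (delta i V u) = delta i V (delta h V u) := deltaC pr h i u.
have -> : form j delta V a fc = form j delta V (fun i => if i == k then (a i).+1 else a i) Fc.
  rewrite /form (multi_iterS dC); congr (multi_iter _ _ _); apply/esym.
  apply: (compat_C0 (problem_compat pr)) => x xV; rewrite C0rE//.
  apply: near_is_derive (dF x).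
  near=> t; rewrite /slice C0rE//.
  by near: t; apply: near_upd; rewrite upd_id.
rewrite (HG _ _ _ pr); congr (multi_iter _ _ _); apply/funext => i /=.
by rewrite [k == i]eq_sym; case: (i == k); rewrite ?add0n// add1n addnS.
Unshelve. all: by end_near. Qed.

(** Here the kernel theorem on the side of D' meets condition (iv) on the side of H. *)
Lemma Dform_eq0 (H : presheaf R E) (j : morphism (C0 R n) H) (delta : 'I_n -> morphism H H) :
  problem j delta -> forall c r a f (fc : continuous f), 0 < r ->
  form (lambda R n) (@dDistr R n) (cube c r) a fc = 0 -> form j delta (cube c r) a fc = 0.
Proof.
move=> pr c r a f fc r0 /(derivatives_eq0_polynomial r0) h.
exact: (problem_poly pr (cube_is_interval c r0) h).
Qed.

Lemma Dform_inj (H : presheaf R E) (j : morphism (C0 R n) H) (delta : 'I_n -> morphism H H) :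
  problem j delta -> forall c r a b f (fc : continuous f) g (gc : continuous g), 0 < r ->
  form (lambda R n) (@dDistr R n) (cube c r) a fc =
  form (lambda R n) (@dDistr R n) (cube c r) b gc ->
  form j delta (cube c r) a fc = form j delta (cube c r) b gc.
Proof.
move=> pr c r a b f fc g gc r0 eD.
(* Raise f by b and g by a, so that both have order a + b; the same F and G serve in D' and in H. *)
have [F [Fc HF]] := raise_form (coord_list b (enum 'I_n)) fc.
have [G [Gc HG]] := raise_form (coord_list a (enum 'I_n)) gc.
have ab : (fun i => (b i + count_mem i (coord_list a (enum 'I_n)))%N) =
    (fun i => (a i + count_mem i (coord_list b (enum 'I_n)))%N).
  by apply/funext => i; rewrite !count_coord_list addnC.
move: eD; have prD := Distr_problem R n.
rewrite (HF _ _ _ prD) (HG _ _ _ prD) (HF _ _ _ pr) (HG _ _ _ pr) ab.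
set e := (fun i => _) => eD.
have hc : continuous (fun x => -1 * F x + G x).
  by apply: contD => //; apply: contM => //; exact: cont_cst.
have h0 : form (lambda R n) (@dDistr R n) (cube c r) e hc = 0.
  by rewrite (@form_lin _ _ _ _ _ _ _ Fc _ Gc hc) eD scaleN1r addNr.
have := Dform_eq0 pr r0 h0; rewrite (@form_lin _ _ _ _ _ _ _ Fc _ Gc hc) scaleN1r addrC.
by move=> /subr0_eq.
Qed.

Lemma cont_row (F : E -> 'I_n -> R) :
  (forall i, continuous (F^~ i)) -> continuous (fun y => \row_i F y i).
Proof.
move=> Fc x A [P xP PA].
have h : \forall y \near x, forall i, P ord0 i (F y i).
  apply: (@filter_forall _ _ _ (nbhs x)) => i.
  by apply: Fc; have := xP ord0 i; rewrite mxE.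
by apply: filterS h => y hy; apply: PA => i j; rewrite (ord1 i) mxE.
Qed.

(** A continuous function on U need not extend to R^n; composing it with the retraction onto a
    closed box inside U extends its restriction to the cube. *)
Lemma clip_exists U f x : x \ino U -> (forall y, y \ino U -> {for y, continuous f}) ->
  exists r g, [/\ 0 < r, cube x r `<=` U, continuous g & forall y, y \ino cube x r -> g y = f y].
Proof.
move=> /nbhs_box[r r0 rU] fc.
pose clip (y : E) : E := \row_i (x ord0 i + Num.max (- r) (Num.min r (y ord0 i - x ord0 i))).
have clipB y : box x r (clip y).
  move=> i; rewrite mxE addrC addrA addNr add0r ler_norml le_max lexx /=.
  by rewrite ge_max ge_min lexx /= ge0_cp// ltW.
have clipc : continuous clip.
  apply: cont_row => i; apply: contD; first exact: cont_cst.
  have hc : continuous (fun y : E => y ord0 i - x ord0 i).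
    by apply: contB; [exact: coord_cont|exact: cont_cst].
  move=> y; have cc (c : R) : {for y, continuous (fun=> c : R^o)} by exact: cst_continuous.
  exact: (continuous_max (cc (- r)) (continuous_min (cc r) (hc y))).
exists r, (f \o clip); split=> //; first by apply: subset_trans rU; exact: cube_sub_box.
  move=> y; apply: continuous_comp; [exact: clipc|exact/fc/rU/clipB].
move=> y yx /=; congr f; apply/rowP => i; rewrite mxE.
have := yx i; rewrite ltr_norml => /andP[h1 h2].
by rewrite min_r ?ltW// max_r ?ltW// addrC subrK.
Qed.

End Forms.

(** * Construction and uniqueness of psi by gluing *)

Section Universal.
Variables (R : realType) (n : nat).
Local Notation E := 'rV[R]_n.
Implicit Types (x : E) (U V W : opens E) (k : 'I_n) (a b : 'I_n -> nat).
Variables (H : presheaf R E) (j : morphism (C0 R n) H) (delta : 'I_n -> morphism H H).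
Hypothesis pr : problem j delta.

Local Notation Dform := (form (lambda R n) (@dDistr R n)).
Local Notation Hform := (form j delta).

(** Uniqueness in the sheaf condition, for the cover by one cube around each point. *)
Lemma section_local_eq U (u v : H U) :
  (forall x, x \ino U -> exists r (VU : cube x r `<=` U), 0 < r /\ res H VU u = res H VU v) ->
  u = v.
Proof.
move=> Hloc.
pose I := {x : E | x \ino U}.
have Hl (i : I) : exists r, 0 < r /\ exists VU : cube (sval i) r `<=` U, res H VU u = res H VU v.
  by have [r [VU [r0 e]]] := Hloc _ (svalP i); exists r; split=> //; exists VU.
have [rad Hrad] := choice Hl.
have VU i : cube (sval i) (rad i) `<=` U by have [_ []] := Hrad i.
have cover : \bigcup_i (cube (sval i) (rad i) : set E) = U.
  apply/seteqP; split=> [x [i _ /VU]//|x xU].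
  by exists (exist _ x xU) => //; apply: cube_center; exact: (Hrad _).1.
have [|t [_ tu]] := problem_sheaf pr VU cover (s := fun i => res H (VU i) u).
  move=> i i'; set W := opensI _ _.
  have WU : W `<=` U by move=> x [/VU].
  by rewrite !(res_comp _ _ WU).
rewrite -(tu u)// -(tu v)// => i.
by have [_ [VU' e]] := Hrad i; rewrite (Prop_irrelevance (VU i) VU').
Qed.

(** The cover is indexed by all local representations of T rather than by one choice per point; the
    glued section then has the expected value on every representation, as [psi_funP] records. *)
Record chart U (T : Distr R n U) := Chart {
  chart_center : E; chart_radius : R; chart_pos : 0 < chart_radius;
  chart_sub : cube chart_center chart_radius `<=` U;
  chart_order : 'I_n -> nat; chart_fun : E -> R; chart_cont : continuous chart_fun;
  chart_eq : res (Distr R n) chart_sub T =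
    Dform (cube chart_center chart_radius) chart_order chart_cont }.

Lemma chart_at U (T : Distr R n U) x : x \ino U ->
  exists i : chart T, chart_center i = x.
Proof.
move=> xU; have [r [f [fc [a [r0 VU e]]]]] := distr_structure T xU.
by exists (Chart r0 (e VU)).
Qed.

Lemma psi_exists U (T : Distr R n U) : exists t : H U, forall i : chart T,
  res H (@chart_sub _ _ i) t = Hform _ (chart_order i) (@chart_cont _ _ i).
Proof.
have cover : \bigcup_(i : chart T) (cube (chart_center i) (chart_radius i) : set E) = U.
  apply/seteqP; split=> [x [i _ /(@chart_sub _ _ i)]//|x xU].
  have [i ix] := chart_at T xU; exists i => //; rewrite ix; apply: cube_center.
  exact: chart_pos.
have [|t [ti _]] := problem_sheaf pr (@chart_sub _ T) cover
  (s := fun i => Hform _ (chart_order i) (@chart_cont _ _ i)); last by exists t.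
(* On an overlap, small cubes carry both representations, and [Dform_inj] compares them. *)
move=> i i'; set W := opensI _ _; apply: section_local_eq => x xW.
have [r r0 rW] := nbhs_box xW.
have XW : cube x r `<=` W by apply: subset_trans rW; exact: cube_sub_box.
exists r, XW; split=> //.
have Xi : cube x r `<=` cube (chart_center i) (chart_radius i) by move=> y /XW[].
have Xi' : cube x r `<=` cube (chart_center i') (chart_radius i') by move=> y /XW[].
rewrite (res_comp _ _ Xi) (res_comp _ _ Xi') !res_form.
apply: (Dform_inj pr r0).
rewrite -(res_form _ _ Xi) -(res_form _ _ Xi') -(chart_eq i) -(chart_eq i').
have XU : cube x r `<=` U by apply: subset_trans Xi (@chart_sub _ _ i).
by rewrite !(res_comp _ _ XU).
Qed.

Definition psi_fun U (T : Distr R n U) : H U := sval (cid (psi_exists T)).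

Lemma psi_funP U (T : Distr R n U) x r (r0 : 0 < r) (VU : cube x r `<=` U) a f
    (fc : continuous f) :
  res (Distr R n) VU T = Dform _ a fc -> res H VU (psi_fun T) = Hform _ a fc.
Proof. by move=> e; exact: (svalP (cid (psi_exists T)) (Chart r0 e)). Qed.

(** Each remaining property of psi is an identity of sections; by this lemma a single representation
    of T near each point suffices to prove it. *)
Lemma psi_unique U (T : Distr R n U) (t : H U) :
  (forall x, x \ino U -> exists r (VU : cube x r `<=` U) a f (fc : continuous f),
    [/\ 0 < r, res (Distr R n) VU T = Dform _ a fc & res H VU t = Hform _ a fc]) ->
  t = psi_fun T.
Proof.
move=> Ht; apply: section_local_eq => x /Ht[r [VU [a [f [fc [r0 e1 e2]]]]]].
by exists r, VU; split=> //; rewrite e2 (psi_funP r0 e1).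
Qed.

Lemma psi_linear U : linear (@psi_fun U).
Proof.
move=> c S T; apply/esym; apply: psi_unique => x xU.
have [r [f [fc [a [r0 VU e]]]]] := distr_structure S xU.
have [r' [g [gc [b [r'0 VU' e']]]]] := distr_structure T xU.
pose q := Num.min r r'; have q0 : 0 < q by rewrite lt_min r0.
have qV : cube x q `<=` cube x r.
  by move=> y yx i; apply: lt_le_trans (yx i) _; rewrite ge_min lexx.
have qV' : cube x q `<=` cube x r'.
  by move=> y yx i; apply: lt_le_trans (yx i) _; rewrite ge_min lexx orbT.
have qU : cube x q `<=` U by exact: subset_trans VU.
(* A linear combination of two representations needs a common order, here a + b. *)
have [F [Fc HF]] := raise_form (coord_list b (enum 'I_n)) fc.
have [G [Gc HG]] := raise_form (coord_list a (enum 'I_n)) gc.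
have ab : (fun i => (b i + count_mem i (coord_list a (enum 'I_n)))%N) =
    (fun i => (a i + count_mem i (coord_list b (enum 'I_n)))%N).
  by apply/funext => i; rewrite !count_coord_list addnC.
have prD := Distr_problem R n.
have hc : continuous (fun x => c * F x + G x).
  by apply: contD => //; apply: contM => //; exact: cont_cst.
have eS : res (Distr R n) qU S = Dform _ a fc by rewrite -(res_comp VU qV) (e VU) res_form.
have eT : res (Distr R n) qU T = Dform _ b gc by rewrite -(res_comp VU' qV') (e' VU') res_form.
exists q, qU, (fun i => (a i + count_mem i (coord_list b (enum 'I_n)))%N), _, hc; split=> //.
- rewrite (@res_linear _ _ (Distr R n) _ _ qU) eS eT (HF _ _ _ prD) (HG _ _ _ prD) ab.
  by rewrite (@form_lin _ _ _ _ _ _ _ _ _ Fc _ Gc hc).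
- rewrite (@res_linear _ _ H _ _ qU) (psi_funP q0 eS) (psi_funP q0 eT) (HF _ _ _ pr) (HG _ _ _ pr) ab.
  by rewrite (@form_lin _ _ _ _ _ _ _ _ _ Fc _ Gc hc).
Qed.

Lemma psi_natural U V (VU : V `<=` U) (T : Distr R n U) :
  psi_fun (res (Distr R n) VU T) = res H VU (psi_fun T).
Proof.
apply/esym; apply: psi_unique => x xV.
have [r [f [fc [a [r0 XV e]]]]] := distr_structure (res (Distr R n) VU T) xV.
exists r, XV, a, f, fc; split; [by []|exact: e|].
have XU : cube x r `<=` U by exact: subset_trans XV VU.
rewrite (res_comp _ _ XU); apply: (psi_funP r0).
by rewrite -(res_comp VU XV) e.
Qed.

Definition psi : morphism (Distr R n) H := Morphism psi_linear psi_natural.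

Lemma multi_iter0 (X : Type) (op : 'I_n -> X -> X) (u : X) :
  multi_iter op (fun=> 0%N) u = u.
Proof. by rewrite /multi_iter; elim: (enum _) => //= k s ->. Qed.

Lemma psi_lambda : psi \oM lambda R n = j.
Proof.
apply: morphismP => U f; apply/esym; apply: psi_unique => x xU.
have [r [g [r0 VU gc gf]]] := clip_exists xU (C0P f).1.
have gE : res (C0 R n) VU f = C0r (cube x r) gc.
  by apply: C0_ext => y yV; rewrite C0rE// [LHS]restrE// gf.
exists r, VU, (fun=> 0%N), g, gc; split=> //.
- by rewrite /form multi_iter0 -gE component_natural.
- by rewrite /form multi_iter0 -gE component_natural.
Qed.

Lemma psi_delta k : psi \oM dDistr R k = delta k \oM psi.
Proof.
apply: morphismP => U T; apply/esym; apply: psi_unique => x xU.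
have [r [f [fc [a [r0 VU e]]]]] := distr_structure T xU.
exists r, VU, (fun i => if i == k then (a i).+1 else a i), f, fc; split=> //.
- by rewrite -component_natural e (delta_form (Distr_problem R n)).
- by rewrite [LHS]/= -component_natural (psi_funP r0 (e VU)) (delta_form pr).
Qed.

(** On a cube, psi' (D^a (lambda f)) = delta^a (psi' (lambda f)) = delta^a (j f) leaves no
    choice. *)
Lemma psi_is_unique (psi' : morphism (Distr R n) H) :
  psi' \oM lambda R n = j -> (forall k, psi' \oM dDistr R k = delta k \oM psi') ->
  psi = psi'.
Proof.
move=> hl hd; apply: morphismP => U T; apply/esym; apply: psi_unique => x xU.
have [r [f [fc [a [r0 VU e]]]]] := distr_structure T xU.
exists r, VU, a, f, fc; split; [by []|exact: e|].
rewrite -component_natural (e VU) /form /multi_iter.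
have dE k V (u : Distr R n V) : psi' V (dDistr R k V u) = delta k V (psi' V u).
  exact: (congr1 (fun m : morphism (Distr R n) H => m V u) (hd k)).
elim: (enum _) => [|k s /= <-].
  exact: (congr1 (fun m : morphism (C0 R n) H => m _ (C0r (cube x r) fc)) hl).
by elim: (a k) => //= m <-; rewrite dE.
Qed.

End Universal.

Theorem theorem7 (R : realType) (n : nat) (n1 : (1 <= n)%N) :
  @problem R n (Distr R n) (lambda R n) (@dDistr R n) /\
  forall (H : presheaf R 'rV[R]_n) (j : morphism (C0 R n) H)
    (delta : 'I_n -> morphism H H),
    problem j delta ->
    exists! psi : morphism (Distr R n) H,
      psi \oM lambda R n = j /\
      forall k : 'I_n, psi \oM dDistr R k = delta k \oM psi.
Proof.
split=> [|H j delta pr]; first exact: Distr_problem.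
exists (psi pr); split=> [|psi' [hl hd]]; last exact: psi_is_unique.
by split=> [|k]; [exact: psi_lambda|exact: psi_delta].
Qed.
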